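(* Let $X$ be a UMD Banach space and let $1<p<\infty$. There exist an angle $\theta_{p,X}\in(0,\pi/2)$ and a constant $C_{p,X}\ge0$ such that, for every integer $N\ge1$, the Walsh semigroup $T_N$ on $L^p(\{-1,1\}^N;X)$ is bounded analytic on $\Sigma_{\theta_{p,X}}$ and $$\mathcal R_{L^p(\{-1,1\}^N;X)}\bigl(\{T_N(z):z\in\Sigma_{\theta_{p,X}}\}\bigr)\le C_{p,X}.$$ In particular, the operators $\Delta_N$, $N\ge 1$, are uniformly $R$-sectorial with a common angle smaller than $\pi/2$.
   Context: All Banach spaces are complex. A Banach space $X$ is UMD if for some (equivalently, all) $1<p<\infty$ there is a constant $\beta$ such that $\|\sum_{j=1}^n\epsilon_jd_j\|_{L^p(X)}\le\beta\|\sum_{j=1}^nd_j\|_{L^p(X)}$ for every finite $X$-valued martingale difference sequence $(d_j)_{j=1}^n$ in $L^p$ and all complex scalars with $|\epsilon_j|=1$. $\{-1,1\}^N$ carries the uniform probability measure. For $A\subseteq\{1,\dots,N\}$, $w_A(x)=\prod_{i\in A}x_i$ (with $w_\varnothing=1$). Every $f:\{-1,1\}^N\to X$ is uniquely of the form $\sum_Aw_Ax_A$ with $x_A\in X$. The Walsh number operator is $\Delta_N(\sum_Aw_Ax_A)=\sum_A|A|w_Ax_A$, and the Walsh semigroup is $T_N(t)=e^{-t\Delta_N}$, $t\ge0$, i.e. $T_N(t)(\sum_Aw_Ax_A)=\sum_Ae^{-t|A|}w_Ax_A$. For $0<\theta<\pi$, $\Sigma_\theta=\{z\in\mathbb C\setminus\{0\}:|\arg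 z|<\theta\}$. A semigroup is bounded analytic on $\Sigma_\theta$ if it extends from $(0,\infty)$ to a bounded holomorphic operator-valued function on $\Sigma_\theta$ satisfying the semigroup law and strongly continuous at $0$ within the sector. A Rademacher sequence $(\varepsilon_j)$ is a sequence of independent random variables uniformly distributed on the unit circle in $\mathbb C$ (Steinhaus variables). A family $\mathscr T$ of bounded operators on a Banach space $E$ is $R$-bounded if there is $C\ge0$ with $(\mathbb E\|\sum_{j=1}^n\varepsilon_jT_jx_j\|^2)^{1/2}\le C(\mathbb E\|\sum_{j=1}^n\varepsilon_jx_j\|^2)^{1/2}$ for all $n$, $T_j\in\mathscr T$, $x_j\in E$; the least such $C$ is $\mathcal R_E(\mathscr T)$. An operator $A$ is $R$-sectorial of angle $\omega$ if $\sigma(A)\subseteq\overline{\Sigma_\omega}$ and for every $\theta\in(\omega,\pi)$ the family $\{\lambda(\lambda-A)^{-1}:\lambda\notin\overline{\Sigma_\theta}\}$ is $R$-bounded; ''uniformly $R$-sectorial with a common angle smaller than $\pi/2$'' means that a single $\omega<\pi/2$ works for all $N$, with $R$-bounds independent of $N$. *)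

(* Defs.v *)
From HB Require Import structures.
From mathcomp Require Import all_boot all_order all_algebra complex.
From mathcomp Require Import all_classical all_reals all_analysis.
From mathcomp Require Import measurable_realfun ring.

Set Implicit Arguments.
Unset Strict Implicit.
Unset Printing Implicit Defensive.

Import Order.TTheory GRing.Theory Num.Theory.
Import numFieldNormedType.Exports.

Local Open Scope classical_set_scope.
Local Open Scope complex_scope.
Local Open Scope ring_scope.

(* MathComp norms over the field R[i] are (real, nonnegative) elements of
   R[i]; rnorm is the same norm with values in R. *)
Definition rnorm (R : realType) (E : normedModType R[i]) (x : E) : R :=
  complex.Re `|x|.

Section RealNorm.
Context {R : realType} {E : normedModType R[i]}.
Implicit Types x y : E.

Lemma rnormE x : `|x| = (rnorm x)%:C.
Proof. by rewrite /rnorm RRe_real// normr_real. Qed.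

Lemma rnorm_ge0 x : 0 <= rnorm x.
Proof. by rewrite -lecR -rnormE; exact: normr_ge0. Qed.

Lemma ler_rnormD x y : rnorm (x + y) <= rnorm x + rnorm y.
Proof. by rewrite -lecR rmorphD/= -!rnormE ler_normD. Qed.

Lemma rnormZ (l : R[i]) x : rnorm (l *: x) = complex.Re `|l| * rnorm x.
Proof.
apply/complexI; rewrite rmorphM/= -!rnormE normrZ.
by congr (_ * _); rewrite RRe_real// normr_real.
Qed.

End RealNorm.

Definition Lp_norm (R : realType) (d : measure_display) (T : measurableType d)
    (P : probability T R) (E : normedModType R[i]) (p : R) (f : T -> E) :=
  'N[P]_p%:E[EFin \o (@rnorm R E \o f)]%E.

Section StrongMeasurability.
Context {R : realType} {T : Type} {X : normedModType R[i]}.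
Implicit Types (G : set (set T)) (s f : T -> X).

Definition simple_fct G s :=
  finite_set (range s) /\ forall x, G (s @^-1` [set x]).

Definition strongly_measurable G f :=
  exists s : nat -> T -> X, (forall k, simple_fct G (s k)) /\
    forall t, s k t @[k --> \oo] --> f t.

End StrongMeasurability.

Section Bochner.
Context {R : realType} {d : measure_display} {T : measurableType d}
        {X : normedModType R[i]}.
Variable P : probability T R.
Implicit Types (A : set T) (s f : T -> X).

Definition simple_integral A s : X :=
  \sum_(x \in range s) (fine (P (A `&` s @^-1` [set x])))%:C *: x.

Definition bochner_integral A f (y : X) :=
  exists s : nat -> T -> X,
    [/\ forall k, simple_fct measurable (s k),
        (\int[P]_t (rnorm (f t - s k t))%:E)%E @[k --> \oo] --> 0%E &
        simple_integral A (s k) @[k --> \oo] --> y].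

(* The sequence d_0, ..., d_(n-1) is adapted to F_1, ..., F_n, and
   E(d_j | F_j) = 0 is expressed by the vanishing of the integral of d_j over
   every set of F_j. *)
Definition martingale_difference (p : R) (n : nat) (F : nat -> set (set T))
    (df : 'I_n -> T -> X) :=
  [/\ forall k, sigma_algebra setT (F k) /\ F k `<=` measurable,
      forall k, F k `<=` F k.+1,
      forall j : 'I_n, strongly_measurable (F j.+1) (df j),
      forall j : 'I_n, (Lp_norm P p (df j) < +oo)%E &
      forall (j : 'I_n) A, F j A -> bochner_integral A (df j) 0].

End Bochner.

Definition UMD (R : realType) (X : completeNormedModType R[i]) :=
  exists p : R, 1 < p /\ exists beta : R,
    forall (d : measure_display) (T : measurableType d) (P : probability T R)
      (n : nat) (F : nat -> set (set T)) (df : 'I_n -> T -> X)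
      (eps : 'I_n -> R[i]),
      martingale_difference P p F df -> (forall j, `|eps j| = 1) ->
      (Lp_norm P p (fun t => (\sum_(j < n) eps j *: df j t)%R) <=
       beta%:E * Lp_norm P p (fun t => (\sum_(j < n) df j t)%R))%E.

(* For theta <= pi this is {z != 0 : |arg z| < theta}, in polar form. *)
Definition sector (R : realType) (theta : R) : set R[i] :=
  [set z | exists r phi : R,
     [/\ 0 < r, `|phi| < theta & z = (r * cos phi) +i* (r * sin phi)]].

Definition closed_sector (R : realType) (theta : R) : set R[i] :=
  closure (sector theta : set (R[i])^o).

Section Steinhaus.
Context {R : realType} {d : measure_display} {T : measurableType d}.
Variable P : probability T R.

(* The Borel structure of the complex plane is that of R * R. *)
Definition Re_Im (e : T -> R[i]) (t : T) :
    measurableTypeR R * measurableTypeR R :=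
  (complex.Re (e t), complex.Im (e t)).

Definition uniform_on_circle (e : T -> R[i]) :=
  measurable_fun setT (Re_Im e) /\
  forall B : set (measurableTypeR R * measurableTypeR R), measurable B ->
    P (Re_Im e @^-1` B) =
    uniform_prob (@ltr01 R)
      [set u : R | B (cos (2 * pi * u), sin (2 * pi * u))].

(* Taking some of the B j equal to setT gives the product rule for all
   subfamilies. *)
Definition independent_complex (n : nat) (e : 'I_n -> T -> R[i]) :=
  forall B : 'I_n -> set (measurableTypeR R * measurableTypeR R),
    (forall j, measurable (B j)) ->
    P (\bigcap_j (Re_Im (e j) @^-1` B j)) =
    (\prod_(j < n) P (Re_Im (e j) @^-1` B j))%E.

Definition rademacher (n : nat) (e : 'I_n -> T -> R[i]) :=
  (forall j, uniform_on_circle (e j)) /\ independent_complex e.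

End Steinhaus.

Section RademacherExists.
Context {R : realType}.
Let U : probability (measurableTypeR R) R := uniform_prob (@ltr01 R).
Let circ (u : measurableTypeR R) : R[i] :=
  cos (2 * pi * u) +i* sin (2 * pi * u).

Let mcirc : measurable_fun setT (Re_Im circ).
Proof.
have h (f : R -> R) : continuous f -> continuous (fun u : R => f (2 * pi * u)).
  by move=> cf u; apply: continuous_comp; [exact: mulrl_continuous|exact: cf].
apply/measurable_fun_pairP; split.
  exact: (continuous_measurable_fun (h _ (@continuous_cos R))).
exact: (continuous_measurable_fun (h _ (@continuous_sin R))).
Qed.

(* R_bounded_by below quantifies over all Rademacher sequences; they exist. *)
Lemma rademacher_exists (n : nat) :
  exists (d : measure_display) (T : measurableType d) (P : probability T R)
    (e : 'I_n -> T -> R[i]), rademacher P e.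
Proof.
elim: n => [|n [d [T [P [e [ue ie]]]]]].
  exists _, (measurableTypeR R), U, (fun _ _ => 0).
  split=> [[]//|B mB]; rewrite big_ord0.
  rewrite (_ : \bigcap_j _ = setT) ?probability_setT//.
  by apply/seteqP; split => // t _ [].
exists _, (T * measurableTypeR R)%type, (P \x U)%E.
exists (fun j w => if unlift ord_max j is Some i then e i w.1 else circ w.2).
set e' := (X in rademacher _ X).
pose C (j : 'I_n.+1) (B : set (measurableTypeR R * measurableTypeR R)) :=
  Re_Im (e' j) @^-1` B.
have preS (i : 'I_n) B : C (lift ord_max i) B = (Re_Im (e i) @^-1` B) `*` setT.
  rewrite /C /e' /Re_Im/=; apply/seteqP; split => -[t u]/=;
    by rewrite ?liftK //; tauto.
have pre0 B : C ord_max B = setT `*` (Re_Im circ @^-1` B).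
  rewrite /C /e' /Re_Im/=; apply/seteqP; split => -[t u]/=;
    by rewrite ?unlift_none //; tauto.
have me i B : measurable B -> measurable (Re_Im (e i) @^-1` B).
  by move=> mB; rewrite -[X in measurable X]setTI; exact: (ue i).1.
have mc B : measurable B -> measurable (Re_Im circ @^-1` B).
  by move=> mB; rewrite -[X in measurable X]setTI; exact: mcirc.
have PS i B : measurable B ->
    (P \x U)%E (C (lift ord_max i) B) = P (Re_Im (e i) @^-1` B).
  move=> mB; rewrite preS product_measure1E//; last exact: me.
  by rewrite -[RHS]mule1; congr (_ * _)%E; exact: (probability_setT U).
have P0 B : measurable B -> (P \x U)%E (C ord_max B) = U (Re_Im circ @^-1` B).
  move=> mB; rewrite pre0 product_measure1E//; last exact: mc.
  by rewrite -[RHS]mul1e; congr (_ * _)%E; exact: (probability_setT P).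
split=> [j|B mB].
  split.
    move=> _ B mB; rewrite setTI -/(C j B).
    case: (unliftP ord_max j) => [i|] ->.
      by rewrite preS; apply: measurableX => //; exact: me.
    by rewrite pre0; apply: measurableX => //; exact: mc.
  move=> B mB; rewrite -/(C j B); case: (unliftP ord_max j) => [i|] ->.
    exact: (etrans (PS _ _ mB) ((ue i).2 _ mB)).
  exact: (P0 _ mB).
have -> : \bigcap_j (Re_Im (e' j) @^-1` B j) =
    (\bigcap_i (Re_Im (e i) @^-1` B (lift ord_max i))) `*`
    (Re_Im circ @^-1` B ord_max).
  apply/seteqP; split => -[t u].
    move=> h; split => /=.
      by move=> i _; have := h (lift ord_max i) I; rewrite -/(C _ _) preS => -[].
    by have := h ord_max I; rewrite -/(C _ _) pre0 => -[].
  move=> [/= h1 h2] j _; rewrite -/(C j (B j)).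
  by case: (unliftP ord_max j) => [i|] ->; rewrite ?preS ?pre0; split => //; exact: h1.
transitivity (P (\bigcap_i (Re_Im (e i) @^-1` B (lift ord_max i))) *
    U (Re_Im circ @^-1` B ord_max))%E.
  apply: product_measure1E; last exact: mc.
  by apply: fin_bigcap_measurable => // i _; exact: me.
rewrite (ie _ (fun i => mB (lift ord_max i))) big_ord_recr/=.
congr (_ * _)%E; last by apply/esym; exact: (P0 _ (mB _)).
apply: eq_bigr => i _; have -> : widen_ord (leqnSn n) i = lift ord_max i.
  by apply/val_inj; rewrite /= /bump leqNgt ltn_ord.
by apply/esym; exact: (PS _ _ (mB _)).
Qed.
End RademacherExists.

Section Operators.
Context {R : realType} {E : normedModType R[i]}.
Implicit Types (T A B : E -> E) (F : set (E -> E)).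

Definition bounded_operator T :=
  linear T /\ exists M : R, forall x, rnorm (T x) <= M * rnorm x.

Definition R_bounded_by F (C : R) :=
  [/\ 0 <= C, F `<=` bounded_operator &
    forall (n : nat) (T : 'I_n -> E -> E) (x : 'I_n -> E)
      (d : measure_display) (Omega : measurableType d)
      (P : probability Omega R) (eps : 'I_n -> Omega -> R[i]),
      (forall j, F (T j)) -> rademacher P eps ->
      (Lp_norm P 2 (fun w => (\sum_(j < n) eps j w *: T j (x j))%R) <=
       C%:E * Lp_norm P 2 (fun w => (\sum_(j < n) eps j w *: x j)%R))%E].

(* Equal to +oo when F is not R-bounded. *)
Definition R_bound F : \bar R := ereal_inf (EFin @` R_bounded_by F).

(* Complex differentiability, in the operator norm, at every point of D. *)
Definition operator_holomorphic (D : set R[i]) (S : R[i] -> E -> E) :=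
  forall z, D z -> exists L : E -> E, bounded_operator L /\
    forall e : R, 0 < e -> exists delta : R, 0 < delta /\
      forall h : R[i], `|h| < delta%:C -> D (z + h) -> forall x : E,
        `|S (z + h) x - S z x - h *: L x| <= e%:C * `|h| * `|x|.

Definition bounded_analytic_extension (theta : R) (T : R -> E -> E)
    (S : R[i] -> E -> E) :=
  [/\ forall t : R, 0 < t -> S t%:C =1 T t,
      (forall z, sector theta z -> linear (S z)) /\
      (exists M : R, forall z, sector theta z ->
         forall x, rnorm (S z x) <= M * rnorm x),
      operator_holomorphic (sector theta) S,
      forall z w, sector theta z -> sector theta w -> sector theta (z + w) ->
        S (z + w) =1 S z \o S w &
      forall x, S z x @[z --> within (sector theta) (nbhs (0 : (R[i])^o))]
        --> x].

Definition is_resolvent A (l : R[i]) B :=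
  [/\ bounded_operator B, forall x, l *: B x - A (B x) = x &
      forall x, B (l *: x - A x) = x].

Definition spectrum A : set R[i] := [set l | ~ exists B, is_resolvent A l B].

(* The operators l (l - A)^-1, for l outside the closed sector. *)
Definition resolvent_family A (theta : R) : set (E -> E) :=
  [set T | exists l B, [/\ ~ closed_sector theta l, is_resolvent A l B &
                           T = fun x => l *: B x]].

End Operators.

Definition uniformly_R_sectorial (R : realType) (I : Type)
    (E : I -> normedModType R[i]) (A : forall i, E i -> E i) (omega : R) :=
  (forall i, spectrum (A i) `<=` closed_sector omega) /\
  forall theta : R, omega < theta < pi -> exists C : R, forall i,
    (R_bound (resolvent_family (A i) theta) <= C%:E)%E.

(* The boolean b encodes the sign (-1) ^+ b. *)
Definition cube (N : nat) := {ffun 'I_N -> bool}.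

Section Walsh.
Context {R : realType} {X : lmodType R[i]} {N : nat}.
Implicit Types (f : {ffun cube N -> X}) (A : {set 'I_N}) (x : cube N).

Definition walsh A x : R[i] := \prod_(i in A) (-1) ^+ x i.

Definition walsh_coef f A : X :=
  (2 ^+ N)^-1 *: \sum_(x : cube N) walsh A x *: f x.

Lemma sum_walsh_x x y :
  \sum_(A : {set 'I_N}) walsh A x * walsh A y = 2 ^+ N * (x == y)%:R.
Proof.
pose g (i : 'I_N) : R[i] := (-1) ^+ x i * (-1) ^+ y i.
transitivity (\prod_i (g i + 1)).
  rewrite bigA_distr; apply: eq_bigr => A _.
  by rewrite /walsh -big_split [LHS]big_mkcond.
have [xy|/eqP neq] := eqVneq x y.
  rewrite mulr1 (eq_bigr (fun=> 2)); first by rewrite prodr_const card_ord.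
  by move=> i _; rewrite /g xy -signr_addb addbb.
rewrite mulr0; case: (pickP (fun i => x i != y i)) => [i xy|e]; last first.
  by case: neq; apply/ffunP => i; have /negbFE/eqP := e i.
rewrite (bigD1 i)//= /g; case: (x i) (y i) xy => -[]//= _.
  by rewrite expr1 expr0 mulr1 addNr mul0r.
by rewrite expr1 expr0 mul1r addNr mul0r.
Qed.

Lemma sum_walsh_A A B :
  \sum_(x : cube N) walsh A x * walsh B x = 2 ^+ N * (A == B)%:R.
Proof.
pose h (i : 'I_N) (b : bool) : R[i] :=
  (if i \in A then (-1) ^+ b else 1) * (if i \in B then (-1) ^+ b else 1).
transitivity (\prod_i \sum_b h i b).
  rewrite bigA_distr_bigA; apply: eq_bigr => x _.
  by rewrite /walsh big_split; congr (_ * _); rewrite big_mkcond.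
have hE i : \sum_b h i b = 2 * ((i \in A) == (i \in B))%:R.
  rewrite big_bool /h; case: (i \in A); case: (i \in B) => /=;
    rewrite ?expr1 ?expr0 ?mulrN1 ?opprK ?mulr1 ?mulr0 ?addNr//.
rewrite (eq_bigr _ (fun i _ => hE i)) big_split /= prodr_const card_ord.
congr (_ * _); have [->|/eqP neq] := eqVneq A B.
  by rewrite big1// => i _; rewrite eqxx.
case: (pickP (fun i => (i \in A) != (i \in B))) => [i AB|e]; last first.
  by case: neq; apply/setP => i; have /negbFE/eqP := e i.
by rewrite (bigD1 i)//= (negbTE AB) mul0r.
Qed.

Lemma walsh_expansion f x : f x = \sum_A walsh A x *: walsh_coef f A.
Proof.
have N0 : (2 ^+ N : R[i]) != 0 by rewrite expf_neq0// pnatr_eq0.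
transitivity
  (\sum_(y : cube N) ((2 ^+ N)^-1 * (2 ^+ N * (x == y)%:R)) *: f y).
  rewrite (bigD1 x)//= eqxx mulr1 mulVf// scale1r big1 ?addr0// => y.
  by rewrite eq_sym => /negbTE ->; rewrite !mulr0 scale0r.
under eq_bigr do rewrite -sum_walsh_x mulr_sumr scaler_suml.
rewrite exchange_big; apply: eq_bigr => A _ /=.
rewrite scalerA scaler_sumr; apply: eq_bigr => y _.
by rewrite scalerA mulrCA mulrA.
Qed.

Lemma walsh_coef_unique f (c : {set 'I_N} -> X) :
  (forall x, f x = \sum_A walsh A x *: c A) -> walsh_coef f =1 c.
Proof.
move=> fE B; have N0 : (2 ^+ N : R[i]) != 0 by rewrite expf_neq0// pnatr_eq0.
rewrite /walsh_coef; under eq_bigr do rewrite fE scaler_sumr.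
rewrite exchange_big /= (bigD1 B)//= [X in _ + X]big1 ?addr0.
  under eq_bigr do rewrite scalerA.
  by rewrite -scaler_suml sum_walsh_A eqxx mulr1 scalerA mulVf// scale1r.
move=> A AB; under eq_bigr do rewrite scalerA.
by rewrite -scaler_suml sum_walsh_A eq_sym (negbTE AB) mulr0 scale0r.
Qed.

Definition walsh_number f : {ffun cube N -> X} :=
  [ffun x => \sum_(A : {set 'I_N}) (#|A|%:R * walsh A x) *: walsh_coef f A].

Definition walsh_semigroup (t : R) f : {ffun cube N -> X} :=
  [ffun x => \sum_(A : {set 'I_N})
     ((expR (- t * #|A|%:R))%:C * walsh A x) *: walsh_coef f A].

End Walsh.

(* Functions on the cube with the norm of L^p for the uniform probability. *)
Definition Lp_cube (R : realType) (X : normedModType R[i]) (p : R)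
  (p1 : 1 < p) (N : nat) : Type := {ffun cube N -> X}.

Section LpCube.
Context {R : realType} {X : normedModType R[i]} {p : R} (p1 : 1 < p) {N : nat}.
Local Notation E := (Lp_cube X p1 N).

HB.instance Definition _ := GRing.Lmodule.copy E {ffun cube N -> X}.

Definition Lp_cube_mean (f : E) : R :=
  (2 ^+ N)^-1 * \sum_(x : cube N) rnorm (f x) `^ p.

Definition Lp_cube_norm (f : E) : R := Lp_cube_mean f `^ p^-1.

Let p0 : 0 < p. Proof. exact: lt_trans p1. Qed.

Lemma Lp_cube_mean_ge0 f : 0 <= Lp_cube_mean f.
Proof.
by rewrite mulr_ge0 ?invr_ge0 ?exprn_ge0// sumr_ge0// => x _; rewrite powR_ge0.
Qed.

Lemma Lp_cube_norm_ge0 f : 0 <= Lp_cube_norm f.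
Proof. exact: powR_ge0. Qed.

Lemma Lp_cube_norm_powR f : Lp_cube_norm f `^ p = Lp_cube_mean f.
Proof. by rewrite -powRrM mulVf ?gt_eqF// powRr1// Lp_cube_mean_ge0. Qed.

Lemma Lp_cube_normZ (l : R[i]) f :
  Lp_cube_norm (l *: f) = complex.Re `|l| * Lp_cube_norm f.
Proof.
have l0 : 0 <= complex.Re `|l| by rewrite -lecR RRe_real ?normr_real//; exact: normr_ge0.
rewrite /Lp_cube_norm.
have -> : Lp_cube_mean (l *: f) = complex.Re `|l| `^ p * Lp_cube_mean f.
  rewrite /Lp_cube_mean [RHS]mulrCA [in RHS]mulr_sumr; congr (_ * _).
  by apply: eq_bigr => x _; rewrite ffunE rnormZ powRM// rnorm_ge0.
rewrite powRM ?powR_ge0 ?Lp_cube_mean_ge0//.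
by rewrite -powRrM divff ?gt_eqF// powRr1.
Qed.

Lemma Lp_cube_norm_eq0 f : Lp_cube_norm f = 0 -> f = 0.
Proof.
move=> f0; have : Lp_cube_mean f = 0.
  by rewrite -Lp_cube_norm_powR f0 powR0// gt_eqF.
move=> /eqP; rewrite mulf_eq0 invr_eq0 expf_eq0 pnatr_eq0 andbF/=.
rewrite psumr_eq0; last by move=> x _; rewrite powR_ge0.
move=> /allP h; apply/ffunP => x; rewrite ffunE.
have /eqP := h x (mem_index_enum x).
rewrite /= => /powR_eq0_eq0 r0; apply/normr0_eq0.
by rewrite rnormE r0.
Qed.

(* Minkowski's inequality, by convexity of the p-th power. *)
Lemma ler_Lp_cube_normD f g :
  Lp_cube_norm (f + g) <= Lp_cube_norm f + Lp_cube_norm g.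
Proof.
have [f0|an0] := eqVneq (Lp_cube_norm f) 0.
  by rewrite f0 (Lp_cube_norm_eq0 f0) !add0r.
have [g0|bn0] := eqVneq (Lp_cube_norm g) 0.
  by rewrite g0 (Lp_cube_norm_eq0 g0) !addr0.
have [a aE] : {a | a = Lp_cube_norm f} by exists (Lp_cube_norm f).
have [b bE] : {b | b = Lp_cube_norm g} by exists (Lp_cube_norm g).
rewrite -aE -bE.
have a0 : 0 < a by rewrite aE lt_def an0 Lp_cube_norm_ge0.
have b0 : 0 < b by rewrite bE lt_def bn0 Lp_cube_norm_ge0.
have ab : 0 < a + b by rewrite addr_gt0.
have t0 : 0 <= a / (a + b) by rewrite divr_ge0 ?ltW.
have t1 : a / (a + b) <= 1 by rewrite ler_pdivrMr// mul1r lerDl ltW.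
have powV c : 0 < c -> c^-1 `^ p = (c `^ p)^-1.
  move=> c0; apply: (mulIf (lt0r_neq0 (powR_gt0 p c0))).
  by rewrite -powRM ?invr_ge0 ?(ltW c0)// !mulVf ?powR1 ?gt_eqF ?powR_gt0.
have key u v : 0 <= u -> 0 <= v -> (u + v) `^ p <=
    (a + b) `^ p * (a / (a + b) * (u `^ p / a `^ p) +
                    b / (a + b) * (v `^ p / b `^ p)).
  move=> u0 v0; have ua0 : 0 <= u / a by rewrite divr_ge0// ltW.
  have vb0 : 0 <= v / b by rewrite divr_ge0// ltW.
  have := @convex_powR R p (ltW p1) (Itv01 t0 t1) (u / a) (v / b).
  rewrite !inE/= !in_itv/= !andbT => /(_ ua0 vb0).
  rewrite !convRE /= -[conv _ _ _]/(_ * _ + _ * _) /=.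
  have -> : unstable.onem (a / (a + b)) = b / (a + b).
    by rewrite /unstable.onem; field; rewrite gt_eqF.
  have -> : a / (a + b) * (u / a) + b / (a + b) * (v / b) = (u + v) / (a + b).
    by field; rewrite !gt_eqF.
  rewrite !powRM ?addr_ge0 ?invr_ge0 ?(ltW a0) ?(ltW b0) ?(ltW ab)//.
  rewrite !powV// => h.
  by rewrite mulrC -ler_pdivrMr ?powR_gt0.
have mfg : Lp_cube_mean (f + g) <= (a + b) `^ p.
  have N0 : 0 <= (2 ^+ N)^-1 :> R by rewrite invr_ge0 exprn_ge0.
  pose F x := (a + b) `^ p * (a / (a + b) * (rnorm (f x) `^ p / a `^ p) +
                              b / (a + b) * (rnorm (g x) `^ p / b `^ p)).
  apply: (@le_trans _ _ ((2 ^+ N)^-1 * \sum_(x : cube N) F x)).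
    rewrite ler_wpM2l// ler_sum// => x _.
    apply: le_trans (key _ _ (rnorm_ge0 _) (rnorm_ge0 _)).
    by rewrite ffunE ge0_ler_powR ?nnegrE ?addr_ge0 ?rnorm_ge0 ?(ltW p0)
      ?ler_rnormD.
  rewrite /F -mulr_sumr big_split/= -!mulr_sumr -!mulr_suml.
  have -> (u v w y z c s t : R) : u * (v * (w * (y * c) + z * (s * t))) =
      v * (w * (u * y * c) + z * (u * s * t)) by ring.
  rewrite -[X in _ * (_ * (X / _) + _)]/(Lp_cube_mean f).
  rewrite -[X in _ * (_ + _ * (X / _))]/(Lp_cube_mean g).
  rewrite -!Lp_cube_norm_powR -aE -bE !divff ?gt_eqF ?powR_gt0//.
  by rewrite !mulr1 -mulrDl divff ?mulr1// gt_eqF.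
have -> : a + b = ((a + b) `^ p) `^ p^-1.
  by rewrite -powRrM divff ?gt_eqF// powRr1// ltW.
by rewrite ge0_ler_powR ?nnegrE ?Lp_cube_mean_ge0 ?powR_ge0// invr_ge0 ltW.
Qed.

Lemma Lp_cube_normC_eq0 f : (Lp_cube_norm f)%:C = 0 -> f = 0.
Proof. by move/complexI/Lp_cube_norm_eq0. Qed.

Lemma ler_Lp_cube_normCD f g :
  (Lp_cube_norm (f + g))%:C <= (Lp_cube_norm f)%:C + (Lp_cube_norm g)%:C.
Proof. by rewrite -rmorphD lecR ler_Lp_cube_normD. Qed.

Lemma Lp_cube_normCZ (l : R[i]) f :
  (Lp_cube_norm (l *: f))%:C = `|l| * (Lp_cube_norm f)%:C.
Proof.
rewrite Lp_cube_normZ rmorphM/=; congr (_ * _).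
Qed.

HB.instance Definition _ := @Lmodule_isNormed.Build R[i] E
  (fun f => (Lp_cube_norm f)%:C) ler_Lp_cube_normCD Lp_cube_normCZ
  Lp_cube_normC_eq0.

End LpCube.

(* Main.v *)
(* Giving each coordinate an independent random time turns the values T(t_l) of
   the Walsh semigroup, for increasing t_l, into averages of conditional
   expectations along a filtration.  The UMD property therefore makes the
   increments T(t_l) - T(t_(l+1)) unconditional on L^p(X), and the Stein
   inequality makes {T(t) : t > 0} R-bounded; both need martingale transforms
   of exponents p and 2, which a good-lambda argument derives from those of the
   exponent given with UMD.

   Put e_j = T(h_j) for dyadic steps h_j.  Writing (1 - e) / (1 - w e) as
   sum_l w^l (e^l - e^(l+1)) and cutting the sum into dyadic blocks, the two
   facts above bound the R-bound of this family by a multiple of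
   (|1 - w| / (1 - |w|))^(1/2).  The exponent is less than 1, so that Cauchy's
   formula for the m-th coefficient of (1 - e) (1 - w e)^-6 shows that
   m e_j^m (1 - e_j) is R-bounded uniformly in m.  Letting m tend to infinity,
   t Delta T(t) is R-bounded, and a Taylor expansion gives the R-boundedness of
   T(z) on a sector.  The Laplace transform along a rotated ray transfers it to
   the resolvents of Delta.

   These R-bounds are proved for random signs.  A Steinhaus sequence has the
   same law after any change of signs, so that averaging over the signs gives
   the R-bounds for Steinhaus variables. *)

From HB Require Import structures.
Require Import Defs.
From mathcomp Require Import all_boot all_order all_algebra complex.
From mathcomp Require Import all_classical all_reals all_analysis.
From mathcomp Require Import measurable_realfun ring lra zify.
Set Implicit Arguments.
Unset Strict Implicit.
Unset Printing Implicit Defensive.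
Import Order.TTheory GRing.Theory Num.Theory.
Import numFieldNormedType.Exports.
Local Open Scope classical_set_scope.
Local Open Scope complex_scope.
Local Open Scope ring_scope.

(** For fixed [N] every operator involved is a multiplier of the Walsh expansion depending on [|A|]
    only. Boundedness, holomorphy, limits and existence of resolvents then concern finitely many
    numbers and may use constants depending on [N]. The substance is the uniformity of the R-bounds,
    carried by the statements [rb], which survive pointwise limits. UMD enters through two
    inequalities only: martingale transforms on [X] with exponent [p] and on L^p(X) with exponent 2,
    with constants fixed before [N]. Origin of the sixth power: if (1 - e)/(1 - w e) has R-bound x^g
    with x = |1 - w|/(1 - |w|), then (1 - e)(1 - w e)^-(k+1) has R-bound of order |1 - w|^-k
    x^(g(k+1)), and averaging over |w| = r gains the needed factor 1 - r once k - g(k+1) > 1. For g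
    < 1 some k does this; g = 1/2 and k = 5 leave |1 - w|^-2, which Parseval's identity averages.
    Dyadic multiples of one step are used because different steps are treated simultaneously on
    disjoint time blocks. Other times follow from T(u + i v) = T(u - t) T(t + i v) with t dyadic
    between u/2 and u. *)

(** * Averages over the cube *)

Definition mean (R : realType) (N : nat) (phi : cube N -> R) : R :=
  (2 ^+ N)^-1 * \sum_x phi x.

Section Mean.
Context {R : realType} {N : nat}.
Implicit Types phi psi : cube N -> R.

Lemma expr2n_gt0 (n : nat) : 0 < 2 ^+ n :> R.
Proof. by rewrite exprn_gt0. Qed.

Lemma inv_expr2n_ge0 (n : nat) : 0 <= (2 ^+ n)^-1 :> R.
Proof. by rewrite invr_ge0 ltW// expr2n_gt0. Qed.

Lemma card_cube : #|{: cube N}| = (2 ^ N)%N.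
Proof. by rewrite card_ffun card_bool card_ord. Qed.

Lemma eq_mean phi psi : phi =1 psi -> mean phi = mean psi.
Proof. by move=> e; rewrite /mean; congr (_ * _); apply: eq_bigr => x _. Qed.

Lemma ler_mean phi psi : (forall x, phi x <= psi x) -> mean phi <= mean psi.
Proof.
by move=> h; apply: ler_wpM2l (inv_expr2n_ge0 _) _ _ _; apply: ler_sum.
Qed.

Lemma mean_ge0 phi : (forall x, 0 <= phi x) -> 0 <= mean phi.
Proof.
by move=> h; rewrite mulr_ge0 ?inv_expr2n_ge0// sumr_ge0.
Qed.

Lemma meanD phi psi : mean (fun x => phi x + psi x) = mean phi + mean psi.
Proof. by rewrite /mean big_split mulrDr. Qed.

Lemma meanZ (c : R) phi : mean (fun x => c * phi x) = c * mean phi.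
Proof. by rewrite /mean -mulr_sumr mulrCA. Qed.

Lemma mean_cst (c : R) : mean (fun _ : cube N => c) = c.
Proof.
rewrite /mean sumr_const card_cube -[c *+ _]mulr_natl natrX mulrA mulVf ?mul1r//.
Qed.

Lemma mean_sum (I : Type) (r : seq I) (P : pred I) (F : I -> cube N -> R) :
  mean (fun x => \sum_(i <- r | P i) F i x) = \sum_(i <- r | P i) mean (F i).
Proof. by rewrite /mean exchange_big -mulr_sumr. Qed.

End Mean.

Lemma mean_swap (R : realType) (N M : nat) (phi : cube N -> cube M -> R) :
  mean (fun x => mean (phi x)) = mean (fun y => mean (phi^~ y)).
Proof.
rewrite /mean; under eq_bigr do rewrite -/(mean _) /mean.
rewrite -!mulr_sumr exchange_big mulrCA; congr (_ * _).
Qed.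

(** * Conditional expectations on the cube *)

Section Condexp.
Context {R : realType} {N : nat}.
Implicit Types (S : {set 'I_N}) (x y z : cube N).

Definition mix S x y : cube N := [ffun i => if i \in S then x i else y i].

(** Exchanging the coordinates outside [S] between two independent points preserves the uniform law
    of the pair, so the mixed point is again uniform. *)
Lemma sum_mix (V : zmodType) S (g : cube N -> V) :
  \sum_y \sum_z g (mix S y z) = (\sum_y g y) *+ (2 ^ N).
Proof.
pose h (u : cube N * cube N) := (mix S u.1 u.2, mix S u.2 u.1).
have hK : involutive h.
  by move=> [y z]; congr pair; apply/ffunP => i; rewrite !ffunE; case: (i \in S).
rewrite pair_big /= (reindex_inj (inv_inj hK)) /=.
under eq_bigr => u _.
  rewrite (_ : mix S _ _ = u.1); first over.
  by apply/ffunP => i; rewrite !ffunE; case: (i \in S).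
rewrite -(pair_big xpredT xpredT (fun y z => g y)) /= -sumrMnl.
by apply: eq_bigr => y _; rewrite sumr_const card_cube.
Qed.

Definition flip (i : 'I_N) x : cube N := [ffun k => x k (+) (k == i)].

Lemma flipK i : involutive (flip i).
Proof. by move=> x; apply/ffunP => k; rewrite !ffunE -addbA addbb addbF. Qed.

(** Measurability with respect to the coordinates in [S]. The target is arbitrary so that it covers
    vectors, boolean stopping rules and, with values in [Prop], events. *)
Definition meas (T : Type) S (f : cube N -> T) :=
  forall x y, {in S, x =1 y} -> f x = f y.

(** Conditional expectation given the coordinates in [S]: by independence, an average over fresh
    values of the others. This version is for real functions; [ce] is the one for modules over
    [R[i]]. *)
Definition cer S (phi : cube N -> R) x := (2 ^+ N)^-1 * \sum_y phi (mix S x y).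

Lemma mean_cer S phi : mean (cer S phi) = mean phi.
Proof.
rewrite /mean /cer -mulr_sumr sum_mix -[(\sum_y phi y) *+ _]mulr_natl natrX.
by rewrite [X in _ * X]mulrA mulVf ?mul1r// gt_eqF ?expr2n_gt0.
Qed.

Lemma meas_mix (T : Type) S (f : cube N -> T) x y :
  meas S f -> f (mix S x y) = f x.
Proof. by move=> mf; apply: mf => i iS; rewrite ffunE iS. Qed.

Lemma mean_cerM S rho phi : meas S rho ->
  mean (fun x => rho x * cer S phi x) = mean (fun x => rho x * phi x).
Proof.
move=> mr; rewrite -[RHS](mean_cer S); apply: eq_mean => x.
rewrite /cer mulrCA; congr (_ * _); rewrite mulr_sumr.
by apply: eq_bigr => y _; rewrite (meas_mix x y mr).
Qed.

Section Vector.
Context {V : lmodType R[i]}.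
Implicit Types (f g : cube N -> V).

Lemma expC2n_neq0 (n : nat) : (2 ^+ n : R[i]) != 0.
Proof. by rewrite expf_neq0// pnatr_eq0. Qed.

Definition ce S f x : V := (2 ^+ N)^-1 *: \sum_y f (mix S x y).

Lemma meas_ce S f : meas S (ce S f).
Proof.
move=> x x' h; rewrite /ce; congr (_ *: _); apply: eq_bigr => y _; congr f.
by apply/ffunP => i; rewrite !ffunE; case: ifP => // /h.
Qed.

Lemma meas_sub (T : Type) S S' (f : cube N -> T) :
  S \subset S' -> meas S f -> meas S' f.
Proof. by move=> /fintype.subsetP sS mf x y h; apply: mf => i /sS; exact: h. Qed.

Lemma scale_mean_cst (v : V) : (2 ^+ N : R[i])^-1 *: (v *+ 2 ^ N) = v.
Proof.
by rewrite -[v *+ _]scaler_nat natrX scalerA mulVf ?scale1r// expC2n_neq0.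
Qed.

Lemma ce_scale S (v : cube N -> R[i]) f x : meas S v ->
  ce S (fun y => v y *: f y) x = v x *: ce S f x.
Proof.
move=> mv; rewrite /ce [RHS]scalerA mulrC -scalerA; congr (_ *: _).
by rewrite scaler_sumr; apply: eq_bigr => y _; rewrite (meas_mix x y mv).
Qed.

Lemma ce_id S f x : meas S f -> ce S f x = f x.
Proof.
move=> mf; rewrite /ce (eq_bigr (fun=> f x)) => [|y _]; last exact: meas_mix.
by rewrite sumr_const card_cube scale_mean_cst.
Qed.

Lemma eq_ce S f g : f =1 g -> ce S f =1 ce S g.
Proof.
by move=> e x; rewrite /ce; congr (_ *: _); apply: eq_bigr => y _; rewrite e.
Qed.

Lemma ceD S f g x : ce S (fun y => f y + g y) x = ce S f x + ce S g x.
Proof. by rewrite /ce big_split scalerDr. Qed.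

Lemma ceZ S (c : R[i]) f x : ce S (fun y => c *: f y) x = c *: ce S f x.
Proof. by rewrite (ce_scale f x (v := fun=> c)). Qed.

Lemma ceB S f g x : ce S (fun y => f y - g y) x = ce S f x - ce S g x.
Proof.
by rewrite /ce big_split scalerDr -scalerN sumrN.
Qed.

Lemma ce_sum S (I : Type) (r : seq I) (P : pred I) (F : I -> cube N -> V) x :
  ce S (fun y => \sum_(i <- r | P i) F i y) x = \sum_(i <- r | P i) ce S (F i) x.
Proof. by rewrite /ce exchange_big scaler_sumr. Qed.

(** Both averages together refresh every coordinate outside the intersection, and the refreshed
    point is uniform by [sum_mix]. *)
Lemma ce_ce S S' f x : ce S (ce S' f) x = ce (S :&: S') f x.
Proof.
rewrite /ce -scaler_sumr; congr (_ *: _).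
transitivity ((2 ^+ N : R[i])^-1 *:
    \sum_y \sum_z f (mix (S :&: S') x (mix S' y z))).
  congr (_ *: _); apply: eq_bigr => y _; apply: eq_bigr => z _; congr f.
  by apply/ffunP => i; rewrite !ffunE inE; case: (i \in S); case: (i \in S').
by rewrite (sum_mix _ (fun u => f (mix (S :&: S') x u))) scale_mean_cst.
Qed.

(** The points [y] and [flip i y] are paired; exactly one of the two agrees with [x] at [i]. *)
Lemma ce_flip S i f x : i \notin S ->
  ce (i |: S) f x + ce (i |: S) f (flip i x) = ce S f x *+ 2.
Proof.
move=> iS; pose g := ce (i |: S) f; have mg : meas (i |: S) g by exact: meas_ce.
have -> : ce S f x = ce S g x.
  rewrite ce_ce; congr (ce _ f x); apply/esym/finset.setIidPl.
  exact: finset.subsetUr.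
rewrite -/g /ce scalerMnr mulr2n [X in _ = _ *: (X + _)](reindex_inj (inv_inj (flipK i))).
rewrite -big_split/= (eq_bigr (fun=> g x + g (flip i x))).
  by rewrite sumr_const card_cube scale_mean_cst.
move=> y _.
have mE z : mix S x z i = z i by rewrite ffunE (negbTE iS).
have [yx|yx] := eqVneq (y i) (x i).
  rewrite addrC; congr (_ + _); apply: mg => k; rewrite !inE => /orP[/eqP ->|kS].
  - by rewrite mE yx.
  - by rewrite ffunE kS.
  - by rewrite mE !ffunE yx.
  - by rewrite !ffunE kS; case: eqP kS iS => [->->|_ _ _]; rewrite ?addbF.
have {}yx : y i = ~~ x i by case: (y i) (x i) yx => -[].
congr (_ + _); apply: mg => k; rewrite !inE => /orP[/eqP ->|kS].
- by rewrite mE !ffunE eqxx yx addbT negbK.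
- by rewrite ffunE kS.
- by rewrite mE !ffunE eqxx yx addbT.
- by rewrite !ffunE kS; case: eqP kS iS => [->->|_ _ _]; rewrite ?addbF.
Qed.

(** The increment is odd in the new coordinate, that is, a sign times a function of the coordinates
    in [S]. *)
Lemma ce_diff_flip S i f x : i \notin S ->
  ce (i |: S) f (flip i x) - ce S f (flip i x) = - (ce (i |: S) f x - ce S f x).
Proof.
move=> iS; have e : ce S f (flip i x) = ce S f x.
  apply: meas_ce => k kS; rewrite ffunE; case: eqP kS iS => [->->//|_ _ _].
  by rewrite addbF.
have := ce_flip f x iS; rewrite e mulr2n => /eqP; rewrite eq_sym -subr_eq => /eqP h.
by rewrite opprB -h opprD opprK opprD !addrA subrr sub0r addrC.
Qed.
End Vector.

Lemma rnormN (V : normedModType R[i]) (v : V) : rnorm (- v) = rnorm v.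
Proof. by rewrite /rnorm normrN. Qed.

(** With at most one new coordinate the increment is odd in it, and the norm forgets the sign: the
    size of the next jump is known one step ahead. The stopping rule of the good-lambda argument
    relies on this. *)
Lemma meas_rnorm_diff (V : normedModType R[i]) S S' (f : cube N -> V) :
  S \subset S' -> (#|S' :\: S| <= 1)%N ->
  meas S (fun x => rnorm (ce S' f x - ce S f x)).
Proof.
move=> sS; case: (posnP #|S' :\: S|) => [/eqP|].
  rewrite finset.cards_eq0 finset.setD_eq0 => sS' _ x y _.
  have -> : S' = S by apply/eqP; rewrite finset.eqEsubset sS sS'.
  by rewrite !subrr.
move=> c0 c1; have /finset.cards1P[i Di] : #|S' :\: S| == 1%N by rewrite eqn_leq c1.
have iS : i \notin S.
  by have : i \in S' :\: S by [rewrite Di finset.set11]; rewrite finset.in_setD => /andP[].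
have -> : S' = i |: S.
  by rewrite -Di finset.setUC finset.setDE finset.setUIr finset.setUCr finset.setIT;
    apply/esym/finset.setUidPr.
move=> x y xy; pose d z := ce (i |: S) f z - ce S f z.
have md : meas (i |: S) d.
  move=> u v uv; rewrite /d (meas_ce f uv); congr (_ - _); apply: meas_ce => k kS.
  by apply: uv; rewrite !inE kS orbT.
have [e|e] := eqVneq (x i) (y i).
  by congr rnorm; apply: md => k; rewrite !inE => /orP[/eqP ->//|/xy].
rewrite -/(d x) -/(d y) -[RHS]rnormN; congr rnorm.
rewrite -ce_diff_flip//; apply: md => k; rewrite !inE => /orP[/eqP ->|kS].
  by rewrite ffunE eqxx addbT; case: (x i) (y i) e => -[].
rewrite ffunE xy//; case: eqP kS iS => [->->//|_ _ _].
by rewrite addbF.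
Qed.

Lemma rnorm_sum (V : normedModType R[i]) (I : Type) (r : seq I) (P : pred I)
    (F : I -> V) :
  rnorm (\sum_(i <- r | P i) F i) <= \sum_(i <- r | P i) rnorm (F i).
Proof.
apply: (big_ind2 (fun a b => rnorm a <= b)) => //; first by rewrite /rnorm normr0.
by move=> a b c d ab cd; apply: le_trans (ler_rnormD _ _) (lerD ab cd).
Qed.

Lemma rnormZr (V : normedModType R[i]) (c : R) (v : V) :
  rnorm (c%:C *: v) = `|c| * rnorm v.
Proof. by rewrite rnormZ normc_def/= expr0n addr0 sqrtr_sqr. Qed.

Lemma rnorm_ce (V : normedModType R[i]) S (f : cube N -> V) x :
  rnorm (ce S f x) <= cer S (fun y => rnorm (f y)) x.
Proof.
rewrite /ce /cer (_ : (2 ^+ N)^-1 = ((2 ^+ N)^-1 : R)%:C); last first.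
  by rewrite fmorphV rmorphXn/= rmorph_nat.
rewrite rnormZr ger0_norm ?inv_expr2n_ge0//.
by apply: ler_wpM2l (inv_expr2n_ge0 _) _ _ _; exact: rnorm_sum.
Qed.

End Condexp.

(** * Martingale transforms along keys *)

(** Filtrations are encoded by keys: coordinate [i] is revealed at time [tau i], and [pre tau k] is
    what is known strictly before that time reaches [k]. *)
Definition pre (N : nat) (tau : 'I_N -> nat) (k : nat) : {set 'I_N} :=
  [set i | (tau i < k)%N].

Definition tr (R : realType) (N : nat) (V : lmodType R[i]) (tau : 'I_N -> nat)
    (L : nat) (theta : nat -> R[i]) (f : cube N -> V) (x : cube N) : V :=
  \sum_(k < L) theta k *: (ce (pre tau k.+1) f x - ce (pre tau k) f x).

(** [C] compares p-th powers, so the norm of a transform is controlled by the p-th root of [C]. The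
    dimension is quantified inside, which records that [C] does not depend on it. *)
Definition mart (R : realType) (V : normedModType R[i]) (p C : R) :=
  forall N (tau : 'I_N -> nat) L theta (f : cube N -> V),
    (forall k, `|theta k| <= 1) ->
    mean (fun x => rnorm (tr tau L theta f x) `^ p) <=
    C * mean (fun x => rnorm (f x) `^ p).

Definition mart_inj (R : realType) (V : normedModType R[i]) (p C : R) :=
  forall N (tau : 'I_N -> nat) L theta (f : cube N -> V),
    injective tau -> (forall k, `|theta k| <= 1) ->
    mean (fun x => rnorm (tr tau L theta f x) `^ p) <=
    C * mean (fun x => rnorm (f x) `^ p).

Lemma sum_ord_mul (V : zmodType) (L N : nat) (F : nat -> V) :
  \sum_(m < L * N) F m = \sum_(k < L) \sum_(r < N) F (k * N + r)%N.
Proof.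
elim: L => [|L IH]; first by rewrite mul0n !big_ord0.
rewrite big_ord_recr/= -IH mulSnr.
by rewrite big_split_ord/=.
Qed.

(** Ties are broken by the key [tau i * N + i]; multipliers constant on blocks of length [N] make
    the refined increments telescope to the original ones. *)
Lemma mart_inj_mart (R : realType) (V : normedModType R[i]) (p C : R) :
  mart_inj V p C -> mart V p C.
Proof.
move=> h N tau L theta f th1.
pose tau' (i : 'I_N) := (tau i * N + i)%N.
have preE k : pre tau' (k * N) = pre tau k.
  apply/setP => i; rewrite !inE /tau'; have := ltn_ord i; nia.
have inj : injective tau'.
  move=> i j e; apply: val_inj => /=; have := congr1 (modn^~ N) e.
  by rewrite /tau' !modnMDl !modn_small.
have := h N tau' (L * N)%N (fun m => theta (m %/ N)%N) f inj (fun k => th1 _).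
rewrite (@eq_mean _ _ _ (fun x => rnorm (tr tau L theta f x) `^ p))// => x.
congr (rnorm _ `^ p); rewrite /tr.
rewrite (sum_ord_mul L N (fun m => theta (m %/ N)%N *:
  (ce (pre tau' m.+1) f x - ce (pre tau' m) f x))).
apply: eq_bigr => k _; under eq_bigr => r _ do rewrite divnMDl ?(leq_trans _ (ltn_ord r))// divn_small// addn0.
rewrite -scaler_sumr; congr (_ *: _).
rewrite -(big_mkord xpredT (fun r => ce (pre tau' (k * N + r).+1) f x - ce (pre tau' (k * N + r)) f x)).
under eq_bigr do rewrite -addnS.
rewrite (@telescope_sumr _ 0 N (fun r => ce (pre tau' (k * N + r)) f x))//.
by rewrite addn0 -mulSnr !preE.
Qed.

(** * Running maxima and Doob's inequality *)

Lemma powRK_inv (R : realType) (p a : R) : 0 < p -> 0 <= a -> (a `^ p) `^ p^-1 = a.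
Proof. by move=> p0 a0; rewrite -powRrM mulfV ?gt_eqF// powRr1. Qed.

Lemma ler_powRl (R : realType) (p a b : R) :
  0 <= p -> 0 <= a -> a <= b -> a `^ p <= b `^ p.
Proof.
move=> p0 a0 ab; apply: ge0_ler_powR; rewrite ?nnegrE//; exact: le_trans ab.
Qed.

(** The running maximum up to and including time [k] is the value at [k.+1]; starting from 0 makes
    it nonnegative. *)
Fixpoint runmax (R : realType) (s : nat -> R) (k : nat) : R :=
  if k is k'.+1 then Num.max (runmax s k') (s k') else 0.

Section Runmax.
Context {R : realType}.
Implicit Types (s : nat -> R).

Lemma runmax_ge0 s k : 0 <= runmax s k.
Proof. by elim: k => //= k IH; rewrite le_max IH. Qed.

Lemma runmaxS s k : runmax s k <= runmax s k.+1.
Proof. by rewrite /= le_max lexx. Qed.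

Lemma le_runmax s i k : (i < k)%N -> s i <= runmax s k.
Proof.
elim: k => // k IH; rewrite ltnS leq_eqVlt => /predU1P[->|/IH h] /=.
  by rewrite le_max lexx orbT.
by rewrite le_max h.
Qed.

Lemma runmax_le s k c : 0 <= c -> (forall i, (i < k)%N -> s i <= c) ->
  runmax s k <= c.
Proof.
move=> c0; elim: k => // k IH h /=; rewrite ge_max h// andbT.
by apply: IH => i ik; apply: h; rewrite ltnS ltnW.
Qed.

Lemma runmax_homo s i j : (i <= j)%N -> runmax s i <= runmax s j.
Proof.
by move=> /subnK <-; elim: (j - i)%N => // n /le_trans; apply; exact: runmaxS.
Qed.

Lemma lt_runmax s k c : 0 <= c -> c < runmax s k ->
  exists2 i, (i < k)%N & c < s i.
Proof.
move=> c0; elim: k => [|k IH] /=; first by rewrite ltNge c0.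
rewrite lt_max => /orP[/IH[i ik ci]|cs]; last by exists k.
by exists i => //; rewrite ltnS ltnW.
Qed.

(** Discrete form of d(M^p) = q M d(M^(p-1)), with q conjugate to p; it is Young's inequality for
    [b] and a^(p-1). *)
Lemma powR_diff_le (p a b : R) : 1 < p -> 0 <= a -> a <= b ->
  b `^ p - a `^ p <= p / (p - 1) * (b * (b `^ (p - 1) - a `^ (p - 1))).
Proof.
move=> p1 a0 ab; have b0 : 0 <= b := le_trans a0 ab.
have p0 : 0 < p by lra.
have pm : 0 < p - 1 by lra.
have /= := @conjugate_powR R b (a `^ (p - 1)) p (p / (p - 1)) b0 (powR_ge0 _ _) p0.
rewrite divr_gt0// => /(_ isT).
have -> : p^-1 + (p / (p - 1))^-1 = 1 by field; rewrite !gt_eqF.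
move=> /(_ erefl); rewrite -powRrM.
have -> : (p - 1) * (p / (p - 1)) = p by field; rewrite gt_eqF.
rewrite mulrBr mulr_powRB1//.
set B := b `^ p; set A := a `^ p; set D := b * _ => h.
have {}h : p / (p - 1) * D <= p / (p - 1) * (B / p + A / (p / (p - 1))).
  by rewrite ler_wpM2l// divr_ge0// ltW.
have e1 : p / (p - 1) * (B / p + A / (p / (p - 1))) = B / (p - 1) + A.
  by field; rewrite !gt_eqF.
have e2 : p / (p - 1) * B = B + B / (p - 1) by field; rewrite gt_eqF.
by rewrite mulrBr e2; rewrite e1 in h; lra.
Qed.

(** The maximum grows only at steps where its new value is [s k], which can therefore stand in front
    of the increment. *)
Lemma runmax_powR_le (p : R) s n : 1 < p -> (forall k, 0 <= s k) ->
  runmax s n `^ p <= p / (p - 1) * \sum_(k < n)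
    s k * (runmax s k.+1 `^ (p - 1) - runmax s k `^ (p - 1)).
Proof.
move=> p1 s0; elim: n => [|n IH].
  by rewrite big_ord0 mulr0 powR0// gt_eqF//; lra.
rewrite big_ord_recr/= mulrDr -lerBlDl.
apply: le_trans (lerB (lexx _) IH) _.
case: (leP (runmax s n) (s n)) => h; last by rewrite !subrr !mulr0.
exact: powR_diff_le p1 (runmax_ge0 _ _) h.
Qed.

End Runmax.

Lemma meas_runmax (R : realType) N (S : {set 'I_N}) (s : nat -> cube N -> R) k :
  (forall i, (i < k)%N -> meas S (s i)) ->
  meas S (fun x => runmax (s^~ x) k).
Proof.
move=> h x y xy; elim: k h => //= k IH h.
by rewrite (h k _ x y xy)// IH// => i ik; apply: h; rewrite ltnS ltnW.
Qed.

Lemma young_powR (R : realType) (p eta a b : R) : 1 < p -> 0 < eta ->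
  0 <= a -> 0 <= b ->
  a * b `^ (p - 1) <= eta * b `^ p + eta `^ (1 - p) * a `^ p.
Proof.
move=> p1 e0 a0 b0.
have [h|h] := leP a (eta * b).
  apply: (@le_trans _ _ (eta * b `^ p)); last by rewrite lerDl mulr_ge0 ?powR_ge0.
  rewrite -(@mulr_powRB1 _ b p) ?(lt_trans _ p1)// mulrA.
  by rewrite ler_wpM2r ?powR_ge0.
apply: (@le_trans _ _ (eta `^ (1 - p) * a `^ p)); last by rewrite lerDr mulr_ge0 ?powR_ge0 ?ltW.
rewrite -(@mulr_powRB1 _ a p) ?(lt_trans _ p1)// mulrCA ler_wpM2l//.
have -> : 1 - p = - (p - 1) by ring.
rewrite powRN mulrC ler_pdivlMr ?powR_gt0// -powRM ?(ltW e0)//.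
apply: ler_powRl; first by rewrite subr_ge0 ltW.
- by rewrite mulr_ge0// ltW.
- by rewrite mulrC ltW.
Qed.

(** This is (2q)^p with q conjugate to p. Young's inequality is used with parameter 1/(2q), so that
    half of the left-hand side is absorbed. *)
Definition doob_cst (R : realType) (p : R) : R :=
  let q := p / (p - 1) in 2 * q * (2 * q)^-1 `^ (1 - p).

Lemma doob_cst_ge0 (R : realType) (p : R) : 1 < p -> 0 <= doob_cst p.
Proof.
move=> p1; rewrite /doob_cst; apply: mulr_ge0; last exact: powR_ge0.
by apply: mulr_ge0 => //; apply: divr_ge0; lra.
Qed.

(** The weights M_(k+1)^(p-1) - M_k^(p-1) are nonnegative and known at time k, so the norm of [f]
    may replace that of its conditional expectation, after which they telescope. Young's inequality
    separates [f] from the maximum, and half of the mean of M^p is absorbed on the left. *)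
Lemma doob (R : realType) (V : normedModType R[i]) (p : R) N
    (S : nat -> {set 'I_N}) (f : cube N -> V) n : 1 < p ->
  (forall i j, (i <= j)%N -> S i \subset S j) ->
  mean (fun x => runmax (fun k => rnorm (ce (S k) f x)) n `^ p) <=
  doob_cst p * mean (fun x => rnorm (f x) `^ p).
Proof.
move=> p1 mS; pose M k x := runmax (fun k => rnorm (ce (S k) f x)) k.
pose q := p / (p - 1).
have q0 : 0 < q by rewrite divr_gt0//; lra.
have pm : 0 <= p - 1 by lra.
have M0 k x : 0 <= M k x by exact: runmax_ge0.
rewrite -/(M n _).
have h1 : mean (fun x => M n x `^ p) <=
    q * mean (fun x => rnorm (f x) * M n x `^ (p - 1)).
  apply: (@le_trans _ _ (mean (fun x => q * \sum_(k < n) rnorm (ce (S k) f x) *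
      (M k.+1 x `^ (p - 1) - M k x `^ (p - 1))))).
    apply: ler_mean => x.
    exact: (@runmax_powR_le _ _ (fun k => rnorm (ce (S k) f x)) n p1
      (fun=> rnorm_ge0 _)).
  rewrite meanZ (ler_pM2l q0) mean_sum.
  apply: (@le_trans _ _ (\sum_(k < n) mean (fun x => rnorm (f x) *
      (M k.+1 x `^ (p - 1) - M k x `^ (p - 1))))).
    apply: ler_sum => k _.
    pose rho x := M k.+1 x `^ (p - 1) - M k x `^ (p - 1).
    have mr : meas (S k) rho.
      have mM j : (j <= k.+1)%N -> meas (S k) (M j).
        move=> jk; apply: (@meas_runmax _ _ _ (fun k x => rnorm (ce (S k) f x))) => i ij.
        move=> x y xy; congr rnorm; apply: (meas_sub (mS i k _) (meas_ce f)) => //.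
        by rewrite -ltnS (leq_trans ij).
      by move=> x y xy; rewrite /rho (mM k.+1 _ _ _ xy)// (mM k _ _ _ xy).
    have r0 x : 0 <= rho x.
      by rewrite subr_ge0; apply: ler_powRl => //; exact: runmaxS.
    apply: (@le_trans _ _ (mean (fun x => rho x * cer (S k) (fun y => rnorm (f y)) x))).
      apply: ler_mean => x; rewrite mulrC.
      by apply: ler_wpM2l (r0 x) _ _ _; exact: rnorm_ce.
    by rewrite (mean_cerM _ mr) le_eqVlt; apply/orP; left; apply/eqP/eq_mean => x; rewrite mulrC.
  rewrite -mean_sum; apply: ler_mean => x; rewrite -mulr_sumr ler_wpM2l ?rnorm_ge0//.
  rewrite -(big_mkord xpredT (fun k => M k.+1 x `^ (p - 1) - M k x `^ (p - 1))).
  by rewrite telescope_sumr// lerBlDr lerDl powR_ge0.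
have h2 : mean (fun x => rnorm (f x) * M n x `^ (p - 1)) <=
    (2 * q)^-1 * mean (fun x => M n x `^ p) +
    (2 * q)^-1 `^ (1 - p) * mean (fun x => rnorm (f x) `^ p).
  rewrite -!meanZ -meanD; apply: ler_mean => x; apply: young_powR => //.
  - by rewrite invr_gt0 mulr_gt0.
  - exact: rnorm_ge0.
rewrite /doob_cst -/q; set A := mean (fun x => M n x `^ p) in h1 h2 *.
set B := mean (fun x => _ `^ p) in h2 *; set c := _ `^ _ in h2 *.
have {}h2 : q * mean (fun x => rnorm (f x) * M n x `^ (p - 1)) <= q * ((2 * q)^-1 * A + c * B).
  by rewrite ler_pM2l.
have e : q * ((2 * q)^-1 * A + c * B) = A / 2 + q * c * B by field; rewrite gt_eqF.
rewrite e in h2; have := le_trans h1 h2.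
have -> : 2 * q * c * B = 2 * (q * c * B) by ring.
by move: (q * c * B) => z; lra.
Qed.

(** * Good-lambda extrapolation *)

(** Here [st] means that a sum has started and [ok] that it has not been stopped, so the active
    steps form an interval. *)
Lemma mono_interval (st ok : nat -> bool) (L : nat) :
  (forall i j, (i <= j)%N -> st i -> st j) ->
  (forall i j, (i <= j)%N -> ok j -> ok i) ->
  exists a b, [/\ (a <= b)%N, (b <= L)%N &
    forall k, (k < L)%N -> st k && ok k = (a <= k < b)%N].
Proof.
move=> mst mok; elim: L => [|L [a [b [ab bL h]]]]; first by exists 0%N, 0%N.
have [v|v] := boolP (st L && ok L); last first.
  exists a, b; split => //; first exact: leqW.
  move=> k; rewrite ltnS leq_eqVlt => /predU1P[->|/h//].
  by rewrite (negbTE v) (ltnNge L b) bL andbF.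
have /andP[vs vo] := v.
have [e|ab'] := eqVneq a b.
  exists L, L.+1; split; [exact: leqnSn|exact: leqnn|] => k kL'.
  have [->|kL] := eqVneq k L; first by rewrite v leqnn ltnSn.
  have {}kL : (k < L)%N by rewrite ltn_neqAle kL -ltnS.
  rewrite h// e kL' andbT leqNgt [(L <= k)%N]leqNgt kL /=.
  by apply/negbTE; rewrite negb_and -ltnNge; case: ltnP.
have aL : (a < L)%N by rewrite (leq_trans _ bL)// ltn_neqAle ab' ab.
have /andP[sa _] : st a && ok a.
  by rewrite h// leqnn ltn_neqAle ab' ab.
exists a, L.+1; split => //; first by rewrite ltnW// ltnW.
move=> k kL'; have [->|kL] := eqVneq k L; first by rewrite v ltnSn (ltnW aL).
have {}kL : (k < L)%N by rewrite ltn_neqAle kL -ltnS.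
rewrite kL' andbT (mok _ _ (ltnW kL) vo) andbT.
apply/idP/idP => [sk|ak]; last exact: mst ak sa.
by have := h k kL; rewrite sk (mok _ _ (ltnW kL) vo) => /esym /andP[].
Qed.

Lemma interval_telescope (F : pzRingType) (V : lmodType F) (u : nat -> V)
    (a b L : nat) (v : nat -> bool) : (a <= b)%N -> (b <= L)%N ->
  (forall k, (k < L)%N -> v k = (a <= k < b)%N) ->
  \sum_(k < L) (v k)%:R *: (u k.+1 - u k) = u b - u a.
Proof.
move=> ab bL h.
rewrite -(big_mkord xpredT (fun k => (v k)%:R *: (u k.+1 - u k))).
rewrite (@big_cat_nat _ _ _ a)/= ?(leq_trans ab)//.
rewrite (@big_cat_nat _ _ _ b _ L)//=.
rewrite big_nat_cond big1 ?add0r; last first.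
  move=> k; rewrite andbT => /andP[_ ka].
  rewrite h; last by rewrite (leq_trans ka)// (leq_trans ab).
  by rewrite leqNgt ka scale0r.
rewrite [X in _ + X]big_nat_cond [X in _ + X]big1 ?addr0; last first.
  move=> k; rewrite andbT => /andP[bk kL].
  by rewrite h// [(k < b)%N]ltnNge bk andbF scale0r.
rewrite -(telescope_sumr u ab) big_nat_cond [RHS]big_nat_cond.
apply: eq_bigr => k; rewrite andbT => /andP[ak kb].
by rewrite h ?ak ?kb ?scale1r// (leq_trans kb).
Qed.

Lemma trS (R : realType) (N : nat) (V : lmodType R[i]) (tau : 'I_N -> nat) L theta
    (f : cube N -> V) x :
  tr tau L.+1 theta f x = tr tau L theta f x +
    theta L *: (ce (pre tau L.+1) f x - ce (pre tau L) f x).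
Proof. by rewrite /tr big_ord_recr. Qed.

Lemma pre_sub (N : nat) (tau : 'I_N -> nat) i j : (i <= j)%N -> pre tau i \subset pre tau j.
Proof.
by move=> ij; apply/fintype.subsetP => k; rewrite !inE => /leq_trans; apply.
Qed.

Lemma meas_tr (R : realType) (N : nat) (V : lmodType R[i]) (tau : 'I_N -> nat) L theta
    (f : cube N -> V) : meas (pre tau L) (tr tau L theta f).
Proof.
elim: L => [|L IH] x y xy; first by rewrite /tr !big_ord0.
rewrite !trS (meas_sub (pre_sub tau (leqnSn L)) IH xy).
rewrite (meas_ce f xy); congr (_ + _ *: (_ - _)).
exact: (meas_sub (pre_sub tau (leqnSn L)) (meas_ce f) xy).
Qed.

Lemma card_pre_diff (N : nat) (tau : 'I_N -> nat) k : injective tau ->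
  (#|pre tau k.+1 :\: pre tau k| <= 1)%N.
Proof.
move=> inj; rewrite leqNgt; apply/negP => /fintype.card_gt1P[i [j [hi hj]]].
move: hi hj; rewrite !inE => hi hj /eqP; apply; apply: inj.
by lia.
Qed.

Section GoodLambda.
Context {R : realType} {V : normedModType R[i]} {N : nat}.
Variables (p0 C0 : R) (tau : 'I_N -> nat) (L : nat) (theta : nat -> R[i]).
Variable f : cube N -> V.
Hypothesis p00 : 0 < p0.
Hypothesis C00 : 0 <= C0.
Hypothesis hmart : mart_inj V p0 C0.
Hypothesis inj : injective tau.
Hypothesis th1 : forall k, `|theta k| <= 1.

Let fk k x := ce (pre tau k) f x.
Let gk k x := tr tau k theta f x.
Let nf x k := rnorm (fk k x).
Let ng x k := rnorm (gk k x).
Let nd x k := rnorm (fk k.+1 x - fk k x).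
Let Fs x := runmax (nf x) L.+1.
Let Gs x := runmax (ng x) L.+1.

Let gS k x : gk k.+1 x = gk k x + theta k *: (fk k.+1 x - fk k x).
Proof. exact: trS. Qed.

Let rnorm_theta k (v : V) : rnorm (theta k *: v) <= rnorm v.
Proof.
rewrite rnormZ -[leRHS]mul1r; apply: ler_wpM2r; first exact: rnorm_ge0.
by rewrite -lecR RRe_real ?normr_real.
Qed.

Let rnormB (u v : V) : rnorm (u - v) <= rnorm u + rnorm v.
Proof. by rewrite -(rnormN v) ler_rnormD. Qed.

(** [h] is the part of [f] accumulated after its transform exceeds [lam] and before the transform
    passes 2 [lam] or [f] or its jumps become large. Its norm is at most 4 [del] [lam] and it
    vanishes unless [lam < Gs], while on the event on the left its transform has norm at least
    [lam]/2. Chebyshev's inequality with exponent [p0] turns this into the ratio 8 [del]. *)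
Lemma good_lambda (lam del : R) : 0 < lam -> 0 < del -> del <= 4^-1 ->
  mean (fun x => ((2 * lam < Gs x)%R && (Fs x <= del * lam)%R)%:R : R) <=
  C0 * (8 * del) `^ p0 * mean (fun x => (lam < Gs x)%R%:R).
Proof.
move=> l0 d0 d4.
have lam0 : 0 <= lam by exact: ltW.
have dl0 : 0 <= del * lam by rewrite mulr_ge0// ltW.
pose st x k := lam < runmax (ng x) k.+1.
(* The last bound includes the jump from [k] to [k.+1], which lies in the future but whose norm is
   already determined. *)
pose ok x k := [&& runmax (ng x) k.+1 <= 2 * lam, runmax (nf x) k.+1 <= del * lam &
  runmax (nd x) k.+1 <= 2 * del * lam].
pose v x k := st x k && ok x k.
pose h x := \sum_(k < L) (v x k)%:R *: (fk k.+1 x - fk k x).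
have mst x i j : (i <= j)%N -> st x i -> st x j.
  by move=> ij; move=> /lt_le_trans; apply; exact: runmax_homo.
have mok x i j : (i <= j)%N -> ok x j -> ok x i.
  move=> ij /and3P[h1 h2 h3]; apply/and3P.
  by split; [apply: le_trans h1|apply: le_trans h2|apply: le_trans h3]; exact: runmax_homo.
have mv k : meas (pre tau k) (v^~ k).
  have mf : meas (pre tau k) (fun x => runmax (nf x) k.+1).
    apply: (@meas_runmax _ _ _ (fun k x => nf x k)) => i ik x y xy; congr rnorm.
    exact: (meas_sub (@pre_sub _ tau i k ik) (meas_ce f) xy).
  have mg : meas (pre tau k) (fun x => runmax (ng x) k.+1).
    apply: (@meas_runmax _ _ _ (fun k x => ng x k)) => i ik x y xy; congr rnorm.
    exact: (meas_sub (@pre_sub _ tau i k ik) (@meas_tr _ _ _ _ _ _ f) xy).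
  have md : meas (pre tau k) (fun x => runmax (nd x) k.+1).
    apply: (@meas_runmax _ _ _ (fun k x => nd x k)) => i ik.
    apply: (meas_sub (@pre_sub _ tau i k ik)); apply: meas_rnorm_diff.
      exact: pre_sub.
    exact: card_pre_diff.
  by move=> x y xy; rewrite /v /st /ok (mf _ _ xy) (mg _ _ xy) (md _ _ xy).
(* Since [v] is predictable, the terms of [h] are martingale differences, and conditioning at time
   [j] keeps those with k < j. *)
have ceh j x : (j <= L)%N -> ce (pre tau j) h x =
    \sum_(k < L | (k < j)%N) (v x k)%:R *: (fk k.+1 x - fk k x).
  move=> jL; rewrite ce_sum big_mkcond; rewrite [RHS]big_mkcond/=.
  apply: eq_bigr => k _; case: ifPn => kj; last first.
    rewrite -leqNgt in kj.
    have -> : pre tau j = pre tau j :&: pre tau k.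
      by apply/esym/finset.setIidPl; exact: pre_sub.
    rewrite -ce_ce -[RHS](_ : ce (pre tau j) (fun=> 0) x = 0); last first.
      by rewrite /ce big1 ?scaler0.
    apply: eq_ce => y.
    rewrite (@ce_scale _ _ _ _ (fun y => (v y k)%:R)); last first.
      by move=> a b ab; rewrite (mv k _ _ ab).
    rewrite ceB !ce_ce finset.setIid (_ : _ :&: _ = pre tau k) ?subrr ?scaler0//.
    by apply/finset.setIidPl; exact: pre_sub.
  apply: ce_id => y z yz; congr (_%:R *: (_ - _)).
  - by rewrite (meas_sub (pre_sub tau (ltnW kj)) (mv k) yz).
  - exact: (meas_sub (pre_sub tau kj) (meas_ce f) yz).
  - exact: (meas_sub (pre_sub tau (ltnW kj)) (meas_ce f) yz).
have trh x : tr tau L theta h x = \sum_(k < L) (v x k)%:R *: (gk k.+1 x - gk k x).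
  rewrite /tr; apply: eq_bigr => k _.
  rewrite !ceh ?(ltnW (ltn_ord k))//.
  rewrite (bigD1 k)//= [X in _ + X - _](_ : _ = \sum_(i < L | (i < k)%N)
    (v x i)%:R *: (fk i.+1 x - fk i x)); last first.
    by apply: eq_bigl => i; rewrite ltnS -val_eqE /= andbC -ltn_neqAle.
  by rewrite addrK gS (addrC (gk k x)) addrK !scalerA mulrC.
have hle x : rnorm (h x) <= 4 * del * lam * (lam < Gs x)%R%:R.
  have [a [b [ab bL hv]]] := mono_interval L (mst x) (mok x).
  rewrite /h (interval_telescope (fk^~ x) ab bL hv).
  have [e|ne] := eqVneq a b.
    rewrite e subrr /rnorm normr0/= mulr_ge0// mulr_ge0 ?mulr_ge0// ltW//.
  have {}ab : (a < b)%N by rewrite ltn_neqAle ne.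
  have /andP[sa oa] : st x a && ok x a by rewrite hv ?leqnn// (leq_trans ab).
  case: b ab bL hv {ne} => // b ab bL hv.
  have /andP[sb ob] : st x b && ok x b by rewrite hv// leqnn andbT -ltnS.
  have -> : lam < Gs x.
    by apply: lt_le_trans sa _; apply: runmax_homo; rewrite ltnS (leq_trans _ bL)// ltnW.
  rewrite mulr1; have /and3P[_ o2 o3] := ob; have /and3P[_ o2' _] := oa.
  (* [ok] at time [b] bounds the values up to [b] and the jump to [b.+1]: 2 + 1 + 1 = 4 multiples of
     [del] [lam]. *)
  have -> : fk b.+1 x - fk a x = (fk b.+1 x - fk b x) + (fk b x - fk a x) by rewrite addrA subrK.
  apply: le_trans (ler_rnormD _ _) _.
  have l1 := le_trans (le_runmax (nd x) (ltnSn b)) o3.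
  have l2 := le_trans (le_runmax (nf x) (ltnSn b)) o2.
  have l3 := le_trans (le_runmax (nf x) (ltnSn a)) o2'.
  have l4 := rnormB (fk b x) (fk a x).
  by rewrite /nd /nf in l1 l2 l3; lra.
have big x : 2 * lam < Gs x -> Fs x <= del * lam -> lam / 2 <= rnorm (tr tau L theta h x).
  move=> hG hF.
  have fle k : (k <= L)%N -> nf x k <= del * lam.
    by move=> kL; apply: le_trans hF; exact: le_runmax.
  have dle k : (k < L)%N -> nd x k <= 2 * del * lam.
    move=> kL; apply: le_trans (rnormB _ _) _.
    by have := fle k (ltnW kL); have := fle k.+1 kL; rewrite /nf; lra.
  have [i1 iL1 g1] : exists2 i, (i < L.+1)%N & 2 * lam < ng x i.
    by apply: lt_runmax => //; rewrite mulr_ge0.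
  have exb : exists i, 2 * lam < ng x i by exists i1.
  have exa : exists i, lam < ng x i by exists i1; apply: le_lt_trans g1; lra.
  (* On this event [f] and its jumps never stop the sum, which runs from the first passage of the
     transform above [lam] to the first one above 2 [lam]. The overshoot at [a] is at most one jump,
     2 [del] [lam], hence at most [lam]/2. *)
  case: (ex_minnP exb) => b gb minb; case: (ex_minnP exa) => a ga mina.
  have ab : (a <= b)%N by apply: mina; apply: le_lt_trans gb; lra.
  have bL : (b <= L)%N by rewrite -ltnS; apply: leq_ltn_trans iL1; exact: minb.
  rewrite trh (interval_telescope (gk^~ x) ab bL); last first.
    move=> k kL; congr (_ && _).
      rewrite /st; apply/idP/idP => [|ak].
        move=> /(lt_runmax lam0)[i ik gi].
        by apply: leq_trans (mina _ gi) _; rewrite -ltnS.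
      by apply: lt_le_trans ga _; exact: le_runmax.
    rewrite /ok; apply/idP/idP => [/and3P[ o1 _ _] | kb].
      rewrite ltnNge; apply/negP => bk.
      have := le_trans (@le_runmax _ (ng x) b k.+1 bk) o1.
      by rewrite leNgt gb.
    apply/and3P; split; apply: runmax_le; rewrite ?mulr_ge0 ?ltW//.
    - by move=> i ik; rewrite leNgt; apply/negP => /minb; rewrite leqNgt (leq_trans ik).
    - by move=> i ik; apply: fle; rewrite -ltnS ltnW// ltnS (leq_trans ik).
    - by move=> i ik; apply: dle; rewrite (leq_trans ik).
  have : ng x a <= lam + 2 * del * lam.
    case: a ga mina ab => [|a] ga mina ab.
      by move: ga; rewrite /ng /gk /tr big_ord0 /rnorm normr0/= ltNge lam0.
    rewrite /ng gS; apply: le_trans (ler_rnormD _ _) _.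
    apply: lerD.
      by rewrite leNgt; apply/negP => /mina; rewrite ltnn.
    apply: le_trans (rnorm_theta _ _) _; apply: dle; exact: leq_trans bL.
  have : ng x b <= rnorm (gk b x - gk a x) + ng x a.
    by rewrite /ng -{1}(subrK (gk a x) (gk b x)) ler_rnormD.
  have : del * lam <= lam / 4 by rewrite mulrC ler_pM2l.
  by move: gb; lra.
have key := @hmart N tau L theta h inj th1.
have l2 : 0 <= lam / 2 by rewrite divr_ge0.
have lp : 0 < (lam / 2) `^ p0 by rewrite powR_gt0// divr_gt0.
rewrite -(ler_pM2l lp) -[leLHS]meanZ.
apply: (@le_trans _ _ (mean (fun x => rnorm (tr tau L theta h x) `^ p0))).
  apply: ler_mean => x; case: (boolP (_ && _)) => [|_]; last by rewrite mulr0 powR_ge0.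
  by move=> /andP[hG hF]; rewrite mulr1 ler_powRl ?big// ltW.
apply: le_trans key _.
have -> : (lam / 2) `^ p0 * (C0 * (8 * del) `^ p0 * mean (fun x => (lam < Gs x)%R%:R)) =
    C0 * (mean (fun x => (4 * del * lam * (lam < Gs x)%R%:R) `^ p0)).
  rewrite -mulrA mulrCA; congr (_ * _); rewrite mulrA -powRM//; last first.
    by rewrite mulr_ge0// ltW.
  have -> : lam / 2 * (8 * del) = 4 * del * lam by field.
  rewrite -meanZ; apply: eq_mean => x; case: (lam < Gs x); rewrite ?mulr1// !mulr0.
  by rewrite powR0// gt_eqF.
apply: ler_wpM2l C00 _ _ _; apply: ler_mean => x.
by apply: ler_powRl; rewrite ?(ltW p00)// rnorm_ge0.
Qed.

End GoodLambda.

(** Dyadic layer-cake bound: when y lies between 2^k a and 2^(k+1) a, the layer [k] alone pays for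
    y^p, up to 2^p. *)
Lemma layer_upper (R : realType) (p a y : R) K : 0 < p -> 0 < a -> 0 <= y ->
  y <= 2 ^+ K * a ->
  y `^ p <= a `^ p + 2 `^ p * \sum_(k < K) (2 ^+ k * a) `^ p * (2 ^+ k * a < y)%R%:R.
Proof.
move=> p0 a0 y0; elim: K => [|K IH] h.
  by rewrite big_ord0 mulr0 addr0 ler_powRl ?(ltW p0)//; rewrite expr0 mul1r in h.
rewrite big_ord_recr/= mulrDr addrA.
have [h'|h'] := leP y (2 ^+ K * a).
  by rewrite mulr0 mulr0 addr0; apply: IH.
rewrite mulr1 -powRM// ?mulr_ge0 ?exprn_ge0 ?(ltW a0)// mulrA -exprS.
apply: (@le_trans _ _ ((2 ^+ K.+1 * a) `^ p)); first by rewrite ler_powRl ?(ltW p0).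
rewrite lerDr addr_ge0 ?powR_ge0// mulr_ge0 ?powR_ge0// sumr_ge0// => k _.
by rewrite mulr_ge0 ?powR_ge0.
Qed.

(** The layers below y grow by a ratio of at least 2, so twice the largest of them bounds their
    sum. *)
Lemma layer_lower (R : realType) (p a y : R) K : 1 <= p -> 0 < a -> 0 <= y ->
  \sum_(k < K) (2 ^+ k * a) `^ p * (2 ^+ k * a < y)%R%:R <= 2 * y `^ p.
Proof.
move=> p1 a0 y0; have p0 : 0 <= p := le_trans ler01 p1.
have full n : \sum_(k < n.+1) (2 ^+ k * a) `^ p <= 2 * (2 ^+ n * a) `^ p.
  elim: n => [|n IH].
    by rewrite big_ord1 expr0 mul1r; have := powR_ge0 a p; lra.
  rewrite big_ord_recr/=; apply: le_trans (lerD IH (lexx _)) _.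
  have : 2 * (2 ^+ n * a) `^ p <= (2 ^+ n.+1 * a) `^ p.
    rewrite exprS -mulrA [leRHS]powRM// ?mulr_ge0 ?exprn_ge0 ?(ltW a0)//.
    by apply: ler_wpM2r; [exact: powR_ge0|rewrite -[leLHS]powRr1// ler_powR ?ler1n].
  lra.
elim: K => [|K IH]; first by rewrite big_ord0 mulr_ge0 ?powR_ge0.
have [h|h] := ltP (2 ^+ K * a) y; last first.
  by rewrite big_ord_recr/= ltNge h mulr0 addr0.
apply: (@le_trans _ _ (\sum_(k < K.+1) (2 ^+ k * a) `^ p)).
  by apply: ler_sum => k _; case: (_ < y); rewrite ?mulr1// mulr0 powR_ge0.
apply: le_trans (full K) _; rewrite ler_pM2l// ler_powRl// ?(ltW h)//.
by rewrite mulr_ge0 ?exprn_ge0 ?(ltW a0).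
Qed.

Lemma runmax_bound (R : realType) N (G : cube N -> R) (a : R) : 0 < a ->
  exists K, forall x, G x <= 2 ^+ K * a.
Proof.
move=> a0; pose B := \sum_x `|G x|.
have [K hK] : exists K : nat, B / a <= 2 ^+ K.
  exists (Num.truncn (B / a)).+1; apply: (@le_trans _ _ (Num.truncn (B / a)).+1%:R).
    exact/ltW/truncnS_gt.
  by rewrite -natrX ler_nat ltnW// ltn_expl.
exists K => x; rewrite -ler_pdivrMr//; apply: le_trans hK.
rewrite ler_pM2r ?invr_gt0// (le_trans (ler_norm _))//.
by rewrite /B (bigD1 x)//= lerDl sumr_ge0.
Qed.

(** The good-lambda inequality is summed over dyadic levels with weights (2^k a)^p; for small [del]
    the tail of the transform on the right is absorbed. The constant is found before the space [V],
    so that it serves the L^p spaces of all cubes at once. *)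
Lemma extrapolation (R : realType) (p0 C0 p : R) : 0 < p0 -> 0 <= C0 -> 1 < p ->
  exists2 C : R, 0 <= C & forall V : normedModType R[i],
    mart_inj V p0 C0 -> mart_inj V p C.
Proof.
move=> p00 C00 p1.
have pp : 0 < p by lra.
(* [b] and [del] are chosen to make 2^p C0 (8 [del])^p0 at most 1/2, where 2^p is the price of
   passing from one dyadic level to the next. *)
pose b : R := (2 `^ (p + 1) * (C0 + 1))^-1.
have b0 : 0 < b by rewrite invr_gt0 mulr_gt0 ?powR_gt0//; lra.
pose del := Num.min (4^-1) (8^-1 * b `^ p0^-1).
have d0 : 0 < del by rewrite lt_min invr_gt0 ltr0n mulr_gt0 ?powR_gt0.
have d4 : del <= 4^-1 by rewrite ge_min lexx.
have db : (8 * del) `^ p0 <= b.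
  apply: (@le_trans _ _ ((b `^ p0^-1) `^ p0)).
    rewrite ler_powRl ?(ltW p00) ?mulr_ge0 ?(ltW d0)//.
    by rewrite -ler_pdivlMl// ge_min lexx orbT.
  by rewrite -powRrM mulVf ?gt_eqF// powRr1// ltW.
pose c := C0 * (8 * del) `^ p0.
have c0 : 0 <= c by rewrite mulr_ge0 ?powR_ge0.
have c2 : 2 `^ p * c <= 2^-1.
  have : 2 `^ p * c <= 2 `^ p * ((C0 + 1) * b).
    rewrite ler_pM2l ?powR_gt0//; apply: ler_pM; rewrite ?powR_ge0//; lra.
  rewrite /b powRD ?pnatr_eq0 ?implybT// powRr1//.
  have -> : 2 `^ p * ((C0 + 1) * (2 `^ p * 2 * (C0 + 1))^-1) = 2^-1 :> R.
    have n1 : C0 + 1 != 0 by rewrite gt_eqF//; lra.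
    have n2 : 2 `^ p != 0 :> R by rewrite gt_eqF// powR_gt0.
    by field; rewrite ?n1 ?n2.
  by [].
pose D := doob_cst p.
pose Cf : R := 2 `^ p * (2 * 2 `^ p * (2 * (del^-1 `^ p * D))).
have D0 : 0 <= D by exact: doob_cst_ge0.
exists Cf; first by do ?[apply: mulr_ge0; rewrite ?powR_ge0 ?D0 ?ler0n].
move=> V hm N tau L theta f inj th1.
pose F x := runmax (fun k => rnorm (ce (pre tau k) f x)) L.+1.
pose G x := runmax (fun k => rnorm (tr tau k theta f x)) L.+1.
have F0 x : 0 <= F x by exact: runmax_ge0.
have G0 x : 0 <= G x by exact: runmax_ge0.
have hF : mean (fun x => F x `^ p) <= D * mean (fun x => rnorm (f x) `^ p).
  by apply: doob => //; exact: pre_sub.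
apply: (@le_trans _ _ (mean (fun x => G x `^ p))).
  apply: ler_mean => x; rewrite ler_powRl ?rnorm_ge0 ?(ltW pp)//.
  exact: (@le_runmax _ (fun k => rnorm (tr tau k theta f x)) L).
set B := mean (fun x => rnorm (f x) `^ p) in hF *.
(* The levels start at [a]; what lies below contributes a multiple of a^p, which vanishes as [a]
   tends to 0. *)
suff key a : 0 < a -> mean (fun x => G x `^ p) <= Cf * B + a `^ p * (1 + 2 * 2 `^ p).
  have m0 : 0 < 1 + 2 * 2 `^ p :> R by rewrite addr_gt0// mulr_gt0 ?powR_gt0.
  apply/ler_addgt0Pr => e e0.
  have := key ((e / (1 + 2 * 2 `^ p)) `^ p^-1); rewrite powR_gt0 ?divr_gt0// => /(_ isT).
  rewrite -powRrM mulVf ?gt_eqF// powRr1 ?divr_ge0 ?(ltW e0) ?(ltW m0)//.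
  by rewrite divfK ?gt_eqF.
move=> a0.
have [K hK] := runmax_bound G a0.
pose lam k := 2 ^+ k * a.
have lam0 k : 0 < lam k by rewrite mulr_gt0 ?exprn_gt0.
pose A k := mean (fun x => (lam k < G x)%R%:R : R).
pose E k := mean (fun x => (lam k < F x / del)%R%:R : R).
have E0 k : 0 <= E k by exact: mean_ge0.
have A0 k : 0 <= A k by exact: mean_ge0.
have rec k : A k.+1 <= c * A k + E k.
  have gl := @good_lambda R V N p0 C0 tau L theta f p00 C00 hm inj th1 (lam k) del (lam0 k) d0 d4.
  apply: le_trans (lerD gl (lexx _)); rewrite -meanD; apply: ler_mean => x.
  rewrite -/(F x) -/(G x) /lam exprS -mulrA -/(lam k).
  rewrite ltr_pdivlMr// [lam k * del]mulrC.
  case: (2 * lam k < G x) => /=; last by rewrite addr_ge0.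
  by case: leP => _; rewrite /= ?addr0 ?add0r.
pose S := \sum_(k < K) lam k `^ p * A k.
pose T := \sum_(k < K) lam k `^ p * E k.
have A1 k : A k <= 1.
  by rewrite -[leRHS](@mean_cst R N); apply: ler_mean => x; case: (_ < _).
have hS : S <= a `^ p + 2 `^ p * (c * S + T).
  rewrite /S /T mulr_sumr -big_split/= mulr_sumr.
  have [->|K0] := posnP K; first by rewrite !big_ord0 addr0 powR_ge0.
  rewrite -(prednK K0) [X in X <= _]big_ord_recl [X in _ <= _ + X]big_ord_recr/=.
  apply: lerD; first by rewrite /lam expr0 mul1r -[leRHS]mulr1 ler_wpM2l ?powR_ge0.
  apply: (@le_trans _ _ (\sum_(i < K.-1) 2 `^ p * (c * (lam i `^ p * A i) + lam i `^ p * E i))).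
    apply: ler_sum => i _; rewrite /bump/= add1n {1}/lam exprS -mulrA powRM ?(ltW (lam0 _))//.
    rewrite -mulrA ler_pM2l ?powR_gt0// -/(lam i).
    have -> : c * (lam i `^ p * A i) + lam i `^ p * E i = lam i `^ p * (c * A i + E i) by ring.
    by rewrite ler_pM2l ?powR_gt0.
  rewrite lerDl mulr_ge0 ?powR_ge0// addr_ge0// mulr_ge0 ?powR_ge0//.
  by rewrite mulr_ge0 ?powR_ge0.
have hT : T <= 2 * (del^-1 `^ p * (D * B)).
  rewrite /T; under eq_bigr do rewrite -meanZ.
  rewrite -mean_sum; apply: (@le_trans _ _ (mean (fun x => 2 * (F x / del) `^ p))).
    by apply: ler_mean => x; apply: layer_lower; rewrite ?(ltW p1)// divr_ge0// ltW.
  rewrite meanZ ler_pM2l//; under eq_mean do rewrite mulrC powRM ?invr_ge0 ?(ltW d0)//.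
  by rewrite meanZ ler_pM2l ?powR_gt0 ?invr_gt0.
have S0 : 0 <= S by rewrite sumr_ge0// => k _; rewrite mulr_ge0 ?powR_ge0.
have hS2 : S <= 2 * (a `^ p + 2 `^ p * T).
  have : 2 `^ p * c * S <= 2^-1 * S by exact: ler_wpM2r.
  by move: hS; rewrite mulrDr mulrA; lra.
apply: (@le_trans _ _ (a `^ p + 2 `^ p * S)).
  apply: (@le_trans _ _ (mean (fun x => a `^ p + 2 `^ p *
    \sum_(k < K) lam k `^ p * (lam k < G x)%R%:R))).
    by apply: ler_mean => x; apply: layer_upper.
  rewrite meanD mean_cst meanZ mean_sum lerD2l ler_pM2l ?powR_gt0//.
  by apply: ler_sum => k _; rewrite meanZ.
have hS3 : 2 `^ p * S <= 2 `^ p * (2 * (a `^ p + 2 `^ p * (2 * (del^-1 `^ p * (D * B))))).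
  rewrite ler_pM2l ?powR_gt0//; apply: le_trans hS2 _.
  by rewrite ler_pM2l// lerD2l ler_pM2l ?powR_gt0.
rewrite /Cf; apply: le_trans (lerD (lexx _) hS3) _.
by rewrite le_eqVlt; apply/orP; left; apply/eqP; ring.
Qed.

(** * Unconditionality of martingale differences on the cube *)

(** A copy of the cube that carries the discrete sigma-algebra. Its uniform probability is built as
    a sum of Dirac masses, so that integrals become finite sums. *)
Definition dcube (N : nat) : Type := cube N.
HB.instance Definition _ N := Finite.copy (dcube N) (cube N).
Definition cube0 (N : nat) : cube N := [ffun=> false].
HB.instance Definition _ N := isPointed.Build (dcube N) (cube0 N).
HB.instance Definition _ N := @isMeasurable.Build default_measure_display
  (dcube N) discrete_measurable (@discrete_measurable0 (dcube N))
  (@discrete_measurableC (dcube N)) (@discrete_measurableU (dcube N)).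

Section Uniform.
Context {R : realType} {N : nat}.
Local Notation T := (dcube N).

Definition cube_weight : {nonneg R} := NngNum (@inv_expr2n_ge0 R N).

Definition cube_points (k : nat) : {measure set T -> \bar R} :=
  dirac (nth (cube0 N) (enum {: cube N}) k : T).

Definition cube_prob : set T -> \bar R :=
  mscale cube_weight (msum cube_points (2 ^ N)).

HB.instance Definition _ := Measure.on cube_prob.

Lemma sum_cube_points (V : nmodType) (F : T -> V) :
  \sum_(k < 2 ^ N) F (nth (cube0 N) (enum {: cube N}) k : T) = \sum_x F x.
Proof.
rewrite -(big_mkord xpredT (fun k => F (nth (cube0 N) (enum {: cube N}) k : T))).
have -> : (2 ^ N)%N = size (enum {: cube N}) by rewrite -cardE card_cube.
by rewrite -(big_nth (cube0 N) xpredT F) big_enum.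
Qed.

Lemma cube_probE (A : set T) : cube_prob A = (mean (fun x => \1_A x : R))%:E.
Proof.
rewrite /cube_prob /mscale /msum /mean EFinM; congr (_ * _)%E.
rewrite -(sum_cube_points (fun x => \1_A x : R)) -sumEFin.
by apply: eq_bigr => k _.
Qed.

Lemma cube_prob_setT : cube_prob setT = 1%E.
Proof.
by rewrite cube_probE (@eq_mean _ _ _ (fun=> 1)) ?mean_cst// => x; rewrite indicT.
Qed.

HB.instance Definition _ := @Measure_isProbability.Build _ _ R cube_prob cube_prob_setT.

Lemma cube_integral (g : T -> R) : (forall x, 0 <= g x) ->
  (\int[cube_prob]_x (g x)%:E = (mean g)%:E)%E.
Proof.
move=> g0; have mg : measurable_fun [set: T] (EFin \o g) by move=> _ B _.
rewrite (ge0_integral_mscale (msum cube_points (2 ^ N)) measurableT cube_weight mg)//; last by move=> x _; rewrite lee_fin.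
rewrite ge0_integral_measure_sum//; last by move=> x _; rewrite lee_fin.
rewrite /mean EFinM; congr (_ * _)%E.
rewrite -(sum_cube_points g) -sumEFin; apply: eq_bigr => k _.
by rewrite integral_dirac// diracT mul1e.
Qed.

Lemma cube_Lp_norm (V : normedModType R[i]) (p : R) (f : T -> V) :
  Lp_norm cube_prob p f = (mean (fun x => rnorm (f x) `^ p) `^ p^-1)%:E.
Proof.
rewrite /Lp_norm unlock /= -poweR_EFin; congr (_ `^ _)%E.
rewrite -cube_integral; last by move=> x; exact: powR_ge0.
apply: eq_integral => x _ /=; rewrite ger0_norm ?rnorm_ge0//.
Qed.

End Uniform.

Lemma sum_fsbig_range (R : pzRingType) (T : finType) (V : lmodType R) (s : T -> V) (c : T -> R) :
  \sum_(v \in range s) (\sum_(t | s t == v) c t) *: v = \sum_t c t *: s t.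
Proof.
have fin : finite_set (range s) by exact/finite_image/finite_finset.
rewrite fsbig_finite//=.
under eq_bigr do rewrite scaler_suml big_mkcond.
rewrite exchange_big/=; apply: eq_bigr => t _.
rewrite (bigD1_seq (s t))/= ?eqxx; last 2 first.
- by rewrite in_fset_set// inE; exists t.
- exact: finmap.fset_uniq.
rewrite big1 ?addr0// => v /negbTE.
by rewrite eq_sym => ->.
Qed.

(** A point of the disc is the midpoint of the chord perpendicular to its radius; the centre, where
    no direction is given, is treated apart. *)
Lemma unimodular_half_sum (R : realType) (t : R[i]) : `|t| <= 1 ->
  exists uv : R[i] * R[i], [/\ `|uv.1| = 1, `|uv.2| = 1 & t = (uv.1 + uv.2) / 2].
Proof.
move=> t1; have [->|t0] := eqVneq t 0.
  by exists (1, -1); rewrite /= normrN1 normr1 subrr mul0r.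
pose r : R := complex.Re `|t|; have tr : `|t| = r%:C by rewrite RRe_real ?normr_real.
have r0 : r != 0 by apply: contraNneq t0 => r0; rewrite -normr_eq0 tr r0.
have r1 : 0 <= 1 - r ^+ 2.
  rewrite subr_ge0 expr_le1// -?lecR ?rmorph1 -?tr ?normr_ge0//.
pose w : R[i] := r +i* Num.sqrt (1 - r ^+ 2).
have nw : `|w| = 1.
  by rewrite normc_def /= sqr_sqrtr// addrC subrK sqrtr1.
have nwc : `|w^*| = 1.
  by rewrite normc_def /= sqrrN sqr_sqrtr// addrC subrK sqrtr1.
have [e ne te] : exists2 e : R[i], `|e| = 1 & t = e * r%:C.
  exists (t / `|t|); first by rewrite normrM normfV normr_id divff// normr_eq0.
  by rewrite -tr divfK// normr_eq0.
exists (e * w, e * w^*); rewrite /= !normrM ne nw nwc mulr1; split=> //.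
rewrite -mulrDr (_ : w + w^* = r%:C * 2); last first.
  by apply/eqP; rewrite eq_complex /=; apply/andP; split; apply/eqP; ring.
by rewrite mulrA mulfK ?pnatr_eq0.
Qed.

Lemma powRD_le (R : realType) (p a b : R) : 0 <= p -> 0 <= a -> 0 <= b ->
  (a + b) `^ p <= 2 `^ p * (a `^ p + b `^ p).
Proof.
move=> p0 a0 b0; have h (x y : R) : 0 <= x -> x <= y -> (x + y) `^ p <= 2 `^ p * (x `^ p + y `^ p).
  move=> x0 xy; have y0 := le_trans x0 xy.
  apply: (@le_trans _ _ ((2 * y) `^ p)); first by rewrite ler_powRl ?addr_ge0//; lra.
  by rewrite powRM// ler_wpM2l ?powR_ge0// lerDr powR_ge0.
have [ab|/ltW ba] := leP a b; first exact: h.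
by rewrite addrC [X in _ * X]addrC; exact: h.
Qed.

Lemma sum_ce (R : realType) N (V : lmodType R[i]) (S : {set 'I_N}) (f : cube N -> V) :
  \sum_x ce S f x = \sum_x f x.
Proof.
rewrite /ce -scaler_sumr (sum_mix S f).
by rewrite scale_mean_cst.
Qed.

Section UMDCube.
Context {R : realType} {X : completeNormedModType R[i]}.
Context {N : nat} (tau : 'I_N -> nat) (L : nat) (f : cube N -> X).
Local Notation T := (dcube N).
Local Notation P := (@cube_prob R N).

Let F (k : nat) : set (set T) := [set A | meas (pre tau k) A].
Let df (j : 'I_L) (t : T) : X := ce (pre tau j.+1) f t - ce (pre tau j) f t.

Let mdf (j : 'I_L) : meas (pre tau j.+1) (df j : cube N -> X).
Proof.
move=> x y xy; rewrite /df (meas_ce f xy); congr (_ - _).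
exact: (meas_sub (pre_sub tau (leqnSn j)) (meas_ce f) xy).
Qed.

Let simple_df (G : set (set T)) (j : 'I_L) :
  (forall x, G (df j @^-1` [set x])) -> simple_fct G (df j).
Proof. by split => //; exact/finite_image/finite_finset. Qed.

Lemma cube_martingale_difference (p : R) : 0 < p ->
  martingale_difference P p F df.
Proof.
move=> p0; split.
- move=> k; split => //; split.
  + by move=> x y _.
  + by move=> A mA x y xy; rewrite /setD /= (mA _ _ xy).
  + move=> A mA x y xy; apply/propext; split => -[n _ An]; exists n => //.
      by rewrite -(mA n _ _ xy).
    by rewrite (mA n _ _ xy).
- by move=> k A; apply: meas_sub; exact: pre_sub.
- move=> j; exists (fun=> df j); split; last by move=> t; exact: cvg_cst.
  move=> _; apply: simple_df => v x y xy /=.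
  by rewrite /preimage/= (mdf xy).
- by move=> j; rewrite cube_Lp_norm ltry.
(* [df j] is simple and approximates itself. Its integral over [A] is the mean of the indicator of
   [A] times [df j], which vanishes by conditioning at time [j], when [A] is known. *)
move=> j A FA; exists (fun=> df j); split.
- by move=> _; exact: simple_df.
- rewrite (_ : (fun _ => _) = fun=> 0%E); first exact: cvg_cst.
  apply/funext => k; apply: integral0_eq => t _.
  by rewrite subrr /rnorm normr0.
rewrite (_ : (fun _ => _) = fun=> 0); first exact: cvg_cst.
apply/funext => k; rewrite /simple_integral.
pose c (t : T) : R[i] := ((2 ^+ N)^-1 * \1_A t : R)%:C.
transitivity (\sum_(v \in range (df j)) (\sum_(t | df j t == v) c t) *: v).
  apply: eq_fsbigr => v _; congr (_ *: _).
  rewrite -[X in fine X]/(cube_prob (A `&` df j @^-1` [set v])) cube_probE [fine _]/mean.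
  transitivity ((\sum_(t | df j t == v) (2 ^+ N)^-1 * \1_A t : R)%:C); last by rewrite rmorph_sum.
  congr (_%:C); rewrite -mulr_sumr; congr (_ * _); rewrite [RHS]big_mkcond.
  apply: eq_bigr => t _; rewrite !indicE; case: eqP => [e|ne].
    congr (_%:R); congr nat_of_bool; apply/idP/idP; rewrite !inE; first by case.
    by move=> At; split.
  by rewrite memNset// => -[].
rewrite sum_fsbig_range.
pose a (t : cube N) : R[i] := (\1_A t : R)%:C.
have ma : meas (pre tau j) a.
  move=> x y xy; rewrite /a !indicE; congr ((_%:R)%:C); congr nat_of_bool.
  by apply/idP/idP; rewrite !inE (FA _ _ xy).
transitivity ((2 ^+ N : R[i])^-1 *: \sum_t a t *: df j t).
  rewrite scaler_sumr; apply: eq_bigr => t _; rewrite scalerA /c rmorphM/=.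
  by rewrite fmorphV rmorphXn/= rmorph_nat.
rewrite -(sum_ce (pre tau j)) big1 ?scaler0// => t _.
rewrite ce_scale// /df ceB !ce_ce finset.setIid (_ : _ :&: _ = pre tau j) ?subrr ?scaler0//.
by apply/finset.setIidPl; exact: pre_sub.
Qed.
End UMDCube.

(** UMD compares the transform with f_L - f_0, which Doob's inequality bounds by [f]; multipliers in
    the disc are half-sums of unimodular ones. *)
Lemma UMD_mart_inj (R : realType) (X : completeNormedModType R[i]) : UMD X ->
  exists p C : R, [/\ 1 < p, 0 <= C & mart_inj X p C].
Proof.
move=> [p [p1 [beta umd]]].
have p0 : 0 < p by lra.
have D0 : 0 <= doob_cst p :> R by exact: doob_cst_ge0.
pose C1 : R := `|beta| `^ p * (2 `^ p * (2 * doob_cst p)).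
have C10 : 0 <= C1.
  apply: mulr_ge0; first exact: powR_ge0.
  by apply: mulr_ge0; [exact: powR_ge0|rewrite mulr_ge0].
exists p, (2 * C1); split => //; first by rewrite mulr_ge0.
move=> N tau L theta f _ th1.
have uni (u : nat -> R[i]) : (forall k, `|u k| = 1) ->
    mean (fun x => rnorm (tr tau L u f x) `^ p) <=
    C1 * mean (fun x => rnorm (f x) `^ p).
  move=> u1; pose D (j : 'I_L) (t : dcube N) : X := ce (pre tau j.+1) f t - ce (pre tau j) f t.
  have := umd _ _ _ L _ _ (fun k => u k) (@cube_martingale_difference R X N tau L f p p0) (fun k => u1 k).
  rewrite !cube_Lp_norm -EFinM lee_fin.
  set A := mean _; set B := mean _ => h.
  have A0 : 0 <= A by apply: mean_ge0 => x; exact: powR_ge0.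
  have B0 : 0 <= B by apply: mean_ge0 => x; exact: powR_ge0.
  have {h} hAB : A <= `|beta| `^ p * B.
    have h' : A `^ p^-1 <= `|beta| * B `^ p^-1.
      by apply: le_trans h _; rewrite ler_wpM2r ?powR_ge0// ler_norm.
    have := ler_powRl (ltW p0) (powR_ge0 _ _) h'.
    have pK z : 0 <= z -> (z `^ p^-1) `^ p = z by move=> z0; rewrite -powRrM mulVf ?gt_eqF// powRr1.
    rewrite (pK A)// powRM; [|exact: normr_ge0|exact: powR_ge0].
    by rewrite (pK B).
  apply: le_trans hAB _; rewrite /C1 -mulrA ler_wpM2l ?powR_ge0//.
  apply: (@le_trans _ _ (mean (fun x => 2 `^ p *
      (rnorm (ce (pre tau L) f x) `^ p + rnorm (ce (pre tau 0) f x) `^ p)))).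
    apply: ler_mean => x.
    rewrite -(big_mkord xpredT (fun j => ce (pre tau j.+1) f x - ce (pre tau j) f x)).
    rewrite (@telescope_sumr _ 0 L (fun j => ce (pre tau j) f x))//.
    apply: le_trans (powRD_le (ltW p0) (rnorm_ge0 _) (rnorm_ge0 _)).
    rewrite ler_powRl ?rnorm_ge0 ?(ltW p0)//.
    by rewrite -(rnormN (ce (pre tau 0) f x)) ler_rnormD.
  rewrite meanZ -mulrA ler_wpM2l ?powR_ge0// meanD -mulrA.
  have cb k : mean (fun x => rnorm (ce (pre tau k) f x) `^ p) <=
      doob_cst p * mean (fun x => rnorm (f x) `^ p).
    apply: le_trans (@doob R X p N (fun=> pre tau k) f 1 p1 (fun _ _ _ => fintype.subxx _)).
    apply: ler_mean => x; rewrite ler_powRl ?rnorm_ge0 ?(ltW p0)//.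
    by rewrite /= le_max lexx orbT.
  by have := cb L; have := cb 0%N; lra.
have /choice[uv huv] := fun k => unimodular_half_sum (th1 k).
pose u k := (uv k).1; pose v k := (uv k).2.
have u1 k : `|u k| = 1 by have [] := huv k.
have v1 k : `|v k| = 1 by have [] := huv k.
have tE x : tr tau L theta f x = 2^-1 *: (tr tau L u f x + tr tau L v f x).
  rewrite /tr -big_split scaler_sumr; apply: eq_bigr => k _ /=.
  rewrite -scalerDl scalerA; congr (_ *: _).
  by have [_ _ ->] := huv k; rewrite mulrC.
have r2 (w : X) : rnorm (2^-1 *: w) = 2^-1 * rnorm w.
  rewrite (_ : 2^-1 = (2^-1 : R)%:C); last by rewrite fmorphV rmorph_nat.
  by rewrite rnormZr ger0_norm// invr_ge0.
apply: (@le_trans _ _ (mean (fun x => rnorm (tr tau L u f x) `^ p +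
    rnorm (tr tau L v f x) `^ p))).
  apply: ler_mean => x; rewrite tE r2 powRM ?rnorm_ge0 ?invr_ge0//.
  apply: (@le_trans _ _ (2^-1 `^ p * (2 `^ p * (rnorm (tr tau L u f x) `^ p +
    rnorm (tr tau L v f x) `^ p)))).
    rewrite ler_wpM2l ?powR_ge0//; apply: le_trans (powRD_le (ltW p0) _ _); rewrite ?rnorm_ge0//.
    by rewrite ler_powRl ?rnorm_ge0 ?(ltW p0)// ler_rnormD.
  by rewrite mulrA -powRM ?invr_ge0// mulVf ?powR1 ?mul1r.
rewrite [leLHS]meanD mulr_natl mulr2n mulrDl.
exact: lerD (uni u u1) (uni v v1).
Qed.

Lemma ce_linear (R : realType) N (U V : lmodType R[i]) (g : U -> V) S
    (f : cube N -> U) x : linear g -> g (ce S f x) = ce S (g \o f) x.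
Proof.
move=> lg; have gZ a u : g (a *: u) = a *: g u.
  have g0 : g 0 = 0 by have := lg 1 0 0; rewrite !scale1r addr0 => /(congr1 (fun z => z - g 0)); rewrite subrr addrK.
  by have := lg a u 0; rewrite !addr0 g0 addr0.
have gD u v : g (u + v) = g u + g v by have := lg 1 u v; rewrite !scale1r.
rewrite /ce gZ; congr (_ *: _).
by apply: (big_morph g gD); rewrite -[0](scale0r 0) gZ scale0r.
Qed.

Section LpCubeMart.
Context {R : realType} {X : normedModType R[i]} {p : R} (p1 : 1 < p) {M : nat}.
Local Notation E := (Lp_cube X p1 M).

Lemma rnorm_Lp (f : E) : rnorm f = Lp_cube_norm f.
Proof. by []. Qed.

Lemma rnorm_Lp_powR (f : E) : rnorm f `^ p = mean (fun x => rnorm (f x) `^ p).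
Proof. by rewrite rnorm_Lp Lp_cube_norm_powR. Qed.

Definition lp_ev (y : cube M) (f : E) : X := f y.

Lemma lp_ev_linear y : linear (lp_ev y).
Proof. by move=> a u v; rewrite /lp_ev ffunE [X in X + _]ffunE. Qed.

Lemma lp_ev_sum y (I : Type) (r : seq I) (P : pred I) (F : I -> E) :
  lp_ev y (\sum_(i <- r | P i) F i) = \sum_(i <- r | P i) lp_ev y (F i).
Proof.
apply: (big_morph (lp_ev y)); last by rewrite /lp_ev ffunE.
by move=> u v; rewrite /lp_ev ffunE.
Qed.

Lemma lp_evZ y a (u : E) : lp_ev y (a *: u) = a *: lp_ev y u.
Proof. by rewrite /lp_ev ffunE. Qed.

Lemma lp_evB y (u v : E) : lp_ev y (u - v) = lp_ev y u - lp_ev y v.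
Proof. by rewrite /lp_ev ffunE [X in _ + X]ffunE. Qed.

Lemma tr_lp_ev N (tau : 'I_N -> nat) L theta (f : cube N -> E) x y :
  tr tau L theta f x y = tr tau L theta (fun z => f z y) x.
Proof.
rewrite -/(lp_ev y _) /tr lp_ev_sum; apply: eq_bigr => k _.
by rewrite lp_evZ lp_evB !(ce_linear _ _ _ (lp_ev_linear y)).
Qed.

(** The p-th power of the norm of [E] is a mean over the points [y], so at exponent [p] the
    inequality for [X] can be applied at each [y]. *)
Lemma mart_inj_Lp C : mart_inj X p C -> mart_inj E p C.
Proof.
move=> h N tau L theta f inj th1.
have e (g : cube N -> E) : mean (fun x => rnorm (g x) `^ p) =
    mean (fun y => mean (fun x => rnorm (lp_ev y (g x)) `^ p)).
  by rewrite -mean_swap; apply: eq_mean => x; exact: rnorm_Lp_powR.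
rewrite [leLHS]e [X in _ <= _ * X]e -meanZ; apply: ler_mean => y.
apply: le_trans (h N tau L theta (fun z => lp_ev y (f z)) inj th1).
by apply: ler_mean => x; rewrite {1}/lp_ev tr_lp_ev.
Qed.

End LpCubeMart.

(** Extrapolation moves the UMD exponent to [p] on [X], Fubini's theorem gives exponent [p] on
    L^p(X), and a second extrapolation gives 2 there, with a constant that depends on no space and
    hence not on [M]. *)
Lemma UMD_mart (R : realType) (X : completeNormedModType R[i]) (p : R) (p1 : 1 < p) :
  UMD X -> exists C C2 : R, [/\ 0 <= C, 0 <= C2, mart X p C &
    forall M, mart (Lp_cube X p1 M) 2 C2].
Proof.
move=> /UMD_mart_inj[p0 [C0 [p01 C00 m0]]].
have [C C0' hC] := @extrapolation R p0 C0 p (lt_trans ltr01 p01) C00 p1.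
have [C2 C20 hC2] := @extrapolation R p C 2 (lt_trans ltr01 p1) C0' (ltr1n R 2).
exists C, C2; split => //; first exact/mart_inj_mart/hC.
by move=> M; apply/mart_inj_mart/hC2/mart_inj_Lp/hC.
Qed.

(** * Walsh multipliers *)

(** Symbols depending on [|A|] alone cover the semigroup, the number operator and its resolvents; on
    the cube only [m 0], ..., [m N] matter. *)
Definition mult (R : realType) (X : lmodType R[i]) N (m : nat -> R[i])
    (f : {ffun cube N -> X}) : {ffun cube N -> X} :=
  [ffun x => \sum_(A : {set 'I_N}) (m #|A| * walsh A x) *: walsh_coef f A].

Section Mult.
Context {R : realType} {X : lmodType R[i]} {N : nat}.
Implicit Types (f g : {ffun cube N -> X}) (m : nat -> R[i]) (A S : {set 'I_N}).

Lemma walsh_coef_mult m f A : walsh_coef (mult m f) A = m #|A| *: walsh_coef f A.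
Proof.
apply: (walsh_coef_unique (c := fun A => m #|A| *: walsh_coef f A)) => x.
by rewrite ffunE; apply: eq_bigr => B _; rewrite scalerA mulrC.
Qed.

Lemma eq_mult m m' f : (forall k, (k <= N)%N -> m k = m' k) -> mult m f = mult m' f.
Proof.
move=> e; apply/ffunP => x; rewrite !ffunE; apply: eq_bigr => A _.
by rewrite e// -[leqRHS](card_ord N) max_card.
Qed.

Lemma multM m m' f : mult m (mult m' f) = mult (fun k => m k * m' k) f.
Proof.
apply/ffunP => x; rewrite !ffunE; apply: eq_bigr => A _.
by rewrite walsh_coef_mult scalerA mulrAC.
Qed.

Lemma mult1 f : mult (fun=> 1) f = f.
Proof.
by apply/ffunP => x; rewrite ffunE [RHS]walsh_expansion; apply: eq_bigr => A _; rewrite mul1r.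
Qed.

Lemma multDl m m' f : mult (fun k => m k + m' k) f = mult m f + mult m' f.
Proof.
apply/ffunP => x; rewrite !ffunE -big_split; apply: eq_bigr => A _ /=.
by rewrite mulrDl scalerDl.
Qed.

Lemma multZl c m f : mult (fun k => c * m k) f = c *: mult m f.
Proof.
apply/ffunP => x; rewrite !ffunE scaler_sumr; apply: eq_bigr => A _ /=.
by rewrite scalerA mulrA.
Qed.

Lemma mult_suml (I : Type) (r : seq I) (P : pred I) (m : I -> nat -> R[i]) f :
  mult (fun k => \sum_(i <- r | P i) m i k) f = \sum_(i <- r | P i) mult (m i) f.
Proof.
apply/ffunP => x; rewrite sum_ffunE ffunE.
under [RHS]eq_bigr do rewrite ffunE.
rewrite [RHS]exchange_big; apply: eq_bigr => A _.
by rewrite mulr_suml scaler_suml.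
Qed.

Lemma walsh_coef_linear A : linear (fun f => walsh_coef f A).
Proof.
move=> a u v; rewrite /walsh_coef [in RHS]scalerA mulrC -scalerA -scalerDr; congr (_ *: _).
rewrite scaler_sumr -big_split; apply: eq_bigr => x _ /=.
by rewrite !ffunE scalerDr !scalerA mulrC.
Qed.

Lemma mult_linear m : linear (mult (X := X) (N := N) m).
Proof.
move=> a u v; apply/ffunP => x; rewrite !ffunE scaler_sumr -big_split.
apply: eq_bigr => A _ /=.
by rewrite (walsh_coef_linear A a u v) scalerDr !scalerA [a * _]mulrC.
Qed.

(** Flipping a coordinate of [A] outside [S] changes the sign of the Walsh function, so its average
    over that coordinate vanishes. *)
Lemma ce_walsh S A (v : X) x :
  ce S (fun y => walsh A y *: v) x = (A \subset S)%:R * walsh A x *: v.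
Proof.
have [AS|] := boolP (A \subset S).
  rewrite mul1r; apply: ce_id => y z yz; congr (_ *: _).
  by apply: eq_bigr => i iA; rewrite yz// (fintype.subsetP AS).
move=> /fintype.subsetPn[i iA iS]; rewrite mul0r scale0r /ce.
rewrite (_ : \sum_y _ = 0) ?scaler0//.
have h : \sum_y walsh A (mix S x y) *: v = - \sum_y walsh A (mix S x y) *: v.
  rewrite {1}(reindex_inj (inv_inj (flipK i))) -sumrN; apply: eq_bigr => y _.
  rewrite -scaleNr; congr (_ *: _).
  rewrite /walsh (bigD1 i)//= [in RHS](bigD1 i)//= !ffunE (negbTE iS) eqxx.
  rewrite -mulNr; congr (_ * _); first by case: (y i); rewrite ?opprK.
  by apply: eq_bigr => k /andP[_ ki]; rewrite !ffunE (negbTE ki) addbF.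
have : (2 : R[i]) *: \sum_y walsh A (mix S x y) *: v = 0.
  by rewrite scaler_nat mulr2n {1}h addNr.
by move/eqP; rewrite scaler_eq0 pnatr_eq0 => /eqP.
Qed.

Lemma ce_expansion S f x :
  ce S f x = \sum_(A : {set 'I_N}) ((A \subset S)%:R * walsh A x) *: walsh_coef f A.
Proof.
rewrite (eq_ce S (walsh_expansion f)) ce_sum; apply: eq_bigr => A _.
exact: ce_walsh.
Qed.

End Mult.

(* Keeping each coordinate with a level distributed as q realizes the
   multipliers G^k, with G the tail of q, as averages of conditional
   expectations along a decreasing chain. *)
Lemma ce_average (R : realType) (X : lmodType R[i]) N n (q : 'I_n -> R)
    (f : {ffun cube N -> X}) (l : nat) x : \sum_s q s = 1 ->
  \sum_(tau : {ffun 'I_N -> 'I_n}) (\prod_i q (tau i))%:C *: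
    ce [set i | (l <= tau i)%N] f x =
  mult (fun k => (((\sum_(s < n | (l <= s)%N) q s) ^+ k)%:C)) f x.
Proof.
move=> q1; rewrite ffunE.
under eq_bigr do rewrite ce_expansion scaler_sumr.
rewrite exchange_big; apply: eq_bigr => A _ /=.
under eq_bigr do rewrite scalerA mulrA.
rewrite -scaler_suml -mulr_suml; congr (_ * _ *: _).
(* The levels are independent: all coordinates of [A] reach level [l] with probability G^|A|. *)
pose F (i : 'I_N) (s : 'I_n) : R := q s * ((i \in A) ==> (l <= s)%N)%:R.
transitivity ((\sum_(tau : {ffun 'I_N -> 'I_n}) \prod_i F i (tau i))%:C : R[i]).
  rewrite rmorph_sum; apply: eq_bigr => tau _.
  rewrite -[X in _ * X](rmorph_nat (real_complex R)) -rmorphM; congr (_%:C).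
  rewrite /F big_split/=; congr (_ * _).
  have [/fintype.subsetP sA|/fintype.subsetPn[i iA]] := boolP (A \subset _).
    rewrite big1// => i _; case: (boolP (i \in A)) => //= /sA.
    by rewrite inE => ->.
  by rewrite inE => /negbTE il; rewrite (bigD1 i)//= iA il mul0r.
rewrite -(bigA_distr_bigA F); congr (_%:C).
rewrite (bigID (mem A)) /= [X in _ * X]big1 ?mulr1; last first.
  move=> i /negbTE iA; rewrite -q1; apply: eq_bigr => s _.
  by rewrite /F iA mulr1.
rewrite -prodr_const; apply: eq_bigr => i iA.
rewrite [RHS]big_mkcond; apply: eq_bigr => s _.
by rewrite /F iA /=; case: ifP; rewrite ?mulr1 ?mulr0.
Qed.

Definition semi (R : realType) (t : R) (k : nat) : R[i] := (expR (- t * k%:R))%:C.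

Lemma semiE (R : realType) (t : R) k : semi t k = (expR (- t) ^+ k)%:C.
Proof. by rewrite /semi mulrC expRM_natl. Qed.

Lemma multBl (R : realType) (X : lmodType R[i]) N (m m' : nat -> R[i])
    (f : {ffun cube N -> X}) : mult (fun k => m k - m' k) f = mult m f - mult m' f.
Proof.
rewrite -scaleN1r -multZl -multDl; apply: eq_mult => k _.
by rewrite mulN1r.
Qed.

(** Weights and keys depend neither on [l] nor on [f] nor on the space. One average therefore
    represents all increments, and all members of a tuple, at once. *)
Lemma semi_average (R : realType) N (t : nat -> R) L :
  (forall l, 0 <= t l) -> (forall l, t l <= t l.+1) ->
  exists (w : {ffun 'I_N -> 'I_L.+2} -> R) (kappa : {ffun 'I_N -> 'I_L.+2} -> 'I_N -> nat),
  [/\ forall tau, 0 <= w tau, \sum_tau w tau = 1 &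
    forall (X : lmodType R[i]) (f : {ffun cube N -> X}) l x, (l <= L)%N ->
      mult (semi (t l)) f x =
      \sum_tau (w tau)%:C *: ce (pre (kappa tau) (L.+1 - l)) f x].
Proof.
move=> t0 tS.
(* Tail of the law of a level: a level at least l + 1 has probability exp(- t_l), level 0 takes the
   remaining mass 1 - exp(- t_0), and no level exceeds L + 1. *)
pose G s := if s is l.+1 then (if (l <= L)%N then expR (- t l) else 0) else 1.
have GS s : G s.+1 <= G s.
  case: s => [|s]; first by rewrite /= -expR0 ler_expR oppr_le0.
  rewrite /=; case: (ltnP s L) => sL; first by rewrite (ltnW sL) ler_expR lerN2.
  by case: ifP => // _; exact: expR_ge0.
pose q (s : 'I_L.+2) := G s - G s.+1.
have qtail l : (l <= L.+2)%N -> \sum_(s < L.+2 | (l <= s)%N) q s = G l.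
  move=> lL; rewrite -(big_geq_mkord l L.+2 xpredT (fun s => G s - G s.+1)).
  rewrite (eq_bigr (fun s => - G s.+1 - - G s)) => [|s _]; last by rewrite opprK addrC.
  by rewrite (telescope_sumr (fun s => - G s))//= ltnn oppr0 add0r opprK.
(* The sets of coordinates with level above [l] decrease in [l]; reversing the levels makes them the
   prefixes of a key. *)
exists (fun tau => \prod_i q (tau i)), (fun (tau : {ffun 'I_N -> 'I_L.+2}) i => (L.+1 - tau i)%N); split.
- by move=> tau; apply: prodr_ge0 => i _; rewrite subr_ge0.
- rewrite -(bigA_distr_bigA (fun=> q)) big1// => i _.
  by rewrite -[RHS](qtail 0%N).
move=> X f l x lL; have q1 : \sum_s q s = 1 by rewrite -[RHS](qtail 0%N).
have := ce_average f l.+1 x q1; rewrite qtail; last by rewrite ltnS leqW.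
rewrite /G lL => h; rewrite (@eq_mult _ _ _ _ (fun k => (expR (- t l) ^+ k)%:C)); last first.
  by move=> k _; rewrite semiE.
rewrite -h; apply: eq_bigr => tau _; congr (_ *: ce _ f x).
by apply/setP => i; rewrite !inE; have := ltn_ord (tau i); lia.
Qed.

Section LpCubeOp.
Context {R : realType} {X : normedModType R[i]} {p : R} (p1 : 1 < p) {N : nat}.
Local Notation E := (Lp_cube X p1 N).

Let p0 : 0 < p. Proof. exact: lt_trans p1. Qed.

Lemma Lp_rnorm_le (f g : E) (C : R) : 0 <= C ->
  mean (fun x => rnorm (f x) `^ p) <= C * mean (fun x => rnorm (g x) `^ p) ->
  rnorm f <= C `^ p^-1 * rnorm g.
Proof.
move=> C0 h; rewrite !rnorm_Lp /Lp_cube_norm -powRM// ?Lp_cube_mean_ge0//.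
by apply: ler_powRl => //; [rewrite invr_ge0 ltW|exact: Lp_cube_mean_ge0].
Qed.

Lemma rnorm_average (V : normedModType R[i]) (J : finType) (w : J -> R) (v : J -> V) (B : R) :
  (forall j, 0 <= w j) -> \sum_j w j = 1 -> (forall j, rnorm (v j) <= B) ->
  rnorm (\sum_j (w j)%:C *: v j) <= B.
Proof.
move=> w0 w1 h; apply: le_trans (rnorm_sum _ _ _) _.
rewrite -[B]mul1r -w1 mulr_suml; apply: ler_sum => j _.
by rewrite rnormZr ger0_norm// ler_wpM2l.
Qed.

Definition ceE (S : {set 'I_N}) (f : E) : E := [ffun x => ce S f x].

Definition trE (kappa : 'I_N -> nat) L theta (f : E) : E := [ffun x => tr kappa L theta f x].

Lemma lp_evE x (f : E) : f x = lp_ev x f.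
Proof. by []. Qed.

Lemma trE_ceE kappa L theta f : trE kappa L theta f =
  \sum_(k < L) theta k *: (ceE (pre kappa k.+1) f - ceE (pre kappa k) f).
Proof.
apply/ffunP => x; rewrite ffunE [RHS]lp_evE lp_ev_sum; apply: eq_bigr => k _.
by rewrite lp_evZ lp_evB /lp_ev !ffunE.
Qed.

Lemma rnorm_trE C kappa L theta f : mart X p C -> 0 <= C ->
  (forall k, `|theta k| <= 1) ->
  rnorm (trE kappa L theta f) <= C `^ p^-1 * rnorm f.
Proof.
move=> hm C0 th1; apply: Lp_rnorm_le => //.
apply: le_trans (hm N kappa L theta f th1).
by rewrite le_eqVlt; apply/orP; left; apply/eqP/eq_mean => x; rewrite ffunE.
Qed.

(** For each key the sum is a martingale transform with the multipliers in reversed order, and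
    averaging over the keys does not increase the bound. *)
Lemma semi_transform C (t : nat -> R) L (theta : nat -> R[i]) (f : E) :
  mart X p C -> 0 <= C ->
  (forall l, 0 <= t l) -> (forall l, t l <= t l.+1) -> (forall l, `|theta l| <= 1) ->
  rnorm (mult (fun k => \sum_(l < L) theta l * (semi (t l) k - semi (t l.+1) k)) f : E) <=
  C `^ p^-1 * rnorm f.
Proof.
move=> hm C0 t0 tS th1.
have [w [kappa [w0 w1 hw]]] := semi_average N L t0 tS.
(* T(t_l) - T(t_(l+1)) comes from the increment at time L - l. These times run over 1, ..., L, so
   time 0 gets the multiplier 0. *)
pose th' k : R[i] := if k is 0%N then 0 else theta (L - k)%N.
have th'1 k : `|th' k| <= 1 by case: k => [|k] //=; rewrite normr0 ler01.
have -> : mult (fun k => \sum_(l < L) theta l * (semi (t l) k - semi (t l.+1) k)) f =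
    \sum_tau (w tau)%:C *: trE (kappa tau) L.+1 th' f :> E.
  rewrite mult_suml; apply/ffunP => x; rewrite [LHS]lp_evE [RHS]lp_evE !lp_ev_sum.
  transitivity (\sum_(l < L) theta l *: (\sum_tau (w tau)%:C *:
     (ce (pre (kappa tau) (L - l).+1) f x - ce (pre (kappa tau) (L - l)) f x))).
    apply: eq_bigr => l _; rewrite multZl lp_evZ; congr (_ *: _).
    rewrite multBl lp_evB /lp_ev.
    rewrite hw ?(ltnW (ltn_ord l))// hw ?ltn_ord// -sumrB.
    by apply: eq_bigr => tau _; rewrite scalerBr subSn ?(ltnW (ltn_ord l))// subSS.
  under eq_bigr do rewrite scaler_sumr.
  rewrite exchange_big; apply: eq_bigr => tau _ /=.
  rewrite lp_evZ /lp_ev ffunE /tr big_ord_recl /= scale0r add0r scaler_sumr.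
  rewrite [RHS](reindex_inj rev_ord_inj) /=; apply: eq_bigr => l _.
  rewrite /bump /= !add1n !scalerA mulrC.
  have -> : (L - l.+1).+1 = (L - l)%N by rewrite -subSn// subSS.
  by rewrite subKn// ltnW.
apply: rnorm_average => // tau; exact: rnorm_trE.
Qed.

End LpCubeOp.

(** * Rademacher averages *)

Definition sgn (R : realType) n (x : cube n) (j : 'I_n) : R[i] := (-1) ^+ x j.

Lemma ltr12 (R : realType) : 1 < 2 :> R.
Proof. by rewrite ltr1n. Qed.

(** A random sum is a point of the L^2 space of the cube of signs, so that [radnorm] inherits the
    properties of a norm. *)
Definition radfun (R : realType) (V : normedModType R[i]) n (F : 'I_n -> V) :
    Lp_cube V (ltr12 R) n :=
  [ffun x => \sum_(j < n) sgn R x j *: F j].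

HB.lock Definition radnorm (R : realType) (V : normedModType R[i]) n (F : 'I_n -> V) : R :=
  rnorm (radfun F).

Lemma rad_ge0 (R : realType) (V : normedModType R[i]) n (F : 'I_n -> V) : 0 <= radnorm F.
Proof. by rewrite radnorm.unlock; exact: rnorm_ge0. Qed.

Lemma rad_powR (R : realType) (V : normedModType R[i]) n (F : 'I_n -> V) :
  radnorm F `^ 2 = mean (fun x => rnorm (\sum_(j < n) sgn R x j *: F j) `^ 2).
Proof.
rewrite radnorm.unlock rnorm_Lp_powR; apply: eq_mean => x.
by rewrite /radfun ffunE.
Qed.

Lemma powR2K (R : realType) (z : R) : 0 <= z -> (z `^ 2) `^ 2^-1 = z.
Proof. exact: powRK_inv. Qed.

Lemma le_sqrt_powR2 (R : realType) (x y C : R) : 0 <= x -> 0 <= y -> 0 <= C ->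
  x `^ 2 <= C * y `^ 2 -> x <= Num.sqrt C * y.
Proof.
move=> x0 y0 C0 h; rewrite -[x]powR2K// -[y]powR2K// -powR12_sqrt//.
by rewrite -powRM ?powR_ge0//; apply: ler_powRl; rewrite ?powR_ge0// invr_ge0.
Qed.

Lemma Re_normC (R : rcfType) (z : R) : complex.Re `|z%:C| = `|z|.
Proof. by rewrite normc_def/= expr0n addr0 sqrtr_sqr. Qed.

Section Rad.
Context {R : realType} {V : normedModType R[i]} {n : nat}.
Implicit Types (F G : 'I_n -> V).

Lemma eq_rad F G : F =1 G -> radnorm F = radnorm G.
Proof.
move=> e; rewrite radnorm.unlock; congr rnorm; apply/ffunP => x; rewrite !ffunE.
by apply: eq_bigr => j _; rewrite e.
Qed.

Lemma rad_sum (I : Type) (r : seq I) (P : pred I) (F : I -> 'I_n -> V) :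
  radnorm (fun j => \sum_(i <- r | P i) F i j) <= \sum_(i <- r | P i) radnorm (F i).
Proof.
rewrite radnorm.unlock; apply: le_trans (rnorm_sum _ _ _); rewrite le_eqVlt; apply/orP; left; apply/eqP.
congr rnorm; apply/ffunP => x; rewrite [RHS]lp_evE lp_ev_sum ffunE.
under [LHS]eq_bigr do rewrite scaler_sumr.
by rewrite exchange_big; apply: eq_bigr => i _; rewrite /lp_ev ffunE.
Qed.

Lemma radD F G : radnorm (fun j => F j + G j) <= radnorm F + radnorm G.
Proof.
rewrite radnorm.unlock; apply: le_trans (ler_rnormD _ _); rewrite le_eqVlt; apply/orP; left; apply/eqP.
congr rnorm; apply/ffunP => x; rewrite !ffunE -big_split.
by apply: eq_bigr => j _; rewrite scalerDr.
Qed.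

Lemma radZ (c : R[i]) F : radnorm (fun j => c *: F j) = complex.Re `|c| * radnorm F.
Proof.
rewrite radnorm.unlock -rnormZ; congr rnorm; apply/ffunP => x.
rewrite [RHS]lp_evE lp_evZ /lp_ev !ffunE scaler_sumr.
by apply: eq_bigr => j _; rewrite !scalerA mulrC.
Qed.

Lemma rad_op (V' : normedModType R[i]) (T : V -> V') (B : R) F : linear T -> 0 <= B ->
  (forall v, rnorm (T v) <= B * rnorm v) -> radnorm (fun j => T (F j)) <= B * radnorm F.
Proof.
move=> lT B0 hT.
have [TZ TD] : (forall a u, T (a *: u) = a *: T u) /\ (forall u v, T (u + v) = T u + T v).
  have TD u v : T (u + v) = T u + T v by have := lT 1 u v; rewrite !scale1r.
  have T0 : T 0 = 0 by have := TD 0 0; rewrite addr0 => /(congr1 (fun z => z - T 0)); rewrite subrr addrK.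
  by split => // a u; have := lT a u 0; rewrite !addr0 T0 addr0.
have -> : B = Num.sqrt (B ^+ 2) by rewrite sqrtr_sqr ger0_norm.
apply: le_sqrt_powR2; rewrite ?rad_ge0 ?sqr_ge0//.
rewrite [leLHS](rad_powR (fun j => T (F j))).
rewrite (rad_powR F).
rewrite -[leRHS]meanZ.
apply: ler_mean => x.
rewrite -powR_mulrn// -powRM ?rnorm_ge0//; apply: ler_powRl; rewrite ?rnorm_ge0//.
rewrite (_ : \sum_(j < n) _ = T (\sum_(j < n) sgn R x j *: F j)) ?hT//.
rewrite [RHS](big_morph T TD (_ : T 0 = 0)); first by apply: eq_bigr => j _; rewrite TZ.
by rewrite -(scale0r 0) TZ scale0r.
Qed.

Lemma rad_sign (b : 'I_n -> bool) F : radnorm (fun j => (-1) ^+ b j *: F j) = radnorm F.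
Proof.
have r2 : 0 < 2 :> R by rewrite ltr0n.
apply: (powR_injective r2); [exact: rad_ge0|exact: rad_ge0|].
apply: etrans (rad_powR _) _; apply: etrans _ (esym (rad_powR _)).
rewrite /mean; congr (_ * _).
pose s (x : cube n) : cube n := [ffun j => x j (+) b j].
have sK : involutive s by move=> x; apply/ffunP => j; rewrite !ffunE -addbA addbb addbF.
rewrite (reindex_inj (inv_inj sK)); apply: eq_bigr => x _.
congr (rnorm _ `^ _); apply: eq_bigr => j _.
by rewrite /sgn scalerA ffunE -signr_addb -addbA addbb addbF.
Qed.

(** A number s in [-1, 1] is the average of 1 and -1 with weights (1 + s)/2 and (1 - s)/2, and
    changing a sign preserves [radnorm]; the coefficients are replaced one at a time. *)
Lemma rad_real (a : 'I_n -> R) F : (forall j, `|a j| <= 1) ->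
  radnorm (fun j => (a j)%:C *: F j) <= radnorm F.
Proof.
move=> a1.
pose c k (j : 'I_n) : R := if (j < k)%N then a j else 1.
suff h k : radnorm (fun j => (c k j)%:C *: F j) <= radnorm F.
  apply: le_trans (h n); rewrite le_eqVlt; apply/orP; left; apply/eqP/eq_rad => j.
  by rewrite /c ltn_ord.
elim: k => [|k IH].
  by rewrite (@eq_rad _ F)// => j; rewrite /c ltn0 scale1r.
apply: le_trans IH; have [nk|kn] := leqP n k.
  rewrite le_eqVlt; apply/orP; left; apply/eqP/eq_rad => j.
  by rewrite /c !(leq_trans (ltn_ord j))// leqW.
pose k0 := Ordinal kn; pose G j := (c k j)%:C *: F j.
pose b (j : 'I_n) := j == k0.
have := a1 k0; set s := a k0; rewrite ler_norml => /andP[s1 s2].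
have e j : (c k.+1 j)%:C *: F j = ((1 + s) / 2)%:C *: G j +
    ((1 - s) / 2)%:C *: ((-1) ^+ b j *: G j).
  rewrite /G !scalerA -scalerDl /b /c; congr (_ *: _).
  have [->|jk] := eqVneq j k0.
    rewrite /= ltnn ltnSn expr1 mulr1 mulr1 mulrN1 -rmorphN -rmorphD /=; congr (_%:C).
    by rewrite /s; field.
  have -> : (j < k.+1)%N = (j < k)%N by rewrite ltnS leq_eqVlt (_ : _ == _ = false)//; exact/negbTE.
  rewrite expr0 mulr1 -!rmorphM -rmorphD/=; congr (_%:C).
  by field.
rewrite (eq_rad e); apply: le_trans (radD _ _) _.
rewrite !radZ rad_sign -mulrDl.
have -> : complex.Re `|((1 + s) / 2)%:C| + complex.Re `|((1 - s) / 2)%:C| = 1.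
  by rewrite !Re_normC !ger0_norm; [field|lra|lra].
by rewrite mul1r.
Qed.

(** Real and imaginary parts are contracted separately, whence the factor 2. *)
Lemma rad_contraction (a : 'I_n -> R[i]) (B : R) F : 0 <= B ->
  (forall j, `|a j| <= B%:C) ->
  radnorm (fun j => a j *: F j) <= 2 * B * radnorm F.
Proof.
rewrite le_eqVlt => /predU1P[<-|B0] aB.
  rewrite (@eq_rad _ (fun j => 0 *: F j)) ?radZ ?normr0 ?mulr0 ?mul0r// => j.
  by have := aB j; rewrite normr_le0 => /eqP ->.
have part (c : 'I_n -> R) : (forall j, `|c j| <= B) -> radnorm (fun j => (c j)%:C *: F j) <= B * radnorm F.
  move=> cB; rewrite (@eq_rad _ (fun j => B%:C *: ((c j / B)%:C *: F j))); last first.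
    by move=> j; rewrite scalerA -rmorphM/= mulrC divfK// gt_eqF.
  rewrite (radZ B%:C (fun j => (c j / B)%:C *: F j)) Re_normC ger0_norm ?(ltW B0)//.
  apply: ler_wpM2l; first exact: ltW.
  apply: rad_real => j.
  by rewrite normrM normfV [`|B|]gtr0_norm// ler_pdivrMr// mul1r.
have ReIm j : `|complex.Re (a j)| <= B /\ `|complex.Im (a j)| <= B.
  have := aB j; rewrite normc_def lecR => h.
  by split; apply: le_trans h; rewrite -[leLHS]sqrtr_sqr ler_wsqrtr// ?lerDl ?lerDr sqr_ge0.
rewrite (@eq_rad _ (fun j => (complex.Re (a j))%:C *: F j + 'i *: ((complex.Im (a j))%:C *: F j))).
  apply: le_trans (radD _ _) _.
  rewrite (radZ 'i (fun j => (complex.Im (a j))%:C *: F j)) normCi [complex.Re 1]/= mul1r -mulrA mulr_natl mulr2n.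
  by apply: lerD; apply: part => j; have [] := ReIm j.
move=> j; rewrite scalerA -scalerDl; congr (_ *: _).
by rewrite {1}[a j]complexE.
Qed.

End Rad.

Lemma linear0 (K : pzRingType) (U V : lmodType K) (g : U -> V) : linear g -> g 0 = 0.
Proof.
by move=> lg; have := lg (-1) 0 0; rewrite scaler0 addr0 scaleN1r addNr.
Qed.

Lemma linearZ_fun (K : pzRingType) (U V : lmodType K) (g : U -> V) a u :
  linear g -> g (a *: u) = a *: g u.
Proof. by move=> lg; have := lg a u 0; rewrite (linear0 lg) !addr0. Qed.

Lemma linear_sum_fun (K : pzRingType) (U V : lmodType K) (g : U -> V) (J : Type)
    (r : seq J) (P : pred J) (F : J -> U) : linear g ->
  g (\sum_(j <- r | P j) F j) = \sum_(j <- r | P j) g (F j).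
Proof.
move=> lg; apply: (big_morph g); last exact: linear0.
by move=> u v; have := lg 1 u v; rewrite !scale1r.
Qed.

Lemma sgn_walsh (R : realType) n (x : cube n) (j : 'I_n) : sgn R x j = walsh [set j] x.
Proof. by rewrite /walsh big_set1. Qed.

Lemma sum_sgn (R : realType) n (i j : 'I_n) :
  \sum_(x : cube n) sgn R x i * sgn R x j = 2 ^+ n * (i == j)%:R.
Proof.
under eq_bigr do rewrite !sgn_walsh.
by rewrite sum_walsh_A (inj_eq finset.set1_inj).
Qed.

Lemma norm_sgn (R : realType) n (x : cube n) (j : 'I_n) : `|sgn R x j| = 1.
Proof. by rewrite /sgn normr_sign. Qed.

Section Diagonal.
Context {R : realType} {X : normedModType R[i]} {p : R} (p1 : 1 < p) {N : nat}.
Local Notation E := (Lp_cube X p1 N).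

Definition mulop (m : nat -> R[i]) (f : E) : E := mult m f.

Lemma mulop_linear m : linear (mulop m).
Proof. exact: mult_linear. Qed.

(* Averaging over independent signs theta extracts from
   (sum_i theta_i psi_i) (sum_j theta_(idx j) F_j) the terms with i = idx j. *)
Lemma rad_diagonal (I n : nat) (psi : 'I_I -> nat -> R[i]) (B : R) (idx : 'I_n -> 'I_I)
    (F : 'I_n -> E) : 0 <= B ->
  (forall (x : cube I) (f : E),
    rnorm (mulop (fun k => \sum_i sgn R x i * psi i k) f) <= B * rnorm f) ->
  radnorm (fun j => mulop (psi (idx j)) (F j)) <= B * radnorm F.
Proof.
move=> B0 h.
pose W (x : cube I) : nat -> R[i] := fun k => \sum_i sgn R x i * psi i k.
pose c : R := (2 ^+ I)^-1.
pose G (x : cube I) j := c%:C *: ((-1) ^+ x (idx j) *: mulop (W x) (F j)).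
have e j : mulop (psi (idx j)) (F j) = \sum_x G x j.
  rewrite /G -scaler_sumr; rewrite /mulop /W.
  transitivity (c%:C *: \sum_(x : cube I) \sum_i
     (sgn R x (idx j) * sgn R x i) *: mult (psi i) (F j) : E); last first.
    congr (_ *: _); apply: eq_bigr => x _; rewrite mult_suml scaler_sumr.
    by apply: eq_bigr => i _; rewrite multZl scalerA.
  rewrite exchange_big (bigD1 (idx j))//= [X in _ + X]big1 ?addr0; last first.
    move=> i ij; rewrite -scaler_suml sum_sgn eq_sym (negbTE ij) mulr0 scale0r//.
  rewrite -scaler_suml sum_sgn eqxx mulr1 scalerA.
  rewrite /c fmorphV rmorphXn/= rmorph_nat mulVf ?scale1r// expC2n_neq0.
rewrite (eq_rad e); apply: le_trans (rad_sum _ _ _) _.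
apply: (@le_trans _ _ (\sum_(x : cube I) c * (B * radnorm F))).
  apply: ler_sum => x _; rewrite /G.
  rewrite (radZ c%:C (fun j => (-1) ^+ x (idx j) *: mulop (W x) (F j))).
  rewrite Re_normC ger0_norm ?inv_expr2n_ge0//; apply: ler_wpM2l; first exact: inv_expr2n_ge0.
  rewrite (rad_sign (fun j => x (idx j)) (fun j => mulop (W x) (F j))).
  by apply: (rad_op _ (mulop_linear (W x)) B0) => v; exact: h.
rewrite sumr_const card_cube -[leLHS]mulr_natl natrX mulrA divff ?mul1r//.
Qed.

End Diagonal.

(** * Stein's inequality *)

(** The mean is invariant under translations of the cube; averaging over the translations of the
    first [n] coordinates makes the restricted point uniform. *)
Lemma mean_marginal (R : realType) n L (phi : cube n -> R) :
  mean (fun x : cube (n + L) => phi [ffun j => x (lshift L j)]) = mean phi.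
Proof.
pose res (x : cube (n + L)) : cube n := [ffun j => x (lshift L j)].
pose add k (x y : cube k) : cube k := [ffun j => x j (+) y j].
have addK k (y : cube k) : involutive (fun x => add k x y).
  by move=> x; apply/ffunP => j; rewrite !ffunE -addbA addbb addbF.
have addC k (x y : cube k) : add k x y = add k y x.
  by apply/ffunP => j; rewrite !ffunE addbC.
have shift k (y : cube k) (psi : cube k -> R) : mean (fun x => psi (add k x y)) = mean psi.
  rewrite /mean; congr (_ * _); apply/esym.
  by rewrite (reindex_inj (inv_inj (addK k y))).
pose ext (y : cube n) : cube (n + L) := [ffun i : 'I_(n + L) => if fintype.split i is inl j then y j else false].
have resE x y : res (add _ x (ext y)) = add _ (res x) y.
  apply/ffunP => j; rewrite !ffunE; congr (_ (+) _).
  case: split_ordP => i; first by move/lshift_inj ->.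
  by move/eqP; rewrite eq_lrshift.
rewrite -/(mean (fun x => phi (res x))) -[LHS](@mean_cst R n).
transitivity (mean (fun y => mean (fun x : cube (n + L) => phi (add _ y (res x))))).
  apply: eq_mean => y; rewrite -[LHS](shift _ (ext y) (fun x => phi (res x))); apply: eq_mean => x.
  by rewrite [X in phi X = _]resE addC.
rewrite mean_swap -[RHS](@mean_cst R (n + L)); apply: eq_mean => x.
by rewrite (shift _ (res x)).
Qed.

Lemma walsh_set2 (R : realType) n (i j : 'I_n) (x : cube n) : i != j ->
  walsh [set i; j] x = sgn R x i * sgn R x j.
Proof. by move=> ij; rewrite /walsh big_setU1 ?inE// big_set1. Qed.

Lemma sum_jump (R : pzRingType) (theta : nat -> R) K m : (m < K)%N ->
  \sum_(k < K) theta k * ((m < k.+1)%N%:R - (m < k)%N%:R) = theta m.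
Proof.
move=> mK; rewrite (bigD1 (Ordinal mK))//= ltnn ltnSn subr0 mulr1.
rewrite big1 ?addr0// => k; rewrite -val_eqE /= => km.
by rewrite ltnS [(m <= k)%N]leq_eqVlt eq_sym (negbTE km) subrr mulr0.
Qed.

Section Stein.
Context {R : realType} {X : normedModType R[i]} {p : R} (p1 : 1 < p) {N : nat}.
Local Notation E := (Lp_cube X p1 N).
Variables (C C2 : R).
Hypothesis C0 : 0 <= C.
Hypothesis C20 : 0 <= C2.
Hypothesis hX : mart X p C.
Hypothesis hE : mart E 2 C2.
Variables (n L : nat) (kappa : 'I_N -> nat) (l : 'I_n -> nat).
Hypothesis lL : forall j, (l j <= L)%N.

Let D (i : nat) (f : E) : E := ceE (pre kappa i.+1) f - ceE (pre kappa i) f.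

Lemma ceE_ceE S S' (f : E) : ceE S (ceE S' f) = ceE (S :&: S') f.
Proof.
apply/ffunP => x; rewrite !ffunE -ce_ce; apply: eq_ce => y.
by rewrite ffunE.
Qed.

Lemma ceE_linear S : linear (ceE S : E -> E).
Proof.
move=> a u v; apply/ffunP => x; rewrite [LHS]lp_evE [RHS]lp_evE.
rewrite [RHS]lp_ev_linear /lp_ev !ffunE -ceZ -ceD; apply: eq_ce => y.
by rewrite lp_evE lp_ev_linear.
Qed.

Lemma pre_capl i j : (i <= j)%N -> pre kappa i :&: pre kappa j = pre kappa i.
Proof. by move=> ij; apply/finset.setIidPl; exact: pre_sub. Qed.

Lemma pre_capr i j : (i <= j)%N -> pre kappa j :&: pre kappa i = pre kappa i.
Proof. by move=> ij; rewrite finset.setIC pre_capl. Qed.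

Let ceB S (u v : E) : ceE S (u - v) = ceE S u - ceE S v.
Proof.
by rewrite -[in LHS]scaleN1r addrC ceE_linear scaleN1r addrC.
Qed.

Lemma D_linear i : linear (D i).
Proof.
move=> a u v; rewrite /D !ceE_linear scalerBr; set a1 := a *: _; set a2 := a *: _.
by rewrite opprD addrACA.
Qed.

Lemma D_D i k (f : E) : D k (D i f) = (i == k)%:R *: D i f.
Proof.
rewrite /D !ceB !ceE_ceE; case: (ltngtP i k) => [ik|ki|->].
- rewrite (pre_capr ik) (pre_capr (ltnW ik)) (pre_capr (leqW ik)).
  by rewrite (pre_capr (leqW (ltnW ik))) subrr scale0r.
- rewrite (pre_capl ki) (pre_capl (ltnW ki)) (pre_capl (leqW ki)).
  by rewrite (pre_capl (leqW (ltnW ki))) !subrr scale0r.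
rewrite !finset.setIid (pre_capl (leqnSn k)) (pre_capr (leqnSn k)).
by rewrite subrr subr0 scale1r.
Qed.

Let dl (x : cube (n + L)) (j : 'I_n) : R[i] := sgn R x (lshift L j).
Let dr (x : cube (n + L)) (i : 'I_L) : R[i] := sgn R x (rshift n i).

(** With signs [dl] for the indices and [dr] for the times, [Psi] sums dl_j dr_i D_i F_j over all
    pairs and [Phi] over those with i < l_j. For fixed signs, transforms on L^p(X) by [dr] bound
    [Psi] by the sum of the dl_j F_j and, since dr_i squares to 1, the desired sum by [Phi]. The
    truncation from [Psi] to [Phi] is a martingale transform in the signs themselves, with values in
    [E] and exponent 2. *)
Lemma stein_chain (F : 'I_n -> E) :
  radnorm (fun j => ceE (pre kappa (l j)) (F j) - ceE (pre kappa 0) (F j)) <=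
  C `^ p^-1 * Num.sqrt C2 * C `^ p^-1 * radnorm F.
Proof.
set B := C `^ p^-1; have B0 : 0 <= B by exact: powR_ge0.
pose sF (x : cube (n + L)) : E := \sum_(j < n) dl x j *: F j.
pose Phi (x : cube (n + L)) : E :=
  \sum_(j < n) \sum_(i < L | (i < l j)%N) (dl x j * dr x i) *: D i (F j).
pose Psi (x : cube (n + L)) : E :=
  \sum_(j < n) \sum_(i < L) (dl x j * dr x i) *: D i (F j).
have DZ i a u : D i (a *: u) = a *: D i u by exact: linearZ_fun (D_linear i).
have D0 i : D i 0 = 0 by exact: linear0 (D_linear i).
have Dsum i (J : finType) (P : pred J) (G : J -> E) :
  D i (\sum_(j | P j) G j) = \sum_(j | P j) D i (G j).
  exact: linear_sum_fun (D_linear i).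
have Dsum_trE (u : nat -> R[i]) (f : E) : \sum_(i < L) u i *: D i f = trE kappa L u f.
  by rewrite trE_ceE.
pose u (x : cube (n + L)) k : R[i] := if insub k is Some i then dr x i else 1.
have uE x (i : 'I_L) : u x i = dr x i by rewrite /u valK.
have u1 x k : `|u x k| <= 1.
  by rewrite /u; case: insubP => [i _ _|_]; rewrite ?norm_sgn ?normr1.
have drr x i : dr x i * dr x i = 1 by rewrite /dr /sgn -signr_addb addbb.
have stepA x : rnorm (\sum_(j < n) dl x j *:
    (ceE (pre kappa (l j)) (F j) - ceE (pre kappa 0) (F j))) <= B * rnorm (Phi x).
  apply: le_trans (rnorm_trE kappa L (Phi x) hX C0 (u1 x)).
  rewrite -Dsum_trE le_eqVlt; apply/orP; left; apply/eqP; congr rnorm.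
  under [RHS]eq_bigr => k _ do rewrite uE /Phi Dsum scaler_sumr.
  rewrite exchange_big; apply: eq_bigr => j _ /=.
  rewrite -(telescope_sumr (fun i => ceE (pre kappa i) (F j)) (leq0n (l j))) big_mkord.
  rewrite (big_ord_widen_cond L xpredT (fun i => D i (F j)) (lL j)) /=.
  rewrite scaler_sumr big_mkcond; apply: eq_bigr => k _ /=.
  rewrite (big_mkcond (fun i : 'I_L => (i < l j)%N)) /= Dsum (bigD1 k)//=.
  rewrite big1 ?addr0; last first.
    move=> i ik; case: ifP => _; last exact: D0.
    by rewrite DZ D_D -val_eqE in ik *; rewrite (negbTE ik) scale0r scaler0.
  case: ifP => _; last by rewrite D0 scaler0.
  by rewrite DZ D_D eqxx scale1r scalerA mulrCA drr mulr1.
have stepC x : rnorm (Psi x) <= B * rnorm (sF x).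
  apply: le_trans (rnorm_trE kappa L (sF x) hX C0 (u1 x)).
  rewrite -Dsum_trE le_eqVlt; apply/orP; left; apply/eqP; congr rnorm.
  rewrite /Psi exchange_big; apply: eq_bigr => k _ /=.
  rewrite uE /sF Dsum scaler_sumr; apply: eq_bigr => j _.
  by rewrite DZ scalerA mulrC.
(* The product of the signs [j] and [i] is revealed at the larger of 2 l_j and 2 i + 1, which is
   even exactly when i < l_j; the multipliers [th] keep the even times. *)
pose key (i : 'I_(n + L)) : nat := match fintype.split i with
  | inl j => (l j).*2 | inr i => i.*2.+1 end.
have keyl j : key (lshift L j) = (l j).*2.
  by rewrite /key; case: split_ordP => i; [move/lshift_inj ->|move/eqP; rewrite eq_lrshift].
have keyr i : key (rshift n i) = i.*2.+1.
  by rewrite /key; case: split_ordP => k; [move/eqP; rewrite eq_rlshift|move/rshift_inj ->].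
pose th (k : nat) : R[i] := if odd k then 0 else 1.
have th1 k : `|th k| <= 1 by rewrite /th; case: ifP; rewrite ?normr0 ?normr1.
have cePsi k x : ce (pre key k) Psi x = \sum_(j < n) \sum_(i < L)
    (((maxn (l j).*2 i.*2.+1 < k)%N%:R : R[i]) * (dl x j * dr x i)) *: D i (F j).
  rewrite ce_sum; apply: eq_bigr => j _; rewrite ce_sum; apply: eq_bigr => i _.
  have ne : lshift L j != rshift n i by rewrite eq_lrshift.
  have e : (fun y => (dl y j * dr y i) *: D i (F j)) =1
      (fun y => walsh [set lshift L j; rshift n i] y *: D i (F j)).
    by move=> y; rewrite walsh_set2.
  rewrite (eq_ce _ e).
  rewrite ce_walsh walsh_set2//; congr ((nat_of_bool _)%:R * _ *: _).
  by rewrite finset.subUset !finset.sub1set !inE keyl keyr gtn_max.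
have trPsi x : tr key (L.*2.+2) th Psi x = Phi x.
  rewrite /tr; under eq_bigr do rewrite !cePsi -sumrB scaler_sumr.
  rewrite exchange_big; apply: eq_bigr => j _.
  under eq_bigr do rewrite -sumrB scaler_sumr.
  rewrite exchange_big [RHS]big_mkcond /=; apply: eq_bigr => i _.
  under eq_bigr do rewrite -scalerBl -mulrBl scalerA mulrA.
  rewrite -scaler_suml -mulr_suml sum_jump; last first.
    by have := lL j; have := ltn_ord i; lia.
  rewrite /th maxnE; case: (ltnP i (l j)) => il.
    have -> : (i.*2.+1 - (l j).*2 = 0)%N by lia.
    by rewrite addn0 odd_double mul1r.
  have -> : ((l j).*2 + (i.*2.+1 - (l j).*2) = i.*2.+1)%N by lia.
  by rewrite /= odd_double mul0r scale0r.
have stepB : mean (fun x => rnorm (Phi x) `^ 2) <= C2 * mean (fun x => rnorm (Psi x) `^ 2).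
  have := hE key L.*2.+2 Psi th1.
  apply: le_trans; rewrite le_eqVlt; apply/orP; left; apply/eqP.
  by apply: eq_mean => x; rewrite trPsi.
have marg (G : 'I_n -> E) : radnorm G `^ 2 =
    mean (fun x : cube (n + L) => rnorm (\sum_(j < n) dl x j *: G j) `^ 2).
  rewrite rad_powR -(mean_marginal L); apply: eq_mean => x.
  apply: (congr1 (fun v : E => rnorm v `^ 2)); apply: eq_bigr => j _.
  by rewrite /dl /sgn ffunE.
suff key' (G : 'I_n -> E) :
    (forall x, rnorm (\sum_(j < n) dl x j *: G j) <= B * rnorm (Phi x)) ->
    radnorm G <= B * Num.sqrt C2 * B * radnorm F.
  by apply: key' => x; exact: stepA.
move=> {}stepA.
have -> : B * Num.sqrt C2 * B = Num.sqrt (B ^+ 2 * C2 * B ^+ 2).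
  by rewrite sqrtrM ?mulr_ge0 ?sqr_ge0// sqrtrM ?sqr_ge0// sqrtr_sqr ger0_norm.
apply: le_sqrt_powR2; [exact: rad_ge0|exact: rad_ge0|by rewrite !mulr_ge0 ?sqr_ge0|].
have BM (v w : E) : rnorm v <= B * rnorm w -> rnorm v `^ 2 <= B ^+ 2 * rnorm w `^ 2.
  move=> h; rewrite -powR_mulrn// -powRM ?rnorm_ge0//.
  by apply: ler_powRl => //; exact: rnorm_ge0.
have arith (b c d : R) : b <= C2 * c -> c <= B ^+ 2 * d ->
    B ^+ 2 * b <= B ^+ 2 * C2 * B ^+ 2 * d.
  move=> hb hc; rewrite -(mulrA _ C2) -mulrA; apply: ler_wpM2l; first exact: sqr_ge0.
  by apply: le_trans hb _; rewrite -mulrA; apply: ler_wpM2l.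
have hA : radnorm G `^ 2 <= B ^+ 2 * mean (fun x => rnorm (Phi x) `^ 2).
  by rewrite (marg G) -[leRHS]meanZ; apply: ler_mean => x; apply: BM; exact: stepA.
have hC : mean (fun x => rnorm (Psi x) `^ 2) <= B ^+ 2 * radnorm F `^ 2.
  by rewrite (marg F) -[leRHS]meanZ; apply: ler_mean => x; apply: BM; exact: stepC.
by apply: le_trans hA _; apply: arith stepB hC.
Qed.

End Stein.

(** * Real-valued moduli of complex numbers *)

Definition cabs (R : realType) (z : R[i]) : R := complex.Re `|z|.

Section Cabs.
Context {R : realType}.
Implicit Types (z w : R[i]).

Lemma cabsE z : `|z| = (cabs z)%:C.
Proof. by rewrite /cabs RRe_real ?normr_real. Qed.

Lemma cabs_ge0 z : 0 <= cabs z.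
Proof. by rewrite -lecR -cabsE normr_ge0. Qed.

Lemma cabsM z w : cabs (z * w) = cabs z * cabs w.
Proof. by apply: complexI; rewrite rmorphM/= -!cabsE normrM. Qed.

Lemma cabsX z n : cabs (z ^+ n) = cabs z ^+ n.
Proof. by apply: complexI; rewrite rmorphXn/= -!cabsE normrX. Qed.

Lemma cabsV z : cabs z^-1 = (cabs z)^-1.
Proof. by apply: complexI; rewrite fmorphV/= -!cabsE normfV. Qed.

Lemma cabsN z : cabs (- z) = cabs z.
Proof. by rewrite /cabs normrN. Qed.

Lemma cabs1 : cabs (1 : R[i]) = 1.
Proof. by rewrite /cabs normr1. Qed.

Lemma cabs0 : cabs (0 : R[i]) = 0.
Proof. by rewrite /cabs normr0. Qed.

Lemma cabs_real (x : R) : cabs x%:C = `|x|.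
Proof. exact: Re_normC. Qed.

Lemma cabsD z w : cabs (z + w) <= cabs z + cabs w.
Proof. by rewrite -lecR rmorphD/= -!cabsE ler_normD. Qed.

Lemma cabsB z w : cabs (z - w) = cabs (w - z).
Proof. by rewrite -cabsN opprB. Qed.

Lemma cabs_sub z w : cabs z - cabs w <= cabs (z - w).
Proof. by rewrite lerBlDr -{1}(subrK w z) cabsD. Qed.

Lemma cabs_le z (B : R) : (`|z| <= B%:C) = (cabs z <= B).
Proof. by rewrite cabsE lecR. Qed.

Lemma cabs_eq0 z : (cabs z == 0) = (z == 0).
Proof. by rewrite -[in RHS]normr_eq0 cabsE -[X in _ = (X == _)]/(real_complex R (cabs z)) fmorph_eq0. Qed.

Lemma cabs_sum (I : Type) (r : seq I) (P : pred I) (F : I -> R[i]) :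
  cabs (\sum_(i <- r | P i) F i) <= \sum_(i <- r | P i) cabs (F i).
Proof.
apply: (big_ind2 (fun a b => cabs a <= b)) => //; first by rewrite cabs0.
by move=> a b c d ab cd; apply: le_trans (cabsD _ _) (lerD ab cd).
Qed.

End Cabs.

(** * R-bounds of families of Walsh multipliers *)

Section RB.
Context {R : realType} {X : normedModType R[i]} {p : R} (p1 : 1 < p) {N : nat}.
Local Notation E := (Lp_cube X p1 N).

(** An R-bound for random signs of a tuple of multipliers. With tuples instead of sets, sums,
    products and limits of symbols are taken index by index. *)
Definition rb n (m : 'I_n -> nat -> R[i]) (K : R) :=
  forall F : 'I_n -> E, radnorm (fun j => mulop (m j) (F j)) <= K * radnorm F.

Context {n : nat}.
Implicit Types (m : 'I_n -> nat -> R[i]) (K : R).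

Lemma rb_ext m m' K : (forall j k, (k <= N)%N -> m j k = m' j k) -> rb m K -> rb m' K.
Proof.
move=> e h F; apply: le_trans (h F); rewrite le_eqVlt; apply/orP; left; apply/eqP.
by apply: eq_rad => j; apply: eq_mult => k kN; rewrite e.
Qed.

Lemma rb_le m K K' : K <= K' -> rb m K -> rb m K'.
Proof. by move=> KK h F; apply: le_trans (h F) _; rewrite ler_wpM2r ?rad_ge0. Qed.

Lemma rb_id : rb (fun (_ : 'I_n) (_ : nat) => 1) 1.
Proof.
move=> F; rewrite mul1r le_eqVlt; apply/orP; left; apply/eqP/eq_rad => j.
exact: mult1.
Qed.

Lemma rb_add m m' K K' : rb m K -> rb m' K' -> rb (fun j k => m j k + m' j k) (K + K').
Proof.
move=> h h' F; rewrite (@eq_rad _ _ _ _ (fun j => mulop (m j) (F j) + mulop (m' j) (F j))).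
  by apply: le_trans (radD _ _) _; rewrite mulrDl lerD.
by move=> j; exact: multDl.
Qed.

Lemma rb_scale (c : R[i]) m K : rb m K -> rb (fun j k => c * m j k) (cabs c * K).
Proof.
move=> h F; rewrite (@eq_rad _ _ _ _ (fun j => c *: mulop (m j) (F j))).
  rewrite (radZ c (fun j => mulop (m j) (F j))) -mulrA.
  by apply: ler_wpM2l; [exact: cabs_ge0|exact: h].
by move=> j; exact: multZl.
Qed.

Lemma rb_sum (J : Type) (r : seq J) (P : pred J) (m : J -> 'I_n -> nat -> R[i]) (K : J -> R) :
  (forall i, P i -> rb (m i) (K i)) ->
  rb (fun j k => \sum_(i <- r | P i) m i j k) (\sum_(i <- r | P i) K i).
Proof.
move=> h F; rewrite (@eq_rad _ _ _ _ (fun j => \sum_(i <- r | P i) mulop (m i j) (F j))).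
  apply: le_trans (rad_sum _ _ _) _; rewrite mulr_suml.
  by apply: ler_sum => i Pi; exact: h.
by move=> j; exact: (mult_suml r P (fun i => m i j)).
Qed.

Lemma rb_comp m m' K K' : 0 <= K -> rb m K -> rb m' K' ->
  rb (fun j k => m j k * m' j k) (K * K').
Proof.
move=> K0 h h' F.
rewrite (@eq_rad _ _ _ _ (fun j => mulop (m j) (mulop (m' j) (F j)))).
  apply: le_trans (h (fun j => mulop (m' j) (F j))) _.
  by rewrite -mulrA; apply: ler_wpM2l => //; exact: h'.
by move=> j; rewrite /mulop multM.
Qed.

Lemma rb_exp m K a : 0 <= K -> rb m K -> rb (fun j k => m j k ^+ a) (K ^+ a).
Proof.
move=> K0 h; elim: a => [|a IH].
  by apply: rb_ext rb_id.
rewrite exprS; apply: (@rb_ext (fun j k => m j k * m j k ^+ a)); last exact: rb_comp.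
by move=> j k _; rewrite exprS.
Qed.

(** Scalars that vary with [j] cannot be taken out of the random sum; the contraction principle
    costs the factor 2. *)
Lemma rb_coef (a : 'I_n -> R[i]) (B : R) m K : 0 <= B ->
  (forall j, cabs (a j) <= B) -> rb m K -> rb (fun j k => a j * m j k) (2 * B * K).
Proof.
move=> B0 aB h F; rewrite (@eq_rad _ _ _ _ (fun j => a j *: mulop (m j) (F j))).
  apply: le_trans (rad_contraction _ B0 _) _; first by move=> j; rewrite cabs_le.
  by rewrite -[leRHS]mulrA; apply: ler_wpM2l; [rewrite mulr_ge0|exact: h].
by move=> j; exact: multZl.
Qed.

(** For given [F] the error is linear in the finitely many numbers m j k - m' j k with k <= N. The
    accuracy required may depend on [N] and [F], the constant [K] does not. *)
Lemma rb_limit m K :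
  (forall e, 0 < e -> exists2 m' : 'I_n -> nat -> R[i], rb m' K &
    forall j k, (k <= N)%N -> cabs (m j k - m' j k) <= e) -> rb m K.
Proof.
move=> h F.
pose Q := \sum_(k < N.+1) 2 * radnorm (fun j => mulop (fun k' => (k' == k)%:R) (F j)).
have Q0 : 0 <= Q by apply: sumr_ge0 => k _; rewrite mulr_ge0 ?rad_ge0.
apply/ler_addgt0Pr => e e0.
have [m' hm' close] := h (e / (Q + 1)) (divr_gt0 e0 (ltr_wpDl Q0 ltr01)).
pose d j k := if (k <= N)%N then m j k - m' j k else 0.
rewrite (@eq_rad _ _ _ _ (fun j => mulop (m' j) (F j) + mulop (d j) (F j))); last first.
  move=> j; rewrite /mulop -multDl; apply: eq_mult => k kN.
  by rewrite /d kN addrC subrK.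
apply: le_trans (radD _ _) _; apply: lerD; first exact: hm'.
rewrite (@eq_rad _ _ _ _ (fun j => \sum_(k < N.+1) d j k *: mulop (fun k' => (k' == k)%:R) (F j))); last first.
  move=> j; under eq_bigr do rewrite /mulop -multZl.
  rewrite /mulop -mult_suml; apply: eq_mult => k kN.
  rewrite (bigD1 (inord k))//= inordK// eqxx mulr1 big1 ?addr0// => i.
  rewrite -val_eqE /= inordK// => /negbTE; rewrite eq_sym => ->.
  by rewrite mulr0.
apply: le_trans (rad_sum _ _ _) _.
apply: (@le_trans _ _ (e / (Q + 1) * Q)).
  rewrite /Q mulr_sumr; apply: ler_sum => k _; rewrite mulrA [e / _ * 2]mulrC.
  apply: rad_contraction; first by rewrite divr_ge0 ?(ltW e0)// addr_ge0.
  by move=> j; rewrite cabs_le /d -ltnS ltn_ord; apply: close; rewrite -ltnS.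
by rewrite mulrAC ler_pdivrMr ?ler_wpM2l ?(ltW e0)// ?lerDl// ltr_wpDl.
Qed.

End RB.
Arguments rb {R} X [p] p1 N [n] m K.

Section RBsemi.
Context {R : realType} {X : normedModType R[i]} {p : R} (p1 : 1 < p) {N : nat}.
Local Notation E := (Lp_cube X p1 N).
Variables (C C2 : R).
Hypothesis C0 : 0 <= C.
Hypothesis C20 : 0 <= C2.
Hypothesis hX : mart X p C.
Hypothesis hE : mart E 2 C2.

(** The first term bounds what is gained after time 0, by Stein's inequality; the second bounds the
    conditional expectation at time 0. *)
Definition stein_cst : R := C `^ p^-1 * Num.sqrt C2 * C `^ p^-1 + doob_cst p `^ p^-1.

Lemma rnorm_ceE S (f : E) : rnorm (ceE S f) <= doob_cst p `^ p^-1 * rnorm f.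
Proof.
have p0 : 0 < p by exact: lt_trans p1.
have D0 : 0 <= doob_cst p by exact: doob_cst_ge0.
apply: Lp_rnorm_le => //.
apply: le_trans (@doob R X p N (fun=> S) f 1 p1 (fun _ _ _ => fintype.subxx _)).
apply: ler_mean => x; rewrite ler_powRl ?rnorm_ge0 ?(ltW p0)//.
by rewrite /ceE ffunE /= le_max lexx orbT.
Qed.

Lemma rb_semi n (t : 'I_n -> R) : (forall j, 0 <= t j) ->
  rb X p1 N (fun j => semi (t j)) stein_cst.
Proof.
move=> t0 F.
pose ts := sort <=%R (codom t).
pose L := size ts.
have L0 j : (index (t j) ts < L)%N by rewrite index_mem mem_sort codom_f.
(* After the sorted list the sequence continues with the sum of all times, which is at least each of
   them, so it stays nondecreasing. *)
pose tn k : R := if (k < L)%N then nth 0 ts k else \sum_j t j.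
have tn0 k : 0 <= tn k.
  rewrite /tn; case: ifP => [kL|_]; last exact: sumr_ge0.
  have : nth 0 ts k \in codom t by rewrite -(mem_sort <=%R) mem_nth.
  by move=> /codomP[j ->].
have tnS k : tn k <= tn k.+1.
  rewrite /tn; case: (ltnP k.+1 L) => kL.
    have st : sorted <=%R ts by exact/sort_sorted/le_total.
    rewrite (ltnW kL); apply: (sorted_leq_nth le_trans lexx 0 st).
    - by rewrite inE ltnW.
    - by rewrite inE.
    - exact: leqnSn.
  case: ifP => // kL'.
  have : nth 0 ts k \in codom t by rewrite -(mem_sort <=%R) mem_nth.
  by move=> /codomP[j ->]; rewrite (bigD1 j)//= lerDl sumr_ge0.
have tE j : t j = tn (index (t j) ts) by rewrite /tn L0 nth_index// mem_sort codom_f.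
have [w [kap [w0 w1 hw]]] := semi_average N L tn0 tnS.
pose l j := (L.+1 - index (t j) ts)%N.
have e j : mulop (semi (t j)) (F j) = \sum_tau (w tau)%:C *: ceE (pre (kap tau) (l j)) (F j).
  apply/ffunP => x; rewrite [RHS]lp_evE lp_ev_sum {1}tE [LHS]hw; last exact: ltnW.
  by apply: eq_bigr => tau _; rewrite lp_evZ /lp_ev ffunE.
rewrite (eq_rad e); apply: le_trans (rad_sum _ _ _) _.
have bound tau : radnorm (fun j => ceE (pre (kap tau) (l j)) (F j)) <= stein_cst * radnorm F.
  rewrite (@eq_rad _ _ _ _ (fun j => (ceE (pre (kap tau) (l j)) (F j) -
    ceE (pre (kap tau) 0) (F j)) + ceE (pre (kap tau) 0) (F j))); last by move=> j; rewrite subrK.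
  apply: le_trans (radD _ _) _; rewrite mulrDl; apply: lerD.
    by apply: (@stein_chain R X p p1 N C C2 C0 C20 hX hE n L.+1) => j; exact: leq_subr.
  apply: (@rad_op _ _ _ _ (ceE (pre (kap tau) 0)) _ F (ceE_linear _) (powR_ge0 _ _)) => v.
  exact: rnorm_ceE.
apply: (@le_trans _ _ (\sum_tau w tau * (stein_cst * radnorm F))).
  apply: ler_sum => tau _.
  rewrite (radZ (w tau)%:C (fun j => ceE (pre (kap tau) (l j)) (F j))) Re_normC ger0_norm//.
  exact: ler_wpM2l.
by rewrite -mulr_suml w1 mul1r.
Qed.

End RBsemi.

(** * Difference quotients of the semigroup *)

Lemma cabs_le1 (R : realType) (z : R[i]) : (`|z| <= 1) = (cabs z <= 1).
Proof. by rewrite cabsE -(rmorph1 (real_complex R)) lecR. Qed.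

Lemma semiM (R : realType) (h : R) (l k : nat) : semi (l%:R * h) k = semi h k ^+ l.
Proof. by rewrite /semi -rmorphXn/= -expRM_natl; congr ((expR _)%:C); ring. Qed.

Lemma semi_le1 (R : realType) (h : R) k : 0 <= h -> cabs (semi h k) <= 1.
Proof.
move=> h0; rewrite /semi cabs_real ger0_norm ?expR_ge0// -expR0 ler_expR.
by rewrite mulNr oppr_le0 mulr_ge0.
Qed.

(** Bernoulli's inequality gives r^m <= 1/(m (1 - r)) <= x 2^-d. Interpolating with r^m <= 1
    replaces x by its square root, the gain on which everything rests, and still leaves decay in
    [d], because 1/2 <= (3/4)^2. *)
Lemma invX_bound (R : realType) (r x : R) d m : 0 < r -> r < 1 -> 1 <= x ->
  2 ^+ d <= x * (m%:R * (1 - r)) -> r ^+ m <= Num.sqrt x * (3 / 4) ^+ d.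
Proof.
move=> r0 r1 x1 h.
have x0 : 0 < x by lra.
pose u := m%:R * (1 - r).
have u0 : 0 < u.
  by rewrite -(pmulr_rgt0 _ x0); apply: lt_le_trans h; rewrite exprn_gt0.
have rm : r ^+ m * (1 + u) <= 1.
  rewrite /u; elim: m {h u u0} => [|m IH]; first by rewrite expr0 mul0r addr0 mulr1.
  apply: le_trans IH; rewrite exprS -natr1.
  have rr : r * (1 + (m%:R + 1) * (1 - r)) <= 1 + m%:R * (1 - r).
    have : 0 <= (1 - r) * ((1 - r) * (m%:R + 1)).
      by rewrite !mulr_ge0 ?subr_ge0 ?(ltW r1)// addr_ge0.
    by set a := m%:R; lra.
  by rewrite mulrC mulrA mulrC ler_wpM2l ?exprn_ge0 ?(ltW r0)// mulrC.
have sq : (r ^+ m) ^+ 2 <= (Num.sqrt x * (3 / 4) ^+ d) ^+ 2.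
  rewrite [leRHS]exprMn sqr_sqrtr ?(ltW x0)// -[(_ ^+ d) ^+ 2]exprM mulnC [_ ^+ (2 * d)]exprM.
  have h2 : (r ^+ m) ^+ 2 * u <= 1.
    have a0 : 0 <= r ^+ m by rewrite exprn_ge0// ltW.
    have a1 : r ^+ m <= 1 by rewrite exprn_ile1// ltW.
    move: rm; set a := r ^+ m in a0 a1 *; rewrite mulrDr mulr1 => rm.
    apply: (@le_trans _ _ (a * u)); last by lra.
    rewrite expr2 -mulrA ler_piMl// mulr_ge0// ltW//.
  have h3 : u^-1 <= x * 2^-1 ^+ d.
    rewrite -[u^-1]mul1r ler_pdivrMr// exprVn mulrAC ler_pdivlMr ?exprn_gt0// mul1r//.
  apply: (@le_trans _ _ u^-1); first by rewrite -[u^-1]mul1r ler_pdivlMr.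
  apply: le_trans h3 _; rewrite ler_pM2l//; apply: lerXn2r; rewrite ?nnegrE; lra.
by rewrite ler_sqr ?nnegrE ?mulr_ge0 ?sqrtr_ge0 ?exprn_ge0 ?(ltW r0)// in sq; lra.
Qed.

Lemma expr_small (R : realType) (q e : R) : 0 <= q -> q < 1 -> 0 < e ->
  exists D, q ^+ D <= e.
Proof.
move=> q0 q1 e0.
have : (fun k => q ^+ k) @ \oo --> (0 : R) by apply: cvg_expr; rewrite ger0_norm.
move=> /cvgrPdist_le /(_ e e0) [D _ /(_ D (leqnn _))] /=.
by rewrite sub0r normrN ger0_norm ?exprn_ge0// => ?; exists D.
Qed.

Section DifferenceQuotient.
Context {R : realType} {X : normedModType R[i]} {p : R} (p1 : 1 < p) {N : nat}.
Local Notation E := (Lp_cube X p1 N).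
Variables (M B : R).
Hypothesis M0 : 0 <= M.
Hypothesis B0 : 0 <= B.
Hypothesis hS : forall n (t : 'I_n -> R), (forall j, 0 <= t j) ->
  rb X p1 N (fun j => semi (t j)) M.
Hypothesis hT : forall (t : nat -> R) L (theta : nat -> R[i]) (f : E),
  (forall l, 0 <= t l) -> (forall l, t l <= t l.+1) -> (forall l, `|theta l| <= 1) ->
  rnorm (mulop (fun k => \sum_(l < L) theta l * (semi (t l) k - semi (t l.+1) k)) f) <=
  B * rnorm f.

Section Dyadic.
Variables (n : nat) (idx : 'I_n -> nat) (tau : R).
Hypothesis tau0 : 0 < tau.
Let h j : R := 2 ^+ idx j * tau.

Let h0 j : 0 <= h j. Proof. by rewrite mulr_ge0 ?exprn_ge0// ltW. Qed.

(* The time intervals [b h_j, 2 b h_j) are disjoint for distinct dyadic steps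
   h_j, so that the corresponding increments are unconditional. *)
Lemma rb_block b (w : R[i]) : (0 < b)%N -> cabs w <= 1 ->
  rb X p1 N (fun j k => \sum_(r < b) w ^+ (b + r) *
    (semi ((b + r)%:R * h j) k - semi ((b + r).+1%:R * h j) k)) (cabs w ^+ b * B).
Proof.
move=> b0 w1.
pose I := (\max_j idx j).+1.
have idxI j : (idx j < I)%N by rewrite ltnS; exact: leq_bigmax.
pose ix j : 'I_I := Ordinal (idxI j).
pose psi (i : 'I_I) k : R[i] := \sum_(r < b) w ^+ r *
  (semi ((b + r)%:R * (2 ^+ i * tau)) k - semi ((b + r).+1%:R * (2 ^+ i * tau)) k).
(* The times (b + r) 2^i [tau] in increasing order: block [i] is followed at once by block i + 1,
   since 2 b 2^i = b 2^(i+1). *)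
pose T a : R := ((b + a %% b) * 2 ^ (a %/ b))%N%:R * tau.
have T1 i r : (r < b)%N -> T (i * b + r)%N = (b + r)%:R * (2 ^+ i * tau).
  move=> rb; rewrite /T divnMDl// divn_small// addn0 modnMDl modn_small//.
  by rewrite natrM natrX mulrA.
have T2 i r : (r < b)%N -> T (i * b + r).+1 = (b + r).+1%:R * (2 ^+ i * tau).
  move=> rb; rewrite -addnS; have [rb'|br] := ltnP r.+1 b.
    by rewrite T1// addnS.
  have -> : r.+1 = b by apply/eqP; rewrite eqn_leq rb br.
  have -> : (i * b + b = i.+1 * b + 0)%N by rewrite mulSnr addn0.
  rewrite T1// addn0 -addnS (_ : r.+1 = b); last by apply/eqP; rewrite eqn_leq rb br.
  by rewrite exprS natrD; ring.
have T0 a : 0 <= T a by rewrite mulr_ge0// ltW.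
have TS a : T a <= T a.+1.
  rewrite (divn_eq a b) T1 ?ltn_pmod// T2 ?ltn_pmod//.
  by rewrite ler_wpM2r ?mulr_ge0 ?exprn_ge0 ?(ltW tau0)// ler_nat.
pose eps (x : cube I) i : R[i] := if insub i is Some i' then sgn R x i' else 1.
have epsE x (i : 'I_I) : eps x i = sgn R x i by rewrite /eps valK.
have eps1 x i : `|eps x i| = 1.
  by rewrite /eps; case: insubP => [i' _ _|_]; rewrite ?norm_sgn ?normr1.
have key (x : cube I) (f : E) : rnorm (mulop (fun k => \sum_i sgn R x i * psi i k) f) <= B * rnorm f.
  pose th a : R[i] := eps x (a %/ b)%N * w ^+ (a %% b).
  have th1 a : `|th a| <= 1.
    rewrite normrM eps1 mul1r normrX; apply: exprn_ile1 => //.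
    by rewrite cabs_le1.
  have e : mulop (fun k => \sum_i sgn R x i * psi i k) f = mulop (fun k =>
      \sum_(a < I * b) th a * (semi (T a) k - semi (T a.+1) k)) f.
    apply: eq_mult => k _.
    rewrite (sum_ord_mul I b (fun a => th a * (semi (T a) k - semi (T a.+1) k))).
    apply: eq_bigr => i _; rewrite /psi mulr_sumr; apply: eq_bigr => r _.
    rewrite T1// T2// /th divnMDl// divn_small// addn0 epsE modnMDl modn_small//.
    by rewrite mulrA.
  by rewrite e; exact: hT.
have hd F := @rad_diagonal R X p p1 N I n psi B ix F B0 key.
have := @rb_scale R X p p1 N n (w ^+ b) (fun j => psi (ix j)) B hd.
rewrite cabsX; apply: rb_ext => j k _.
rewrite /psi mulr_sumr; apply: eq_bigr => r _.
by rewrite mulrA -exprD.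
Qed.

(** Summation by parts puts the differences on the powers of [w], with total variation at most L |1
    - w|. For L of order 1/|1 - w| this is bounded. *)
Lemma rb_head L (w : R[i]) : cabs w <= 1 ->
  rb X p1 N (fun j k => \sum_(l < L) w ^+ l *
    (semi (l%:R * h j) k - semi (l.+1%:R * h j) k)) (M * (2 + L%:R * cabs (1 - w))).
Proof.
move=> w1.
have t0 l j : 0 <= l%:R * h j by rewrite mulr_ge0.
have r1 := hS (t0 0%N).
have r2 : rb X p1 N (fun j k => \sum_(l < L) (w ^+ l.+1 - w ^+ l) * semi (l.+1%:R * h j) k)
    (\sum_(l < L) cabs (1 - w) * M).
  apply: (@rb_sum R X p p1 N n _ _ _ (fun (l : 'I_L) j k => (w ^+ l.+1 - w ^+ l) * semi (l.+1%:R * h j) k)) => l _.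
  apply: rb_le (rb_scale _ (hS (t0 l.+1))).
  apply: ler_wpM2r => //; rewrite exprS -{2}[w ^+ l]mul1r -mulrBl cabsM cabsB cabsX.
  by rewrite ler_piMr ?cabs_ge0// exprn_ile1// cabs_ge0.
have r3 := rb_scale (- w ^+ L) (hS (t0 L)).
have := rb_add (rb_add r1 r2) r3; rewrite sumr_const card_ord => hh.
apply: (rb_ext (m := fun j k => _)) (rb_le _ hh); last first.
  have c1 : cabs (- w ^+ L) * M <= M.
    by rewrite cabsN cabsX ler_piMl// exprn_ile1// cabs_ge0.
  rewrite -[(cabs _ * M) *+ L]mulr_natl; move: c1; set c := cabs _ * M; lra.
move=> j k _ /=; elim: L {r2 r3 hh} => [|L IH].
  by rewrite !big_ord0 expr0 addr0 mulN1r subrr.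
by rewrite !big_ord_recr /= -IH; ring.
Qed.

Let e j k : R[i] := semi (h j) k.

Lemma rb_partial D L (w : R[i]) : (0 < L)%N -> cabs w <= 1 ->
  rb X p1 N (fun j k => \sum_(l < 2 ^ D * L) w ^+ l * (e j k ^+ l - e j k ^+ l.+1))
    (M * (2 + L%:R * cabs (1 - w)) + \sum_(d < D) cabs w ^+ (2 ^ d * L) * B).
Proof.
move=> L0 w1; elim: D => [|D IH].
  rewrite big_ord0 addr0 expn0 mul1n; apply: rb_ext (rb_head L w1) => j k _.
  by apply: eq_bigr => l _; rewrite !semiM.
rewrite big_ord_recr /= addrA.
have b0 : (0 < 2 ^ D * L)%N by rewrite muln_gt0 expn_gt0.
apply: rb_ext (rb_add IH (rb_block b0 w1)) => j k _ /=.
rewrite expnS -mulnA mul2n -addnn big_split_ord /=; congr (_ + _).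
by apply: eq_bigr => l _; rewrite !semiM.
Qed.

Lemma sub1_neq0 (w : R[i]) j k : cabs w < 1 -> 1 - w * e j k != 0.
Proof.
move=> w1; rewrite subr_eq0 eq_sym; apply/eqP => /(congr1 (@cabs R)); rewrite cabsM cabs1.
have := semi_le1 k (h0 j); rewrite -/(e j k) => e1.
move=> we; have : cabs w * cabs (e j k) <= cabs w by rewrite ler_piMr ?cabs_ge0.
by rewrite we leNgt w1.
Qed.

(** 5 = 2 + 3 belongs to the head, where L |1 - w| <= 3; 4 is the sum of the powers of 3/4 over the
    blocks. *)
Definition sect_cst : R := 5 * M + 4 * B.

Lemma rb_difference_quotient (w : R[i]) : 0 < cabs w -> cabs w < 1 ->
  rb X p1 N (fun j k => (1 - e j k) / (1 - w * e j k))
    (sect_cst * Num.sqrt (cabs (1 - w) / (1 - cabs w))).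
Proof.
move=> w0 w1; set r := cabs w in w0 w1 *; set a := cabs (1 - w).
have ar : 1 - r <= a by have := cabs_sub 1 w; rewrite cabs1.
have a0 : 0 < a by apply: lt_le_trans ar; rewrite subr_gt0.
have a2 : a <= 2.
  by apply: le_trans (cabsD _ _) _; rewrite cabsN cabs1 -/r; lra.
set x := a / (1 - r).
have x1 : 1 <= x by rewrite ler_pdivlMr ?subr_gt0// mul1r.
(* This length makes 1 <= L a <= 3: the head stays bounded, and the block with m = 2^d L satisfies x
   m (1 - r) >= 2^d. *)
pose L := (Num.truncn a^-1).+1.
have La : 1 <= L%:R * a.
  by rewrite -ler_pdivrMr// mul1r ltW// truncnS_gt.
have La3 : L%:R * a <= 3.
  rewrite /L -natr1 mulrDl mul1r.
  have : (Num.truncn a^-1)%:R * a <= 1.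
    by rewrite -ler_pdivlMr// mul1r truncn_le invr_ge0 ltW.
  lra.
have s1 : 1 <= Num.sqrt x by rewrite -sqrtr1 ler_wsqrtr.
have blk d : r ^+ (2 ^ d * L) <= Num.sqrt x * (3 / 4) ^+ d.
  apply: invX_bound => //; rewrite /x natrM natrX.
  have -> : a / (1 - r) * (2 ^+ d * L%:R * (1 - r)) = 2 ^+ d * (L%:R * a).
    by field; rewrite subr_eq0 gt_eqF.
  by rewrite ler_peMr ?exprn_ge0.
have geo D : \sum_(d < D) (3 / 4 : R) ^+ d <= 4.
  suff : \sum_(d < D) (3 / 4 : R) ^+ d = 4 - 4 * (3 / 4) ^+ D.
    by move=> ->; rewrite gerBl mulr_ge0// exprn_ge0.
  by elim: D => [|D IH]; rewrite ?big_ord0 ?big_ord_recr/= ?IH ?expr0 ?exprS; field.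
have part D : rb X p1 N (fun j k => \sum_(l < 2 ^ D * L) w ^+ l * (e j k ^+ l - e j k ^+ l.+1))
    (sect_cst * Num.sqrt x).
  apply: rb_le (rb_partial D (ltn0Sn _) (ltW w1)).
  have h1 : M * (2 + L%:R * a) <= 5 * M * Num.sqrt x.
    apply: (@le_trans _ _ (5 * M)); last by rewrite ler_peMr// mulr_ge0.
    by rewrite mulrC ler_wpM2r//; lra.
  have h2 : \sum_(d < D) r ^+ (2 ^ d * L) * B <= 4 * B * Num.sqrt x.
    apply: (@le_trans _ _ (\sum_(d < D) (Num.sqrt x * B) * (3 / 4) ^+ d)).
      by apply: ler_sum => d _; rewrite mulrAC ler_wpM2r.
    rewrite -mulr_sumr; apply: le_trans (ler_wpM2l _ (geo D)) _.
      by rewrite mulr_ge0// sqrtr_ge0.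
    by rewrite le_eqVlt; apply/orP; left; apply/eqP; ring.
  by rewrite /sect_cst mulrDl; apply: lerD.
apply: rb_limit => eps eps0.
pose c := 2 / (1 - r) * Num.sqrt x.
have c0 : 0 < c.
  by rewrite mulr_gt0 ?divr_gt0 ?subr_gt0// (lt_le_trans _ s1).
have [D hD] := @expr_small R (3 / 4) _ ltac:(lra) ltac:(lra) (divr_gt0 eps0 c0).
exists (fun j k => \sum_(l < 2 ^ D * L) w ^+ l * (e j k ^+ l - e j k ^+ l.+1)) => // j k _.
have n0 := sub1_neq0 j k w1; have e1 := semi_le1 k (h0 j); rewrite -/(e j k) in e1.
set m := (2 ^ D * L)%N.
have -> : (1 - e j k) / (1 - w * e j k) -
    \sum_(l < m) w ^+ l * (e j k ^+ l - e j k ^+ l.+1) =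
    (1 - e j k) / (1 - w * e j k) * (w * e j k) ^+ m.
  have -> : \sum_(l < m) w ^+ l * (e j k ^+ l - e j k ^+ l.+1) =
      (1 - e j k) * \sum_(l < m) (w * e j k) ^+ l.
    by rewrite mulr_sumr; apply: eq_bigr => l _; rewrite exprMn exprS; ring.
  have /eqP := subrX1 (w * e j k) m; rewrite -subr_eq0 => /eqP hs.
  set S := \sum_(l < m) _ in hs *.
  have -> : (w * e j k) ^+ m = 1 - (1 - w * e j k) * S.
    by apply/eqP; rewrite -subr_eq0 -hs; apply/eqP; ring.
  by field.
rewrite !cabsM cabsV cabsX cabsM.
have d1 : 1 - r <= cabs (1 - w * e j k).
  apply: le_trans (cabs_sub _ _); rewrite cabs1 lerD2l lerN2 cabsM.
  by rewrite ler_piMr ?cabs_ge0.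
have d2 : cabs (1 - e j k) <= 2.
  by apply: le_trans (cabsD _ _) _; rewrite cabsN cabs1; lra.
apply: (@le_trans _ _ (2 / (1 - r) * (Num.sqrt x * (3 / 4) ^+ D))); last first.
  rewrite mulrA -/c mulrC -ler_pdivlMr//.
apply: ler_pM.
- by rewrite mulr_ge0 ?invr_ge0 ?cabs_ge0.
- by rewrite exprn_ge0 ?mulr_ge0 ?cabs_ge0.
- apply: ler_pM => //; [exact: cabs_ge0|by rewrite invr_ge0 cabs_ge0|].
  by rewrite lef_pV2// posrE ?(lt_le_trans _ d1)// subr_gt0.
- apply: le_trans (blk D); apply: lerXn2r; rewrite ?nnegrE ?mulr_ge0 ?cabs_ge0 ?(ltW w0)//.
  by rewrite ler_piMr ?cabs_ge0.
Qed.

End Dyadic.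
End DifferenceQuotient.

(** * Roots of unity *)

(** Iterated square roots of -1 give z with z^(2^a) = -1, whose order divides 2^(a+1) but not
    2^a. *)
Lemma exists_primitive_root (R : realType) a :
  exists z : R[i], (2 ^ a.+1)%N.-primitive_root z.
Proof.
have [z hz] : exists z : R[i], z ^+ (2 ^ a) = -1.
  elim: a => [|a [z hz]]; first by exists (-1); rewrite expn0 expr1.
  by exists (sqrtC z); rewrite expnS exprM sqrtCK.
have z1 : z ^+ (2 ^ a.+1) = 1 by rewrite expnSr exprM hz sqrrN expr1n.
have [m pm dm] := prim_order_exists (expn_gt0 2 a.+1) z1.
have /(dvdn_pfactor _ _ (isT : prime 2))[b ba mE] := dm.
suff -> : a.+1 = b by exists z; rewrite -mE.
apply/eqP; rewrite eqn_leq ba andbT ltnNge; apply/negP => ba'.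
have : (m %| 2 ^ a)%N by rewrite mE dvdn_exp2l.
rewrite (prim_order_dvd pm) hz eq_sym -subr_eq0 opprK.
by rewrite -[1 + 1]/(2%:R) pnatr_eq0.
Qed.

Lemma sum_root_unity (R : realType) Q (z : R[i]) i j :
  Q.-primitive_root z -> (i < Q)%N -> (j < Q)%N ->
  \sum_(s < Q) (z ^+ i / z ^+ j) ^+ s = Q%:R * (i == j)%:R.
Proof.
move=> pz iQ jQ; have z0 : z != 0.
  apply/eqP => z0; have := prim_expr_order pz.
  rewrite z0 expr0n; case: Q pz iQ jQ => // Q _ _ _ /= /eqP.
  by rewrite eq_sym oner_eq0.
have [->|ij] := eqVneq i j.
  rewrite divff ?expf_neq0// mulr1.
  by under eq_bigr do rewrite expr1n; rewrite sumr_const card_ord.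
rewrite mulr0; set u := _ / _.
have u1 : u != 1.
  rewrite /u; apply/negP => /eqP /(congr1 (fun v => v * z ^+ j)).
  rewrite divfK ?expf_neq0// mul1r => /eqP; rewrite (eq_prim_root_expr pz).
  by rewrite !modn_small// (negbTE ij).
have uQ : u ^+ Q = 1.
  by rewrite expr_div_n -!exprM !(mulnC _ Q) !exprM (prim_expr_order pz) !expr1n divr1.
have := subrX1 u Q; rewrite uQ subrr => /esym/eqP.
by rewrite mulf_eq0 subr_eq0 (negbTE u1) => /eqP.
Qed.

Lemma cabs_root_unity (R : realType) Q (z : R[i]) : Q.-primitive_root z -> cabs z = 1.
Proof.
move=> pz; have := congr1 (@cabs R) (prim_expr_order pz).
rewrite cabsX cabs1 => /eqP; rewrite pexprn_eq1 ?cabs_ge0//.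
by case: Q pz => [/prim_order_gt0//|Q _] /= /eqP.
Qed.

(** Below the truncation degree these are the coefficients of (1 - u)^-(k+1), summed by the
    hockey-stick identity. *)
Lemma coef_geometric_exp (R : nzRingType) (q k n : nat) : (n < q)%N ->
  ((\poly_(l < q) (1 : R)) ^+ k.+1)`_n = 'C(n + k, k)%:R.
Proof.
elim: k n => [|k IH] n nq; first by rewrite expr1 coef_poly nq bin0.
rewrite exprSr coefM.
transitivity (\sum_(i < n.+1) 'C(i + k, k)%:R : R).
  apply: eq_bigr => i _; have iq : (i < q)%N by rewrite (leq_ltn_trans _ nq)// -ltnS.
  by rewrite IH// coef_poly (leq_ltn_trans (leq_subr _ _) nq) mulr1.
rewrite -natr_sum; congr (_%:R).
elim: n {nq} => [|n IHn]; first by rewrite big_ord1 !add0n !binn.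
by rewrite big_ord_recr /= IHn [in RHS]addSn binS addSnnS.
Qed.

Lemma leq_bin5 n : (n ^ 5 <= 120 * 'C(n + 5, 5))%N.
Proof.
rewrite mulnC -[120%N]/(5`!) bin_ffact !addnS addn0 !ffactnS ffactn0 !muln1 /=.
by rewrite !expnS expn0 muln1; do ![apply: leq_mul]; lia.
Qed.

Lemma exprB_ge (R : realType) (r : R) m : 0 <= r -> r <= 1 -> 1 - m%:R * (1 - r) <= r ^+ m.
Proof.
move=> r0 r1; elim: m => [|m IH]; first by rewrite mul0r subr0 expr0.
rewrite exprS -natr1; apply: le_trans (ler_wpM2l r0 IH).
have : 0 <= m%:R * ((1 - r) * (1 - r)) by rewrite !mulr_ge0 ?subr_ge0.
by set a := m%:R; lra.
Qed.

Lemma expr_le_bern (R : realType) (r : R) m : 0 <= r -> r <= 1 ->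
  r ^+ m * (1 + m%:R * (1 - r)) <= 1.
Proof.
move=> r0 r1; elim: m => [|m IH]; first by rewrite expr0 mul0r addr0 mulr1.
apply: le_trans IH; rewrite exprS -natr1.
have rr : r * (1 + (m%:R + 1) * (1 - r)) <= 1 + m%:R * (1 - r).
  have : 0 <= (1 - r) * ((1 - r) * (m%:R + 1)) by rewrite !mulr_ge0 ?subr_ge0// addr_ge0.
  by set a := m%:R; lra.
by rewrite mulrC mulrA mulrC ler_wpM2l ?exprn_ge0// mulrC.
Qed.

(* Parseval's identity for 1/(1 - r z) on the roots of unity. *)
Lemma sum_inv_sqr (R : realType) Q (z : R[i]) (r : R) : Q.-primitive_root z ->
  0 <= r -> r < 1 -> r ^+ Q <= 2^-1 ->
  \sum_(s < Q) (cabs (1 - r%:C * z ^+ s) ^- 2) <= 4 * Q%:R / (1 - r).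
Proof.
move=> pz r0 r1 rQ.
have z0 : z != 0 by rewrite -cabs_eq0 (cabs_root_unity pz) oner_eq0.
pose S (s : 'I_Q) : R[i] := \sum_(l < Q) r%:C ^+ l * (z ^+ l) ^+ s.
have rQ1 : 0 < 1 - r ^+ Q by lra.
have hS (s : 'I_Q) : (1 - r%:C * z ^+ s) * S s = (1 - r ^+ Q)%:C.
  have := subrX1 (r%:C * z ^+ s) Q.
  rewrite exprMn -exprM mulnC exprM (prim_expr_order pz) expr1n mulr1 => h.
  rewrite -[LHS]opprK -mulNr opprB rmorphB rmorph1 rmorphXn /=.
  rewrite /S; under eq_bigr do rewrite -exprM mulnC exprM -exprMn.
  by rewrite -h opprB.
(* [S s] inverts 1 - r z^s up to the factor 1 - r^Q, which is at least 1/2; squaring gives 4. *)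
have inv (s : 'I_Q) : cabs (1 - r%:C * z ^+ s) ^- 2 <= 4 * cabs (S s) ^+ 2.
  have := congr1 (@cabs R) (hS s); rewrite cabsM cabs_real gtr0_norm// => h.
  set a := cabs (1 - _) in h *; set b := cabs (S s) in h *.
  have a0 : 0 < a.
    rewrite lt_def cabs_ge0 andbT; apply/eqP => a0; move: h; rewrite a0 mul0r => h.
    by rewrite -h ltxx in rQ1.
  have b0 : 0 <= b by exact: cabs_ge0.
  rewrite -[a ^- 2]mul1r ler_pdivrMr ?exprn_gt0// -mulrA -exprMn [b * a]mulrC h.
  have : 2^-1 ^+ 2 <= (1 - r ^+ Q) ^+ 2 by apply: lerXn2r; rewrite ?nnegrE; lra.
  by rewrite !expr2; lra.
apply: le_trans (ler_sum _ (fun s _ => inv s)) _.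
rewrite -mulr_sumr -mulrA; apply: ler_wpM2l => //.
have -> : \sum_(s < Q) cabs (S s) ^+ 2 = Q%:R * \sum_(l < Q) (r ^+ 2) ^+ l.
  apply: complexI; rewrite rmorph_sum rmorphM rmorph_nat rmorph_sum /=.
  transitivity (\sum_(s < Q) \sum_(l < Q) \sum_(l' < Q)
     (r%:C ^+ l * r%:C ^+ l') * (z ^+ l / z ^+ l') ^+ s).
    apply: eq_bigr => s _; rewrite rmorphXn /= -cabsE normCK.
    rewrite /S rmorph_sum /= mulr_suml; apply: eq_bigr => l _.
    rewrite mulr_sumr; apply: eq_bigr => l' _.
    have zc u : (z ^+ u)^* = (z ^+ u)^-1.
      have zu : z ^+ u * (z ^+ u)^* = 1.
        by rewrite -normCK cabsE cabsX (cabs_root_unity pz) expr1n expr1n.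
      by rewrite -[LHS]mul1r -(mulVf (expf_neq0 u z0)) -mulrA zu mulr1.
    have rc : (r%:C : R[i])^* = r%:C by rewrite conj_Creal// ger0_real// lecR.
    have zc' : ((z ^+ l') ^+ s)^* = (z ^+ l')^-1 ^+ s by rewrite rmorphXn /= zc.
    have rc' : (r%:C ^+ l' : R[i])^* = r%:C ^+ l' by rewrite rmorphXn /= rc.
    rewrite (rmorphM Num.conj) /= rc' zc' [in RHS]exprMn.
    by rewrite mulrACA.
  rewrite exchange_big mulr_sumr; apply: eq_bigr => l _ /=.
  rewrite exchange_big (bigD1 l)//= -mulr_sumr (sum_root_unity pz)// eqxx mulr1.
  rewrite big1 ?addr0; last first.
    move=> l' ll'; rewrite -mulr_sumr (sum_root_unity pz)//.
    by rewrite eq_sym -val_eqE in ll' *; rewrite (negbTE ll') !mulr0.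
  by rewrite -expr2 -exprM mulnC exprM mulrC !rmorphXn.
rewrite ler_wpM2l//.
have h := subrX1 (r ^+ 2) Q; set T := \sum_(l < Q) _ in h *.
have T0 : 0 <= T by apply: sumr_ge0 => l _; rewrite exprn_ge0// exprn_ge0.
rewrite -[_^-1]mul1r ler_pdivlMr ?subr_gt0//.
have : (1 - r ^+ 2) * T <= 1.
  by rewrite -opprB mulNr -h opprB lerBlDr lerDl exprn_ge0// exprn_ge0.
apply: le_trans; rewrite mulrC; apply: ler_wpM2r => //.
by rewrite lerD2l lerN2 expr2; rewrite -[leRHS]mulr1; apply: ler_wpM2l => //; exact: ltW.
Qed.

Section PowerDifference.
Context {R : realType} {X : normedModType R[i]} {p : R} (p1 : 1 < p) {N : nat}.
Variables (n : nat) (e : 'I_n -> nat -> R[i]) (K0 M : R).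
Hypothesis K00 : 0 <= K0.
Hypothesis M0 : 0 <= M.
Hypothesis e1 : forall j k, cabs (e j k) <= 1.
Hypothesis hP : forall l, rb X p1 N (fun j k => e j k ^+ l) M.
Hypothesis hA : forall w, 0 < cabs w -> cabs w < 1 ->
  rb X p1 N (fun j k => (1 - e j k) / (1 - w * e j k))
    (K0 * Num.sqrt (cabs (1 - w) / (1 - cabs w))).

Let neq0 w j k : cabs w < 1 -> 1 - w * e j k != 0.
Proof.
move=> w1; rewrite subr_eq0 eq_sym; apply/eqP => /(congr1 (@cabs R)); rewrite cabsM cabs1.
move=> we; have : cabs w * cabs (e j k) <= cabs w by rewrite ler_piMr ?cabs_ge0.
by rewrite we leNgt w1.
Qed.

(** 1/(1 - w e) equals (1 - w (1 - e)/(1 - w e))/(1 - w), hence has R-bound of order x^(1/2)/|1 -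
    w|, with x = |1 - w|/(1 - |w|). Five such factors and one (1 - e)/(1 - w e) give |1 - w|^-5 x^3.
    Truncation costs the bounded factors 1 - w^q e^q and yields a polynomial in [w], whose
    coefficients are averages over roots of unity. *)
Lemma rb_truncated q (w : R[i]) : 0 < cabs w -> cabs w < 1 ->
  rb X p1 N (fun j k => (1 - e j k) * (\sum_(l < q) (w * e j k) ^+ l) ^+ 6)
   (K0 * (1 + K0) ^+ 5 * (1 + M) ^+ 6 * (cabs (1 - w) ^- 2 * (1 - cabs w) ^- 3)).
Proof.
move=> w0 w1; set r := cabs w in w0 w1 *; set a := cabs (1 - w).
have ar : 1 - r <= a by have := cabs_sub 1 w; rewrite cabs1.
have a0 : 0 < a by apply: lt_le_trans ar; rewrite subr_gt0.
set x := a / (1 - r).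
have x1 : 1 <= x by rewrite ler_pdivlMr ?subr_gt0// mul1r.
set y := Num.sqrt x.
have y1 : 1 <= y by rewrite -sqrtr1 ler_wsqrtr.
have y0 : 0 <= y by lra.
have A := hA w0 w1; rewrite -/a -/x -/y in A.
have v1 : 1 - w != 0 by rewrite -cabs_eq0 -/a gt_eqF.
have V : rb X p1 N (fun j k => (1 - w * e j k)^-1) (a^-1 * ((1 + K0) * y)).
  have := rb_scale (1 - w)^-1 (rb_add (@rb_id R X p p1 N n) (rb_scale (- w) A)).
  rewrite cabsV -/a => h; apply: (rb_ext _ (rb_le _ h)); last first.
    rewrite ler_pM2l ?invr_gt0// mulrDl mul1r; apply: lerD => //.
    by rewrite cabsN -/r ler_piMl ?mulr_ge0// ltW.
  move=> j k _; have nz := neq0 j k w1.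
  by field; rewrite nz v1.
have W : rb X p1 N (fun j k => 1 + (- w ^+ q) * e j k ^+ q) (1 + M).
  apply: (rb_add (@rb_id R X p p1 N n)).
  apply: rb_le (rb_scale (- w ^+ q) (hP q)).
  by rewrite cabsN cabsX ler_piMl// exprn_ile1// ltW.
have V0 : 0 <= a^-1 * ((1 + K0) * y) by rewrite !mulr_ge0 ?invr_ge0 ?(ltW a0)// addr_ge0.
have KK : 0 <= K0 * y by rewrite mulr_ge0.
have M1 : 0 <= 1 + M by rewrite addr_ge0.
have h := rb_comp (mulr_ge0 KK (exprn_ge0 5 V0)) (rb_comp KK A (rb_exp 5 V0 V)) (rb_exp 6 M1 W).
apply: (rb_ext _ (rb_le _ h)); last first.
  have -> : K0 * y * (a^-1 * ((1 + K0) * y)) ^+ 5 * (1 + M) ^+ 6 =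
     K0 * (1 + K0) ^+ 5 * (1 + M) ^+ 6 * (a ^- 5 * (y ^+ 2) ^+ 3).
    by field; rewrite gt_eqF.
  rewrite /y sqr_sqrtr ?(le_trans ler01 x1)// /x.
  rewrite le_eqVlt; apply/orP; left; apply/eqP; congr (_ * _).
  by field; rewrite !gt_eqF// subr_gt0.
move=> j k _; have nz := neq0 j k w1.
have hs := subrX1 (w * e j k) q; set T := \sum_(l < q) _ in hs *.
have {hs} -> : T = (1 - w ^+ q * e j k ^+ q) / (1 - w * e j k).
  rewrite -exprMn -opprB hs -mulNr opprB mulrAC divff ?mul1r//.
by field.
Qed.

(** With d = 1/(2m) the average over the circle gives 4 d^-4 = 64 m^4; 240 is twice 5!, from r^m >=
    1/2 and C(m+5,5) >= m^5/5!. *)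
Definition power_cst : R := 64 * 240 * (K0 * (1 + K0) ^+ 5 * (1 + M) ^+ 6).

Lemma power_cst_ge0 : 0 <= power_cst.
Proof.
apply: mulr_ge0; first by apply: mulr_ge0; exact: ler0n.
apply: mulr_ge0; last by rewrite exprn_ge0// addr_ge0.
by apply: mulr_ge0 => //; rewrite exprn_ge0// addr_ge0.
Qed.

(* The coefficient of w^m in (1 - e) (1 - w e)^-6 is C(m+5,5) e^m (1 - e); it
   is extracted by averaging over the circle of radius r = 1 - 1/(2m). *)
Lemma rb_power_difference m : (0 < m)%N ->
  rb X p1 N (fun j k => e j k ^+ m * (1 - e j k)) (power_cst / m%:R).
Proof.
move=> m0; set K3 := K0 * (1 + K0) ^+ 5 * (1 + M) ^+ 6.
have K30 : 0 <= K3.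
  apply: mulr_ge0; last by rewrite exprn_ge0// addr_ge0.
  by apply: mulr_ge0 => //; rewrite exprn_ge0// addr_ge0.
(* Truncation at m + 1 leaves the coefficient of degree [m] intact, and [Q] exceeds the degree of
   [P], so that distinct degrees stay distinct modulo [Q]. *)
pose q := m.+1; pose a := (6 * q)%N; pose Q := (2 ^ a.+1)%N.
have [z pz] := exists_primitive_root R a.
have aQ : (a < Q)%N by rewrite /Q expnS (leq_trans (ltn_expl a (ltnSn 1)))// leq_pmull.
have mQ : (m < Q)%N by apply: leq_ltn_trans aQ; rewrite /a /q; lia.
have Q2m : (2 * m <= Q)%N by apply: leq_trans (ltnW aQ); rewrite /a /q; lia.
have mr : 0 < m%:R :> R by rewrite ltr0n.
pose d : R := (2 * m%:R)^-1.
have d0 : 0 < d by rewrite invr_gt0 mulr_gt0.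
have d2 : d <= 2^-1 by rewrite lef_pV2 ?posrE ?mulr_gt0// ler_peMr// ler1n.
pose r := 1 - d; have r0 : 0 < r by rewrite /r; lra.
have r1 : r < 1 by rewrite /r; lra.
have dE : 1 - r = d by rewrite /r opprB addrC subrK.
have md : m%:R * d = 2^-1 by rewrite /d; field; rewrite gt_eqF.
have rm : 2^-1 <= r ^+ m.
  by have := exprB_ge m (ltW r0) (ltW r1); rewrite dE md; lra.
have rQ : r ^+ Q <= 2^-1.
  have := expr_le_bern Q (ltW r0) (ltW r1); rewrite dE.
  have : 1 <= Q%:R * d.
    apply: (@le_trans _ _ ((2 * m)%:R * d)); first by rewrite natrM -mulrA md mulfV.
    by apply: ler_wpM2r; [exact: ltW|rewrite ler_nat].
  have := exprn_gt0 Q r0; set u := r ^+ Q; set v := Q%:R * d => u0 v1.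
  by have : u * 1 <= u * v by [rewrite ler_pM2l]; lra.
pose w (s : 'I_Q) : R[i] := r%:C * z ^+ s.
have zc : cabs z = 1 by exact: cabs_root_unity pz.
have wr s : cabs (w s) = r.
  by rewrite cabsM cabs_real cabsX zc expr1n mulr1 ger0_norm// ltW.
pose P : {poly R[i]} := (\poly_(l < q) 1) ^+ 6.
have sP : (size P <= Q)%N.
  apply: leq_trans (size_poly_exp_leq _ _) _; apply: leq_trans aQ.
  rewrite ltnS mulnC leq_mul2l /=; apply: leq_trans (leq_pred _) _.
  exact: size_poly.
have Pm : P`_m = 'C(m + 5, 5)%:R by rewrite /P coef_geometric_exp.
have Pe u : P.[u] = (\sum_(l < q) u ^+ l) ^+ 6.
  rewrite horner_exp horner_poly; congr (_ ^+ _).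
  by apply: eq_bigr => l _; rewrite mul1r.
pose c : R := r ^+ m * 'C(m + 5, 5)%:R.
have c0 : m%:R ^+ 5 / 240 <= c.
  have : m%:R ^+ 5 <= 120 * 'C(m + 5, 5)%:R :> R by rewrite -natrX -natrM ler_nat leq_bin5.
  rewrite /c; move: rm; set b := 'C(_, _)%:R; set u := r ^+ m => u2 hb.
  have b0 : 0 <= b by rewrite ler0n.
  have : 2^-1 * b <= u * b by exact: ler_wpM2r.
  lra.
have c1 : 0 < c.
  by apply: lt_le_trans c0; apply: divr_gt0; [exact: exprn_gt0|rewrite ltr0n].
have main : rb X p1 N (fun j k => c%:C * (e j k ^+ m * (1 - e j k))) (64 * K3 * m%:R ^+ 4).
  pose G (s : 'I_Q) (j : 'I_n) (k : nat) : R[i] := (Q%:R^-1 * (z ^+ m) ^- s) *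
     ((1 - e j k) * (\sum_(l < q) (w s * e j k) ^+ l) ^+ 6).
  have hG s : rb X p1 N (G s) (Q%:R^-1 * (K3 * (cabs (1 - w s) ^- 2 * d ^- 3))).
    have := rb_scale (Q%:R^-1 * (z ^+ m) ^- s) (@rb_truncated q (w s) _ _).
    have cz : cabs ((z ^+ m) ^- s) = 1 by rewrite cabsV !cabsX zc !expr1n invr1.
    have cQ : cabs (Q%:R^-1 : R[i]) = Q%:R^-1.
      rewrite (_ : (Q%:R^-1 : R[i]) = (Q%:R^-1 : R)%:C); last by rewrite fmorphV rmorph_nat.
      by rewrite cabs_real ger0_norm// invr_ge0.
    by rewrite wr dE cabsM cz cQ mulr1; apply.
  have hsum := @rb_sum R X p p1 N n _ (index_enum 'I_Q) xpredT G _ (fun s _ => hG s).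
  apply: (rb_ext _ (rb_le _ hsum)); last first.
    rewrite -mulr_sumr -mulr_sumr -mulr_suml.
    have QR : 0 < Q%:R :> R by rewrite ltr0n expn_gt0.
    have := sum_inv_sqr pz (ltW r0) r1 rQ; rewrite -/(w _) dE => hs.
    apply: (@le_trans _ _ (Q%:R^-1 * (K3 * (4 * Q%:R / d * d ^- 3)))).
      rewrite ler_pM2l ?invr_gt0//; apply: ler_wpM2l => //.
      by apply: ler_wpM2r => //; rewrite invr_ge0 exprn_ge0// ltW.
    rewrite le_eqVlt; apply/orP; left; apply/eqP; rewrite /d.
    by field; rewrite !gt_eqF.
  move=> j k _; rewrite /G.
  transitivity ((1 - e j k) * (Q%:R^-1 * \sum_(s < Q) (z ^+ m) ^- s * P.[w s * e j k])).
    rewrite mulr_sumr mulr_sumr; apply: eq_bigr => s _; rewrite Pe.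
    by rewrite mulrCA [in RHS]mulrA.
  rewrite rmorphM rmorphXn rmorph_nat /= -Pm [RHS]mulrC -mulrA -/(e j k).
  rewrite [in RHS]mulrC -[in RHS]mulrA; congr (_ * _).
  have Q0 : (Q%:R : R[i]) != 0 by rewrite pnatr_eq0 -lt0n expn_gt0.
  under eq_bigr do rewrite (horner_coef_wide _ sP) mulr_sumr.
  rewrite exchange_big /=.
  transitivity (Q%:R^-1 * \sum_(i < Q) P`_i * r%:C ^+ i * e j k ^+ i * \sum_(s < Q) (z ^+ i / z ^+ m) ^+ s).
    congr (_ * _); apply: eq_bigr => i _; rewrite mulr_sumr; apply: eq_bigr => s _.
    by rewrite /w !exprMn exprVn -!exprM [(s * i)%N]mulnC; ring.
  rewrite (bigD1 (Ordinal mQ))//= (sum_root_unity pz)// eqxx mulr1 big1 ?addr0; last first.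
    by move=> i; rewrite -val_eqE /= => im; rewrite (sum_root_unity pz)// (negbTE im) !mulr0.
  by field.
have c1' : c%:C != 0 :> R[i] by rewrite -cabs_eq0 cabs_real gtr0_norm// gt_eqF.
apply: (rb_ext _ (rb_le _ (rb_scale (c%:C)^-1 main))); last first.
  rewrite cabsV cabs_real gtr0_norm// /power_cst -/K3.
  have : c^-1 <= 240 / m%:R ^+ 5.
    rewrite -[240 / _]invrK lef_pV2 ?posrE//; last first.
      by rewrite invr_gt0; apply: divr_gt0; [rewrite ltr0n|exact: exprn_gt0].
    by rewrite invfM invrK mulrC.
  move=> hc; have z64 : 0 <= 64 * K3 * m%:R ^+ 4.
    by apply: mulr_ge0; [apply: mulr_ge0 => //; exact: ler0n|rewrite exprn_ge0// ltW].
  apply: le_trans (ler_wpM2r z64 hc) _; rewrite le_eqVlt; apply/orP; left; apply/eqP.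
  by field; rewrite gt_eqF.
by move=> j k _; rewrite mulrA mulVf// mul1r.
Qed.

End PowerDifference.

(** * The semigroup at complex times *)

Lemma expR_second_order (R : realType) (x : R) : 0 <= x -> `|x - (1 - expR (- x))| <= x ^+ 2.
Proof.
move=> x0; have h1 := expR_ge1Dx (- x); have h2 := expR_ge1Dx x.
have hp := expR_gt0 (- x).
have h3 : expR (- x) * (1 + x) <= 1.
  have : expR (- x) * expR x = 1 by rewrite -expRD addNr expR0.
  have : expR (- x) * (1 + x) <= expR (- x) * expR x by rewrite ler_pM2l.
  lra.
have h4 : expR (- x) <= 1 - x + x ^+ 2.
  rewrite -(@ler_pM2r _ (1 + x)); last by lra.
  apply: le_trans h3 _.
  have -> : (1 - x + x ^+ 2) * (1 + x) = 1 + x ^+ 3 by ring.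
  by rewrite lerDl exprn_ge0.
rewrite ger0_norm; first by move: h4; rewrite expr2; lra.
by lra.
Qed.

(** From (1 + 1/a)^a <= e. It lets the factorials of the Taylor series absorb a^a in the identity (t
    Delta)^a T(t) = a^a ((t/a) Delta T(t/a))^a. *)
Lemma natX_le_fact (R : realType) (a : nat) : a%:R ^+ a <= expR 1 ^+ a * a`!%:R :> R.
Proof.
elim: a => [|a IH]; first by rewrite !expr0 mul1r.
have [->|a0] := posnP a.
  by rewrite !expr1 mulr1 -[leLHS]expR0 ler_expR.
have ap : 0 < a%:R :> R by rewrite ltr0n.
have h : a.+1%:R ^+ a <= expR 1 * a%:R ^+ a :> R.
  have -> : a.+1%:R = a%:R * (1 + a%:R^-1) :> R by rewrite -natr1; field; rewrite gt_eqF.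
  rewrite exprMn mulrC ler_pM2r ?exprn_gt0//.
  have -> : expR 1 = expR (a%:R^-1) ^+ a :> R.
    by rewrite -expRM_natl mulfV// gt_eqF.
  by apply: lerXn2r; rewrite ?nnegrE ?expR_ge0 ?addr_ge0 ?invr_ge0// expR_ge1Dx.
rewrite exprS factS natrM exprS.
have -> : expR 1 * expR 1 ^+ a * (a.+1%:R * a`!%:R) = a.+1%:R * (expR 1 * (expR 1 ^+ a * a`!%:R)) :> R by ring.
rewrite ler_pM2l ?ltr0n//; apply: le_trans h _.
by rewrite ler_pM2l ?expR_gt0.
Qed.

Lemma cabs_nat (R : realType) (m : nat) : cabs (m%:R : R[i]) = m%:R.
Proof. by rewrite -(rmorph_nat (real_complex R)) cabs_real ger0_norm. Qed.

Definition cis (R : realType) (y : R) : R[i] := cos y +i* sin y.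

Lemma cabs_cis (R : realType) (y : R) : cabs (cis y) = 1.
Proof. by rewrite /cabs normc_def /= cos2Dsin2 sqrtr1. Qed.

Lemma cisD (R : realType) (x y : R) : cis (x + y) = cis x * cis y.
Proof.
rewrite /cis cosD sinD; apply/eqP; rewrite eq_complex /=; apply/andP; split=> //.
by apply/eqP; ring.
Qed.

Lemma expr_i (R : realType) (a : nat) : 'i%C ^+ a =
  (((~~ odd a)%:R * (-1) ^+ a./2 : R) +i* ((odd a)%:R * (-1) ^+ a./2)).
Proof.
elim: a => [|a IH]; first by rewrite expr0 /= mul1r mul0r.
rewrite exprS IH /=; case: (boolP (odd a)) => oa /=.
  rewrite uphalf_half oa add1n exprS; apply/eqP; rewrite eq_complex /=.
  by apply/andP; split; apply/eqP; ring.
rewrite uphalf_half (negbTE oa) add0n; apply/eqP; rewrite eq_complex /=.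
by apply/andP; split; apply/eqP; ring.
Qed.

Lemma cis_taylor (R : realType) (y e : R) : 0 < e -> exists m0, forall m, (m0 <= m)%N ->
  cabs (cis y - \sum_(a < m) ('i%C * y%:C) ^+ a / a`!%:R) <= e.
Proof.
move=> e0.
have sumE m : \sum_(a < m) ('i%C * y%:C) ^+ a / a`!%:R =
    (series (cos_coeff y) m) +i* (series (sin_coeff y) m).
  rewrite /series /=; elim: m => [|m IH]; first by rewrite !big_geq// big_ord0.
  rewrite big_ord_recr /= IH !big_nat_recr//=; rewrite /cos_coeff /sin_coeff.
  rewrite exprMn expr_i -rmorphXn /=.
  rewrite (_ : (m`!%:R^-1 : R[i]) = (m`!%:R^-1)%:C); last by rewrite fmorphV rmorph_nat.
  rewrite -exprnP; have -> : (odd m)%:R * (-1) ^+ m.-1./2 = (odd m)%:R * (-1) ^+ m./2 :> R.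
    case: (boolP (odd m)) => om; last by rewrite !mul0r.
    by rewrite -(odd_double_half m) om add1n /= uphalf_double doubleK.
  by apply/eqP; rewrite eq_complex /=; apply/andP; split; apply/eqP; ring.
have hc : series (cos_coeff y) @ \oo --> cos y by rewrite cos.unlock; exact: is_cvg_series_cos_coeff.
have hs : series (sin_coeff y) @ \oo --> sin y by rewrite sin.unlock; exact: is_cvg_series_sin_coeff.
have e2 : 0 < e / 2 by rewrite divr_gt0.
move/cvgrPdist_le : hc => /(_ _ e2) [m1 _ h1].
move/cvgrPdist_le : hs => /(_ _ e2) [m2 _ h2].
exists (maxn m1 m2) => m; rewrite geq_max => /andP[l1 l2].
rewrite sumE; have := h1 m l1; have := h2 m l2 => /=.
set A := series _ m; set A' := series _ m => b1 b2.
have -> : cis y - (A' +i* A) = (cos y - A')%:C + 'i%C * (sin y - A)%:C.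
  by rewrite /cis; apply/eqP; rewrite eq_complex /=; apply/andP; split; apply/eqP; ring.
apply: le_trans (cabsD _ _) _; rewrite cabsM !cabs_real.
have -> : cabs ('i%C : R[i]) = 1 by rewrite /cabs normCi.
by rewrite mul1r; lra.
Qed.

(* exp(- z k) for z = u + i v. *)
Definition csemi (R : realType) (z : R[i]) (k : nat) : R[i] :=
  semi (complex.Re z) k * cis (- complex.Im z * k%:R).

Lemma dyadic_floor (R : realType) (tau u : R) : 0 < tau -> tau <= u ->
  exists i, 2 ^+ i * tau <= u < 2 ^+ i.+1 * tau.
Proof.
move=> t0 tu; have x1 : 1 <= u / tau by rewrite ler_pdivlMr// mul1r.
pose q := Num.truncn (u / tau).
have x0 : 0 <= u / tau by lra.
have /andP[q1 q2] := truncn_itv x0; rewrite -/q in q1 q2.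
have q0 : (0 < q)%N by rewrite -(ltr_nat R); have := lt_le_trans q2 (lexx _); rewrite -natr1; lra.
exists (trunc_log 2 q).
have /andP[l1 l2] := trunc_log_bounds (isT : (1 < 2)%N) q0.
rewrite -ler_pdivlMr// -ltr_pdivrMr//; apply/andP; split.
  by apply: le_trans q1; rewrite -natrX ler_nat.
by apply: lt_le_trans q2 _; rewrite -natrX ler_nat.
Qed.

Section Analytic.
Context {R : realType} {X : normedModType R[i]} {p : R} (p1 : 1 < p) {N : nat}.
Variables (M K2 : R).
Hypothesis M0 : 0 <= M.
Hypothesis K20 : 0 <= K2.
Hypothesis hS : forall n (t : 'I_n -> R), (forall j, 0 <= t j) ->
  rb X p1 N (fun j => semi (t j)) M.
Hypothesis hD : forall n (idx : 'I_n -> nat) (tau : R) m, 0 < tau -> (0 < m)%N ->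
  rb X p1 N (fun j k => semi (2 ^+ idx j * tau) k ^+ m * (1 - semi (2 ^+ idx j * tau) k))
    (K2 / m%:R).

(** T(t/m)^m = T(t) and m (1 - T(t/m)) tends to t Delta. Only the common factor [tau] is divided by
    [m], so the steps remain dyadic multiples of one number. *)
Lemma rb_derivative n (idx : 'I_n -> nat) (tau : R) : 0 < tau ->
  rb X p1 N (fun j k => (2 ^+ idx j * tau * k%:R)%:C * semi (2 ^+ idx j * tau) k) K2.
Proof.
move=> tau0; pose t j := 2 ^+ idx j * tau.
have t0 j : 0 <= t j by rewrite mulr_ge0 ?exprn_ge0// ltW.
apply: rb_limit => eps eps0.
(* [Y] is at least every t_j k with k <= N; its dependence on [N] only affects the choice of [m]. *)
pose Y := (\sum_j t j) * N%:R.
have Y0 : 0 <= Y by rewrite mulr_ge0// sumr_ge0.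
pose m := (Num.truncn (Y ^+ 2 / eps)).+1.
have m0 : 0 < m%:R :> R by rewrite ltr0n.
have mY : Y ^+ 2 / m%:R <= eps.
  by rewrite ler_pdivrMr// mulrC -ler_pdivrMr// ltW// truncnS_gt.
exists (fun j k => m%:R * (semi (2 ^+ idx j * (tau / m%:R)) k ^+ m *
    (1 - semi (2 ^+ idx j * (tau / m%:R)) k))).
  apply: rb_le (rb_scale _ (hD idx (divr_gt0 tau0 m0) (ltn0Sn _))).
  rewrite cabs_nat.
  by rewrite mulrC divfK// gt_eqF.
move=> j k kN; rewrite -/(t j).
have -> : 2 ^+ idx j * (tau / m%:R) = t j / m%:R by rewrite /t mulrA.
rewrite -semiM mulrC [m%:R * (t j / _)]mulrC divfK ?gt_eqF// mulrCA -mulrBr.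
rewrite cabsM -[leRHS]mul1r; apply: ler_pM; rewrite ?cabs_ge0 ?semi_le1//.
have -> : (t j * k%:R)%:C - m%:R * (1 - semi (t j / m%:R) k) =
    (m%:R * (t j * k%:R / m%:R - (1 - expR (- (t j * k%:R / m%:R)))))%:C.
  rewrite /semi mulNr [_ / _ * k%:R]mulrAC; set E := expR _.
  rewrite -[m%:R in LHS](rmorph_nat (real_complex R)) -[X in _ * (X - _)](rmorph1 (real_complex R)).
  rewrite -rmorphB -rmorphM -rmorphB /=; congr (_%:C).
  by field; rewrite gt_eqF.
rewrite cabs_real normrM ger0_norm//.
have y0 : 0 <= t j * k%:R / m%:R by rewrite divr_ge0// mulr_ge0.
apply: le_trans (ler_wpM2l (ltW m0) (expR_second_order y0)) _.
apply: le_trans mY; rewrite expr_div_n.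
have -> : m%:R * ((t j * k%:R) ^+ 2 / m%:R ^+ 2) = (t j * k%:R) ^+ 2 / m%:R.
  by field; rewrite gt_eqF.
rewrite ler_pM2r ?invr_gt0//; apply: lerXn2r; [by rewrite nnegrE mulr_ge0|by rewrite nnegrE|].
rewrite /Y; apply: ler_pM => //; last by rewrite ler_nat.
by rewrite (bigD1 j)//= lerDl sumr_ge0.
Qed.

Variable rho : R.
Hypothesis rho0 : 0 < rho.
Hypothesis rho1 : rho * K2 * expR 1 <= 2^-1.

(** The Taylor term of degree a is (i s/t)^a / a! times (t Delta)^a T(t). As |s| <= rho t, its
    R-bound for a >= 1 is at most 2 (rho K2 e)^a <= 2 2^-a, and these sum to 2; the term of degree 0
    gives 2 M. The factor 2 stems from coefficients depending on [j]. *)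
Lemma rb_cis n (idx : 'I_n -> nat) (tau : R) (s : 'I_n -> R) : 0 < tau ->
  (forall j, `|s j| <= rho * (2 ^+ idx j * tau)) ->
  rb X p1 N (fun j k => cis (s j * k%:R) * semi (2 ^+ idx j * tau) k) (2 * M + 2).
Proof.
move=> tau0 hs; pose t j := 2 ^+ idx j * tau.
have t0 j : 0 < t j by rewrite mulr_gt0 ?exprn_gt0.
have rK : 0 <= rho * K2 * expR 1 by rewrite !mulr_ge0 ?expR_ge0 ?(ltW rho0).
have e1 := expR_gt0 (1 : R).
pose Kt (a : nat) := if a is 0%N then 2 * M else 2 * 2^-1 ^+ a.
have term a : rb X p1 N (fun j k => ('i%C * (s j / t j)%:C) ^+ a / a`!%:R *
    ((t j * k%:R)%:C ^+ a * semi (t j) k)) (Kt a).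
  have cf j : cabs (('i%C * (s j / t j)%:C) ^+ a / a`!%:R) <= rho ^+ a / a`!%:R.
    rewrite cabsM cabsX cabsM cabs_real cabsV.
    have -> : cabs ('i%C : R[i]) = 1 by rewrite /cabs normCi.
    rewrite cabs_nat mul1r.
    rewrite ler_pM2r ?invr_gt0 ?ltr0n ?fact_gt0//.
    apply: lerXn2r; [by rewrite nnegrE|by rewrite nnegrE ltW|].
    by rewrite normrM normfV (gtr0_norm (t0 j)) ler_pdivrMr//; exact: hs.
  have r0 : 0 <= rho ^+ a / a`!%:R by rewrite divr_ge0// exprn_ge0// ltW.
  case: a cf r0 => [|a] cf r0.
    apply: (rb_ext _ (rb_le _ (rb_coef r0 cf (hS (fun j => ltW (t0 j)))))) => [j k _|].
      by rewrite [_%:C ^+ 0]expr0 mul1r.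
    by rewrite expr0 fact0 divr1 mulr1.
  have ap : 0 < a.+1%:R :> R by rewrite ltr0n.
  have h1 := rb_exp a.+1 K20 (rb_derivative idx (divr_gt0 tau0 ap)).
  have h2 := rb_scale (a.+1%:R ^+ a.+1) h1.
  have h3 : rb X p1 N (fun j k => (t j * k%:R)%:C ^+ a.+1 * semi (t j) k) (a.+1%:R ^+ a.+1 * K2 ^+ a.+1).
    apply: (rb_ext _ (rb_le _ h2)); last first.
      by rewrite cabsX cabs_nat.
    move=> j k _; rewrite [X in _ * X]exprMn -semiM [LHS]mulrA -exprMn.
    have -> : 2 ^+ idx j * (tau / a.+1%:R) = t j / a.+1%:R by rewrite /t mulrA.
    rewrite [a.+1%:R * (t j / _)]mulrC divfK ?gt_eqF//; congr (_ ^+ _ * _).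
    rewrite -[a.+1%:R in LHS](rmorph_nat (real_complex R)) -rmorphM /=.
    by congr (_%:C); field; rewrite gt_eqF.
  apply: rb_le (rb_coef r0 cf h3).
  have -> : 2 * (rho ^+ a.+1 / a.+1`!%:R) * (a.+1%:R ^+ a.+1 * K2 ^+ a.+1) =
     2 * ((rho * K2) ^+ a.+1 * (a.+1%:R ^+ a.+1 / a.+1`!%:R)).
    by rewrite [(rho * K2) ^+ _]exprMn; ring.
  rewrite ler_pM2l//; apply: (@le_trans _ _ ((rho * K2) ^+ a.+1 * expR 1 ^+ a.+1)).
    apply: ler_wpM2l; first by rewrite exprn_ge0// mulr_ge0// ltW.
    by rewrite ler_pdivrMr ?ltr0n ?fact_gt0// natX_le_fact.
  by rewrite -exprMn; apply: lerXn2r => //; rewrite nnegrE.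
apply: rb_limit => eps eps0.
have ex (jk : 'I_n * 'I_N.+1) : {m0 : nat | forall m, (m0 <= m)%N ->
    cabs (cis (s jk.1 * jk.2%:R) - \sum_(a < m) ('i%C * (s jk.1 * jk.2%:R)%:C) ^+ a / a`!%:R) <= eps}.
  by apply: cid; exact: cis_taylor.
pose m := \max_(jk : 'I_n * 'I_N.+1) sval (ex jk).
exists (fun j k => \sum_(a < m) ('i%C * (s j / t j)%:C) ^+ a / a`!%:R *
    ((t j * k%:R)%:C ^+ a * semi (t j) k)).
  apply: rb_le (@rb_sum R X p p1 N n _ (index_enum 'I_m) xpredT
    (fun (a : 'I_m) j k => ('i%C * (s j / t j)%:C) ^+ a / a`!%:R *
      ((t j * k%:R)%:C ^+ a * semi (t j) k)) (fun a => Kt a) (fun a _ => term a)).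
  have MM := M0.
  suff geo a : \sum_(i < a) Kt i <= if a is b.+1 then 2 * M + 2 - 2 * 2^-1 ^+ b else 0.
    apply: le_trans (geo m) _; case: m => [|a]; first by rewrite addr_ge0// mulr_ge0.
    by rewrite gerBl mulr_ge0// exprn_ge0// invr_ge0.
  elim: a => [|a IH]; first by rewrite big_ord0.
  rewrite big_ord_recr /=; apply: le_trans (lerD IH (lexx _)) _.
  case: a {IH} => [|a] /=; first by rewrite /Kt expr0; lra.
  by rewrite /Kt exprS; lra.
move=> j k kN.
have := svalP (ex (j, inord k)) m (leq_bigmax _); rewrite /= inordK// => h.
rewrite -/(t j).
rewrite (_ : \sum_(a < m) _ = (\sum_(a < m) ('i%C * (s j * k%:R)%:C) ^+ a / a`!%:R) * semi (t j) k); last first.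
  rewrite mulr_suml; apply: eq_bigr => a _.
  rewrite mulrA; congr (_ * _); rewrite mulrAC -exprMn -mulrA -rmorphM /=.
  by congr ((_ * _%:C) ^+ _ / _); field; rewrite gt_eqF.
rewrite -mulrBl cabsM -[leRHS]mulr1; apply: ler_pM; rewrite ?cabs_ge0//.
by apply: semi_le1; exact: ltW.
Qed.

Definition sector_cst : R := M * (2 * M + 2).

(** T(u + i v) = T(u - t) T(t + i v) with t a dyadic multiple of [tau] and t <= u <= 2 t; the
    hypothesis on the imaginary part then reads |v| <= rho t. *)
Lemma rb_csemi n (z : 'I_n -> R[i]) :
  (forall j, 0 < complex.Re (z j)) ->
  (forall j, 2 * `|complex.Im (z j)| <= rho * complex.Re (z j)) ->
  rb X p1 N (fun j => csemi (z j)) sector_cst.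
Proof.
move=> u0 hv; pose u j := complex.Re (z j); pose v j := complex.Im (z j).
(* A common step below every u_j; the summand 1 keeps it positive for the empty tuple. *)
pose tau := (1 + \sum_j (u j)^-1)^-1.
have s0 : 0 <= \sum_j (u j)^-1 by apply: sumr_ge0 => j _; rewrite invr_ge0 ltW// u0.
have tau0 : 0 < tau by rewrite invr_gt0 ltr_pwDl.
have tu j : tau <= u j.
  rewrite -[u j]invrK lef_pV2 ?posrE ?invr_gt0 ?u0 ?ltr_pwDl//.
  rewrite (bigD1 j)//= addrCA lerDl addr_ge0// sumr_ge0// => i _.
  by rewrite invr_ge0 ltW// u0.
have ex j : {i | 2 ^+ i * tau <= u j < 2 ^+ i.+1 * tau} by apply: cid; exact: dyadic_floor.
pose idx j := sval (ex j).
have lo j : 2 ^+ idx j * tau <= u j by have /andP[] := svalP (ex j).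
have hi j : u j <= 2 * (2 ^+ idx j * tau).
  by rewrite mulrA -exprS ltW//; have /andP[] := svalP (ex j).
have h1 : rb X p1 N (fun j => semi (u j - 2 ^+ idx j * tau)) M.
  by apply: hS => j; rewrite subr_ge0.
have h2 := @rb_cis n idx tau (fun j => - v j) tau0 _.
apply: rb_ext (rb_comp M0 h1 (h2 _)) => [j k _|j].
  rewrite /csemi mulrCA mulrC; congr (_ * _).
  by rewrite /semi -rmorphM /= -expRD -/(u j); congr ((expR _)%:C); ring.
rewrite normrN -(@ler_pM2l _ 2)//; apply: le_trans (hv j) _.
by rewrite [leRHS]mulrCA ler_pM2l//; exact: hi.
Qed.

End Analytic.

(** * The complex exponential *)

Definition cexp (R : realType) (z : R[i]) : R[i] := (expR (complex.Re z))%:C * cis (complex.Im z).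

Section Cexp.
Context {R : realType}.
Implicit Types (z h : R[i]).

Lemma cexpD z h : cexp (z + h) = cexp z * cexp h.
Proof.
case: z h => [a b] [a' b']; rewrite /cexp /= expRD cisD rmorphM /=.
by rewrite mulrACA.
Qed.

Lemma cexp0 : cexp (0 : R[i]) = 1.
Proof. by rewrite /cexp /= expR0 /cis cos0 sin0 mul1r. Qed.

Lemma cexpMn z l : cexp (l%:R * z) = cexp z ^+ l.
Proof.
elim: l => [|l IH]; first by rewrite mul0r cexp0.
by rewrite -natr1 mulrDl mul1r cexpD IH exprSr.
Qed.

Lemma cabs_cexp z : cabs (cexp z) = expR (complex.Re z).
Proof. by rewrite /cexp cabsM cabs_cis mulr1 cabs_real ger0_norm// expR_ge0. Qed.

Lemma csemiE z k : csemi z k = cexp (- (k%:R * z)).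
Proof.
rewrite /csemi /cexp /semi -(rmorph_nat (real_complex R)).
by case: z => a b /=; congr ((expR _)%:C * cis _); ring.
Qed.

Lemma cabs_Re z : `|complex.Re z| <= cabs z.
Proof.
by rewrite /cabs normc_def /= -[leLHS]sqrtr_sqr ler_wsqrtr// lerDl sqr_ge0.
Qed.

Lemma cabs_Im z : `|complex.Im z| <= cabs z.
Proof.
by rewrite /cabs normc_def /= -[leLHS]sqrtr_sqr ler_wsqrtr// lerDr sqr_ge0.
Qed.

Lemma inv_fact_le (a : nat) : (a.+2`!%:R : R)^-1 <= 2^-1 ^+ a.+1.
Proof.
elim: a => [|a IH]; first by rewrite expr1.
rewrite factS natrM invfM exprS; apply: ler_pM => //; rewrite ?invr_ge0//.
by rewrite lef_pV2 ?posrE ?ltr0n// ler_nat.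
Qed.

Lemma cis_second_order (y : R) : `|y| <= 1 -> cabs (cis y - 1 - 'i%C * y%:C) <= y ^+ 2.
Proof.
move=> y1; apply/ler_addgt0Pr => e e0; have [m0 h] := cis_taylor y e0.
have := h m0.+2 (leqW (leqnSn m0)).
rewrite 2!big_ord_recl /= expr0 expr1 fact0 factS fact0 !divr1.
set S := \sum_(i < m0) _ => hS.
have -> : cis y - 1 - 'i%C * y%:C = (cis y - (1 + ('i%C * y%:C + S))) + S by ring.
apply: le_trans (cabsD _ _) _; rewrite addrC; apply: lerD => //.
apply: le_trans (cabs_sum _ _ _) _.
apply: (@le_trans _ _ (\sum_(i < m0) y ^+ 2 * 2^-1 ^+ i.+1)).
  apply: ler_sum => i _; rewrite /bump /= !add1n cabsM cabsX cabsM cabs_real cabsV cabs_nat.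
  have -> : cabs ('i%C : R[i]) = 1 by rewrite /cabs normCi.
  rewrite mul1r -[y ^+ 2]ger0_norm ?sqr_ge0// normrX -[i.+2]/(2 + i)%N exprD -mulrA.
  apply: ler_wpM2l; first exact: exprn_ge0.
  rewrite -[leRHS]mul1r; apply: ler_pM; rewrite ?exprn_ge0 ?invr_ge0//; last exact: inv_fact_le.
  exact: exprn_ile1.
rewrite -mulr_sumr ler_piMr ?sqr_ge0//.
have -> : \sum_(i < m0) (2^-1 : R) ^+ i.+1 = 1 - 2^-1 ^+ m0.
  elim: (m0) => [|m IH]; first by rewrite big_ord0 expr0 subrr.
  by rewrite big_ord_recr /= IH exprS; field.
by rewrite gerBl exprn_ge0// invr_ge0.
Qed.

Lemma expR_second_order_abs (a : R) : `|a| <= 1 ->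
  `|expR a - 1 - a| <= 2 * a ^+ 2 /\ expR a <= 4.
Proof.
move=> a1.
have [a0|a0] := leP 0 a; last first.
  have na : 0 <= - a by rewrite oppr_ge0 ltW.
  have := expR_second_order na; rewrite opprK sqrrN.
  have -> : - a - (1 - expR a) = expR a - 1 - a by ring.
  move=> h; split.
    by apply: le_trans h _; have := sqr_ge0 a; lra.
  apply: (@le_trans _ _ 1); last by rewrite ler1n.
  by rewrite -expR0 ler_expR ltW.
rewrite ger0_norm// in a1.
have h1 := expR_ge1Dx (- (a / 2)); have h2 := expR_ge1Dx a.
have h3 : expR a * (1 - a / 2) ^+ 2 <= 1.
  apply: (@le_trans _ _ (expR a * expR (- (a / 2)) ^+ 2)); last first.
    rewrite -expRM_natl -expRD le_eqVlt; apply/orP; left; apply/eqP.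
    by rewrite -[RHS]expR0; congr expR; field.
  by rewrite ler_pM2l ?expR_gt0//; apply: lerXn2r; rewrite ?nnegrE ?expR_ge0//; lra.
have p2 : 0 < (1 - a / 2) ^+ 2 by rewrite exprn_gt0//; lra.
have h4 : expR a <= 1 + a + 2 * a ^+ 2.
  rewrite -(ler_pM2r p2); apply: le_trans h3 _.
  have -> : (1 + a + 2 * a ^+ 2) * (1 - a / 2) ^+ 2 =
    1 + a ^+ 2 * ((1 - a) * (5 / 4 - a / 2)) by field.
  by rewrite lerDl mulr_ge0 ?sqr_ge0// mulr_ge0//; lra.
split; last first.
  apply: le_trans h4 _; have : a ^+ 2 <= 1 by rewrite exprn_ile1.
  by lra.
by rewrite ger0_norm; lra.
Qed.

(** For h = a + i b the remainder splits into e^a (e^(ib) - 1 - i b), e^a - 1 - a and i b (e^a - 1),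
    which contribute 4, 2 and 3. *)
Lemma cexp_second_order h : cabs h <= 1 -> cabs (cexp h - 1 - h) <= 9 * cabs h ^+ 2.
Proof.
move=> h1; have := cabs_Re h; have := cabs_Im h.
case: h h1 => [a b]; set H := cabs _; rewrite [complex.Re _]/= [complex.Im _]/= => h1 hb ha.
have [e1 e2] := expR_second_order_abs (le_trans ha h1).
have c1 := cis_second_order (le_trans hb h1).
have -> : cexp (a +i* b) - 1 - (a +i* b) = (expR a)%:C * (cis b - 1 - 'i%C * b%:C) +
    ((expR a - 1 - a)%:C + 'i%C * (b * (expR a - 1))%:C).
  rewrite /cexp [complex.Re _]/= [complex.Im _]/= /cis.
  by apply/eqP; rewrite eq_complex /=; apply/andP; split; apply/eqP; ring.
have i1 : cabs ('i%C : R[i]) = 1 by rewrite /cabs normCi.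
have ee : `|expR a - 1| <= 3 * `|a|.
  have -> : expR a - 1 = (expR a - 1 - a) + a by ring.
  apply: le_trans (ler_normD _ _) _.
  have : `|a| ^+ 2 <= `|a| by rewrite expr2 ler_piMr// (le_trans ha).
  have : a ^+ 2 = `|a| ^+ 2 by rewrite -normrX ger0_norm ?sqr_ge0.
  by move=> <-; lra.
have H0 : 0 <= H by exact: cabs_ge0.
have sq (u : R) : `|u| <= H -> u ^+ 2 <= H ^+ 2.
  move=> uH; rewrite -[u ^+ 2]ger0_norm ?sqr_ge0// normrX.
  by apply: lerXn2r; rewrite ?nnegrE.
have t1 : cabs ((expR a)%:C * (cis b - 1 - 'i%C * b%:C)) <= 4 * H ^+ 2.
  rewrite cabsM cabs_real ger0_norm ?expR_ge0//.
  by apply: ler_pM; rewrite ?expR_ge0 ?cabs_ge0//; apply: le_trans c1 (sq _ hb).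
have t2 : cabs ((expR a - 1 - a)%:C : R[i]) <= 2 * H ^+ 2.
  by rewrite cabs_real; apply: le_trans e1 _; rewrite ler_pM2l//; exact: sq.
have t3 : cabs ('i%C * (b * (expR a - 1))%:C) <= 3 * H ^+ 2.
  rewrite cabsM i1 mul1r cabs_real normrM expr2 mulrCA.
  apply: ler_pM => //; apply: le_trans ee _.
  by rewrite ler_pM2l.
apply: le_trans (cabsD _ _) _; apply: le_trans (lerD (lexx _) (cabsD _ _)) _.
by lra.
Qed.

(** Since 9 |h|^2 <= |h|/2, the denominator is at least |h|/2. With h = s u this gives the
    convergence of s/(exp(s u) - 1) to 1/u needed for Riemann sums. *)
Lemma div_cexp_sub1 h : h != 0 -> cabs h <= 18^-1 ->
  cexp h - 1 != 0 /\ cabs (h / (cexp h - 1) - 1) <= 18 * cabs h.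
Proof.
move=> h0 h1; have h1' : cabs h <= 1 by apply: le_trans h1 _; lra.
have hp : 0 < cabs h by rewrite lt_def cabs_ge0 cabs_eq0 h0.
have sec := cexp_second_order h1'.
have lo : cabs h / 2 <= cabs (cexp h - 1).
  have := cabs_sub h (- (cexp h - 1 - h)); rewrite cabsN opprK.
  have -> : h + (cexp h - 1 - h) = cexp h - 1 by ring.
  have : 9 * cabs h ^+ 2 <= cabs h / 2.
    rewrite expr2 mulrA mulrC ler_pM2l//; lra.
  by lra.
have n0 : cexp h - 1 != 0.
  by rewrite -cabs_eq0 gt_eqF// (lt_le_trans _ lo)// divr_gt0.
split=> //.
have -> : h / (cexp h - 1) - 1 = - (cexp h - 1 - h) / (cexp h - 1) by field.
rewrite cabsM cabsN cabsV ler_pdivrMr ?(lt_le_trans _ lo) ?divr_gt0//.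
apply: le_trans sec _.
have : 18 * cabs h * (cabs h / 2) <= 18 * cabs h * cabs (cexp h - 1).
  by apply: ler_wpM2l lo; rewrite mulr_ge0// ltW.
apply: le_trans; rewrite expr2; lra.
Qed.

End Cexp.

(** * Resolvents by the Laplace transform *)

Section Resolvent.
Context {R : realType} {X : normedModType R[i]} {p : R} (p1 : 1 < p) {N : nat}.
Variables (rho K : R).
Hypothesis K0 : 0 <= K.
Hypothesis hZ : forall n (z : 'I_n -> R[i]), (forall j, 0 < complex.Re (z j)) ->
  (forall j, 2 * `|complex.Im (z j)| <= rho * complex.Re (z j)) ->
  rb X p1 N (fun j => csemi (z j)) K.
Variables (n : nat) (r c : R) (v d : 'I_n -> R[i]) (rr : 'I_n -> R).
Hypothesis c0 : 0 < c.
Hypothesis r0 : forall j, 0 < rr j.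
Hypothesis v1 : forall j, cabs (v j) = 1.
Hypothesis vc : forall j, c <= complex.Re (v j).
Hypothesis d1 : forall j, cabs (d j) = 1.
Hypothesis d0 : forall j, 0 < complex.Re (d j).
Hypothesis dS : forall j, 2 * `|complex.Im (d j)| <= rho * complex.Re (d j).

(* With mu = rr v / d, the sum over l >= 1 of s v exp(- s l v) T(l s d / rr)
   discretizes the Laplace representation of mu (mu + Delta)^-1 along the ray
   of direction d. *)
Let q (s : R) j k : R[i] := cexp (- (s%:C * (v j + k%:R * d j / (rr j)%:C))).

(** The coefficients are at most s x^(l+1) with x = exp(- s c); their sum is at most 1/c whatever
    [s], because exp(s c) >= 1 + s c. The operators stay in the sector of R-boundedness, as their
    times are positive multiples of [d j]. *)
Lemma rb_laplace_sum (s : R) : 0 < s ->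
  rb X p1 N (fun j k => s%:C * v j * (q s j k / (1 - q s j k))) (2 * K / c).
Proof.
move=> s0.
have Re_scale (x : R) (z : R[i]) : complex.Re (x%:C * z) = x * complex.Re z.
  by case: z => a b /=; ring.
have Im_scale (x : R) (z : R[i]) : complex.Im (x%:C * z) = x * complex.Im z.
  by case: z => a b /=; ring.
pose x := expR (- (s * c)).
have x1 : x < 1 by rewrite -expR0 ltr_expR oppr_lt0 mulr_gt0.
have xp : 0 < x by exact: expR_gt0.
have term (l : nat) : rb X p1 N (fun j k => s%:C * v j * cexp (- (l.+1%:R * (s%:C * v j))) *
    csemi ((l.+1%:R * s / rr j)%:C * d j) k) (2 * (s * x ^+ l.+1) * K).
  apply: rb_coef; first by rewrite mulr_ge0 ?exprn_ge0// ltW.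
    move=> j; rewrite cabsM [cabs (_ * v j)]cabsM v1 mulr1 cabs_real gtr0_norm// ler_pM2l// cabs_cexp.
    rewrite /x -expRM_natl ler_expR mulrN.
    have -> : complex.Re (- (l.+1%:R * (s%:C * v j))) = - (l.+1%:R * (s * complex.Re (v j))).
      rewrite -(rmorph_nat (real_complex R)); case: (v j) => a b /=; ring.
    by rewrite lerN2 ler_pM2l ?ltr0n// ler_pM2l.
  have y0 j : 0 < l.+1%:R * s / rr j by rewrite divr_gt0 ?mulr_gt0 ?ltr0n.
  apply: hZ => j; first by rewrite Re_scale mulr_gt0.
  by rewrite Re_scale Im_scale normrM gtr0_norm// mulrCA [leRHS]mulrCA ler_pM2l.
have qE (l : nat) j k : cexp (- (l.+1%:R * (s%:C * v j))) * csemi ((l.+1%:R * s / rr j)%:C * d j) k =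
    q s j k ^+ l.+1.
  rewrite csemiE -cexpD /q -cexpMn; congr cexp.
  by rewrite rmorphM fmorphV rmorphM rmorph_nat /=; ring.
have q1 j k : cabs (q s j k) <= x.
  rewrite cabs_cexp ler_expR.
  have -> : complex.Re (- (s%:C * (v j + k%:R * d j / (rr j)%:C))) =
     - (s * (complex.Re (v j) + k%:R * complex.Re (d j) / rr j)).
    rewrite -fmorphV -(rmorph_nat (real_complex R)).
    case: (v j) => a b; case: (d j) => a' b' /=.
    by move: (_^-1) => w; ring.
  rewrite lerN2 ler_pM2l//; apply: le_trans (vc j) _.
  by rewrite lerDl divr_ge0 ?mulr_ge0// ltW.
have nz j k : 1 - q s j k != 0.
  rewrite subr_eq0 eq_sym; apply/eqP => e; have := q1 j k.
  by rewrite e cabs1 leNgt x1.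
apply: rb_limit => eps eps0.
pose A := s / (1 - x).
have A0 : 0 < A by rewrite divr_gt0 ?subr_gt0.
have [m hm] := expr_small (ltW xp) x1 (divr_gt0 eps0 A0).
exists (fun j k => \sum_(l < m) s%:C * v j * cexp (- (l.+1%:R * (s%:C * v j))) *
    csemi ((l.+1%:R * s / rr j)%:C * d j) k).
  apply: rb_le (@rb_sum R X p p1 N n _ (index_enum 'I_m) xpredT (fun (l : 'I_m) j k => s%:C * v j * cexp (- (l.+1%:R * (s%:C * v j))) *
    csemi ((l.+1%:R * s / rr j)%:C * d j) k) (fun l : 'I_m => 2 * (s * x ^+ l.+1) * K) (fun l _ => term l)).
  have e (l : 'I_m) : 2 * (s * x ^+ l.+1) * K = 2 * K * (s * x * x ^+ l) by rewrite exprS; ring.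
  have geo : (1 - x) * \sum_(l < m) x ^+ l <= 1.
    have h := subrX1 x m; set S := \sum_(l < m) _ in h *.
    have -> : (1 - x) * S = 1 - x ^+ m by rewrite -[RHS]opprB h; ring.
    by rewrite gerBl exprn_ge0// ltW.
  have sx : s * c * x <= 1 - x.
    have := expR_ge1Dx (s * c).
    have E : expR (s * c) * x = 1 by rewrite /x -expRD subrr expR0.
    move=> h; have : (1 + s * c) * x <= expR (s * c) * x by rewrite ler_pM2r.
    by rewrite E mulrDl mul1r; lra.
  have S0 : 0 <= \sum_(l < m) x ^+ l by apply: sumr_ge0 => l _; rewrite exprn_ge0// ltW.
  have fin : s * x * \sum_(l < m) x ^+ l <= c^-1.
    rewrite -[leRHS]mul1r ler_pdivlMr//; apply: le_trans geo.
    have -> : s * x * (\sum_(l < m) x ^+ l) * c = s * c * x * \sum_(l < m) x ^+ l by ring.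
    exact: ler_wpM2r.
  rewrite (eq_bigr _ (fun l _ => e l)) -mulr_sumr -mulr_sumr.
  by apply: ler_wpM2l fin; rewrite mulr_ge0.
move=> j k _.
have -> : \sum_(l < m) s%:C * v j * cexp (- (l.+1%:R * (s%:C * v j))) *
    csemi ((l.+1%:R * s / rr j)%:C * d j) k =
    s%:C * v j * (q s j k * \sum_(l < m) q s j k ^+ l).
  rewrite 2!mulr_sumr; apply: eq_bigr => l _.
  by rewrite -mulrA qE exprS.
have hs := subrX1 (q s j k) m; set T := \sum_(l < m) _ in hs *.
have -> : T = (1 - q s j k ^+ m) / (1 - q s j k).
  by rewrite -opprB hs -mulNr opprB mulrAC divff ?mul1r// nz.
have -> : s%:C * v j * (q s j k / (1 - q s j k)) -
   s%:C * v j * (q s j k * ((1 - q s j k ^+ m) / (1 - q s j k))) =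
   s%:C * v j * q s j k * q s j k ^+ m / (1 - q s j k) by field.
rewrite 3!cabsM cabsM v1 mulr1 cabs_real gtr0_norm// cabsV cabsX.
have dl : 1 - x <= cabs (1 - q s j k).
  by apply: le_trans (cabs_sub _ _); rewrite cabs1 lerD2l lerN2.
have dp : 0 < cabs (1 - q s j k) by apply: lt_le_trans dl; rewrite subr_gt0.
apply: (@le_trans _ _ (s * x ^+ m / (1 - x))); last first.
  by rewrite mulrAC -/A mulrC -ler_pdivlMr.
apply: ler_pM; rewrite ?invr_ge0 ?(ltW dp)//.
- by rewrite !mulr_ge0 ?exprn_ge0 ?cabs_ge0// ltW.
- rewrite -mulrA ler_pM2l//; apply: (@le_trans _ _ (cabs (q s j k) ^+ m)).
    by rewrite ler_piMl ?exprn_ge0 ?cabs_ge0// (le_trans (q1 j k))// ltW.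
  by apply: lerXn2r; rewrite ?nnegrE ?cabs_ge0// ltW.
- by rewrite lef_pV2 ?posrE// subr_gt0.
Qed.

(** As s tends to 0, s v q/(1 - q) = s v/(exp(s u) - 1) tends to v/u with u = v + k d/rr, and the
    R-bound of the Riemann sums does not depend on s. *)
Lemma rb_resolvent :
  rb X p1 N (fun j k => v j / (v j + k%:R * d j / (rr j)%:C)) (2 * K / c).
Proof.
apply: rb_limit => eps eps0.
(* [W] bounds |u| for all [j] and all k <= N, so one step [s] makes all the products s u small. *)
pose W : R := 1 + \sum_j N%:R / rr j.
have W0 : 0 < W.
  by rewrite ltr_pwDl// sumr_ge0// => j _; rewrite divr_ge0// ltW.
have c18 : 0 < 18 * W by rewrite mulr_gt0.
pose s := Num.min (18 * W)^-1 (eps * c / (18 * W)).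
have s0 : 0 < s by rewrite lt_min invr_gt0 c18 divr_gt0// mulr_gt0.
exists (fun j k => s%:C * v j * (q s j k / (1 - q s j k))); first exact: rb_laplace_sum.
move=> j k kN; set u := v j + k%:R * d j / (rr j)%:C.
have Reu : c <= complex.Re u.
  apply: le_trans (vc j) _; rewrite /u -fmorphV -(rmorph_nat (real_complex R)).
  have : 0 <= k%:R * complex.Re (d j) / rr j by rewrite divr_ge0 ?mulr_ge0// ltW.
  case: (v j) => a b; case: (d j) => a' b' /=.
  by move: (_^-1) => w hw; rewrite !mul0r !subr0; move: hw; rewrite mulr0 subr0 lerDl.
have cu : c <= cabs u by apply: le_trans Reu (le_trans (ler_norm _) (cabs_Re u)).
have u0 : u != 0 by rewrite -cabs_eq0 gt_eqF// (lt_le_trans c0).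
have uW : cabs u <= W.
  apply: le_trans (cabsD _ _) _; rewrite v1 /W lerD2l !cabsM d1 mulr1 cabs_nat cabsV cabs_real.
  rewrite gtr0_norm// (bigD1 j)//=; apply: (@le_trans _ _ (N%:R / rr j)).
    by rewrite ler_pM2r ?invr_gt0// ler_nat.
  by rewrite lerDl sumr_ge0// => i _; rewrite divr_ge0// ltW.
pose h := s%:C * u.
have h0 : h != 0 by rewrite mulf_neq0// -cabs_eq0 cabs_real gtr0_norm// gt_eqF.
have hW : cabs h <= s * W by rewrite cabsM cabs_real gtr0_norm// ler_pM2l.
have s1 : s <= (18 * W)^-1 by rewrite ge_min lexx.
have s2 : s <= eps * c / (18 * W) by rewrite ge_min lexx orbT.
have h18 : cabs h <= 18^-1.
  apply: le_trans hW _; rewrite -ler_pdivlMr// -invfM//.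
have [n0 hh] := div_cexp_sub1 h0 h18.
have qE : q s j k = (cexp h)^-1.
  have E : cexp (- h) * cexp h = 1 by rewrite -cexpD addNr cexp0.
  have z0 : cexp h != 0 by apply/eqP => e; move: E; rewrite e mulr0 => /esym/eqP; rewrite oner_eq0.
  by rewrite /q -/u -/h -[LHS](mulfK z0) E mul1r.
have z0 : cexp h != 0.
  rewrite -cabs_eq0 cabs_cexp gt_eqF// expR_gt0//.
have -> : v j / u - s%:C * v j * (q s j k / (1 - q s j k)) =
    - (v j / u) * (h / (cexp h - 1) - 1).
  by rewrite qE /h; field; rewrite -/h u0 z0 n0.
rewrite cabsM cabsN cabsM cabsV v1 mul1r.
apply: (@le_trans _ _ (c^-1 * (18 * (s * W)))).
  apply: ler_pM; rewrite ?invr_ge0 ?cabs_ge0//.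
    by rewrite lef_pV2 ?posrE// (lt_le_trans c0).
  by apply: le_trans hh _; rewrite ler_pM2l.
rewrite mulrC ler_pdivrMr//.
have -> : 18 * (s * W) = s * (18 * W) by ring.
by rewrite -ler_pdivlMr.
Qed.

End Resolvent.

(** * From random signs to Steinhaus variables *)

Section CircleSymmetry.
Context {R : realType}.
Local Notation mu := (@lebesgue_measure R).
Local Notation bw := (measurableTypeR R).

Lemma lebesgue_measure_shift (c : R) (A : set bw) : measurable A ->
  mu ((fun u : bw => u + c : bw) @^-1` A) = mu A.
Proof.
move=> mA.
have mf : measurable_fun setT (fun u : bw => u + c : bw).
  by apply: (@measurable_funD _ _ _ setT (fun u => u) (fun=> c)).
have mf' : measurable_fun setT (fun u : bw => u - c : bw).
  by apply: (@measurable_funD _ _ _ setT (fun u => u) (fun=> - c)).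
apply/esym.
pose m := pushforward mu (fun u : bw => u + c : bw).
apply: (@lebesgue_measure_unique R m) => // _ [[a b]] _ <-.
rewrite /m /= /pushforward.
rewrite (_ : _ @^-1` _ = [set` `](a - c), (b - c)]]); last first.
  by apply/seteqP; split => u /=; rewrite !in_itv/= ltrBlDr lerBrDr.
rewrite !lebesgue_measure_itv/= !lte_fin ltrD2r; case: ifP => // _.
by rewrite -!EFinB; congr EFin; ring.
Qed.

Lemma uniform_probE (U : set bw) : measurable U ->
  uniform_prob (@ltr01 R) U = mu (U `&` `[0, 1[).
Proof.
move=> mU; rewrite /uniform_prob integral_uniform_pdf.
rewrite (eq_integral (fun=> 1%E)); last first.
  move=> x; rewrite inE/= in_itv/= => -[_ x01].
  by rewrite /uniform_pdf x01 subr0 invr1.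
rewrite integral_cst//=; last exact: measurableI.
rewrite mul1e; apply/eqP; rewrite eq_le; apply/andP; split.
  rewrite (_ : `[0, 1]%classic = `[0, 1[ `|` [set 1] :> set R); last first.
    apply/seteqP; split => x /=; rewrite !in_itv/=.
      by rewrite [x <= 1]le_eqVlt => /andP[-> /predU1P[->|->]]; [right|left].
    by move=> [/andP[-> /ltW ->]//|->]; rewrite ler01 lexx.
  rewrite setIUr.
  apply: (@le_trans _ _ (mu (U `&` `[0%R, 1%R[) + mu (U `&` [set 1%R]))%E).
    by apply: measureU2; exact: measurableI.
  rewrite -[leRHS]adde0 leeD2l//.
  rewrite -(lebesgue_measure_set1 (1 : R)) le_measure// ?inE//.
  by apply: measurableI.
rewrite le_measure// ?inE.
- by apply: measurableI.
- by apply: measurableI.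
- by apply: setIS => x /=; rewrite !in_itv/= => /andP[-> /ltW].
Qed.

(** Cut [0, 1[ at 1/2: the shift moves [0, 1/2[ to [1/2, 1[ and [1/2, 1[ to [1, 3/2[, which
    periodicity brings back to [0, 1/2[. *)
Lemma uniform_prob_half_turn (D : set bw) : measurable D ->
  (forall u : R, D (u + 1) <-> D u) ->
  uniform_prob (@ltr01 R) ((fun u : bw => u + 2^-1 : bw) @^-1` D) =
  uniform_prob (@ltr01 R) D.
Proof.
move=> mD per.
have mf c : measurable_fun setT (fun u : bw => u + c : bw).
  by apply: (@measurable_funD _ _ _ setT (fun u => u) (fun=> c)).
have mp c (A : set bw) : measurable A -> measurable ((fun u : bw => u + c : bw) @^-1` A).
  by move=> mA; rewrite -[X in measurable X]setTI; exact: mf.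
rewrite !uniform_probE//; last exact: mp.
have cut (V : set bw) : measurable V ->
    mu (V `&` `[0, 1[) = (mu (V `&` `[0%R, (2^-1)%R[) + mu (V `&` `[(2^-1)%R, 1%R[))%E.
  move=> mV; rewrite -measureU.
  - congr (mu _); rewrite -setIUr; congr (_ `&` _).
    apply/seteqP; split => x /=; rewrite !in_itv/=.
      by case: (ltP x 2^-1) => h /andP[h1 h2]; [left|right]; apply/andP; split => //; lra.
    by move=> [] /andP[h1 h2]; apply/andP; split; lra.
  - exact: measurableI.
  - exact: measurableI.
  - by apply/seteqP; split => // x /= [] [_ +] [_ +]; rewrite !in_itv/=; lra.
rewrite cut ?cut//; last exact: mp.
rewrite addeC; congr (_ + _)%E.
  transitivity (mu (D `&` `[1, 3/2[)).
    rewrite -(lebesgue_measure_shift 2^-1 (A := D `&` `[1, 3/2[)); last exact: measurableI.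
    congr (mu _); apply/seteqP; split => x /= [Dx]; rewrite !in_itv/= => h; split => //;
      by lra.
  rewrite -(lebesgue_measure_shift 1 (A := D `&` `[1, 3/2[)); last exact: measurableI.
  congr (mu _); apply/seteqP; split => x /= [/per Dx]; rewrite !in_itv/= => h; split => //;
    by lra.
rewrite -(lebesgue_measure_shift 2^-1 (A := D `&` `[2^-1, 1[)); last exact: measurableI.
congr (mu _); apply/seteqP; split => x /= [Dx]; rewrite !in_itv/= => h; split => //;
  by lra.
Qed.

Definition circle (u : R) : bw * bw := (cos (2 * pi * u), sin (2 * pi * u)).

Lemma measurable_circle : measurable_fun setT (circle : bw -> bw * bw).
Proof.
have h (f : R -> R) : continuous f -> continuous (fun u : R => f (2 * pi * u)).
  by move=> cf u; apply: continuous_comp; [exact: mulrl_continuous|exact: cf].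
apply/measurable_fun_pairP; split.
  exact: (continuous_measurable_fun (h _ (@continuous_cos R))).
exact: (continuous_measurable_fun (h _ (@continuous_sin R))).
Qed.

Definition turn (b : bool) (v : bw * bw) : bw * bw :=
  ((-1) ^+ b * v.1, (-1) ^+ b * v.2).

Lemma measurable_turn b : measurable_fun setT (turn b).
Proof.
apply/measurable_fun_pairP; split; apply: measurable_funM => //.
Qed.

Lemma circle_turn b (B : set (bw * bw)) : measurable B ->
  uniform_prob (@ltr01 R) [set u : R | B (turn b (circle u))] =
  uniform_prob (@ltr01 R) [set u : R | B (circle u)].
Proof.
move=> mB; case: b; last first.
  by congr uniform_prob; apply/seteqP; split => u; rewrite /= /turn !expr0 !mul1r.
have mD : measurable (circle @^-1` B : set bw).
  by rewrite -[X in measurable X]setTI; exact: measurable_circle.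
rewrite -[RHS](@uniform_prob_half_turn (circle @^-1` B)) //.
  congr uniform_prob; apply/seteqP; split => u /=; rewrite /turn /circle /= !expr1 !mulN1r;
  have -> : 2 * pi * (u + 2^-1) = 2 * pi * u + pi :> R by field.
    by rewrite cosDpi sinDpi.
  by rewrite cosDpi sinDpi.
move=> u; rewrite /circle /=.
have -> : 2 * pi * (u + 1) = 2 * pi * u + pi *+ 2 :> R by rewrite mulrDr mulr1 mulr_natl.
by rewrite cosD2pi sinD2pi.
Qed.
End CircleSymmetry.

Lemma cabs_le_ReIm (R : realType) (a b : R) : cabs (a +i* b) <= `|a| + `|b|.
Proof.
rewrite (_ : a +i* b = a%:C + 'i * b%:C); last by simpc.
by apply: le_trans (cabsD _ _) _; rewrite cabsM !cabs_real /cabs normc_def /= expr0n expr1n add0r sqrtr1 mul1r.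
Qed.

Lemma ler_dist_rnorm (R : realType) (E : normedModType R[i]) (u v : E) :
  `|rnorm u - rnorm v| <= rnorm (u - v).
Proof.
have h (a b : E) : rnorm a - rnorm b <= rnorm (a - b).
  by rewrite lerBlDr -{1}(subrK b a) ler_rnormD.
by rewrite ler_norml lerNl opprB h andbT -(rnormN (u - v)) opprB h.
Qed.

Section NormMeasurable.
Context {R : realType} {d : measure_display} {T : measurableType d}
  {E : normedModType R[i]}.

(** [E] carries no sigma-algebra, so the norm is not composed with measurable maps into [E].
    Rounding the coefficients to multiples of 2^-k leaves a function of countably many integer
    tuples, and these functions converge pointwise. *)
Lemma measurable_rnorm_sum n (a b : 'I_n -> T -> R) (x : 'I_n -> E) :
  (forall j, measurable_fun setT (a j)) -> (forall j, measurable_fun setT (b j)) ->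
  measurable_fun setT (fun w => rnorm (\sum_(j < n) (a j w +i* b j w) *: x j)).
Proof.
move=> ma mb.
pose q k (r : R) : int := Num.floor (2 ^+ k * r).
pose e k (z : {ffun 'I_n -> int * int}) :=
  rnorm (\sum_(j < n) (((z j).1%:~R / 2 ^+ k) +i* ((z j).2%:~R / 2 ^+ k)) *: x j).
pose Q k w : {ffun 'I_n -> int * int} := [ffun j => (q k (a j w), q k (b j w))].
have mq k (f : T -> R) (z : int) : measurable_fun setT f ->
    measurable [set w | q k (f w) = z].
  move=> mf; rewrite (_ : [set w | _] = f @^-1` [set` `[z%:~R / 2 ^+ k, (z + 1)%:~R / 2 ^+ k[]).
    by rewrite -[X in measurable X]setTI; exact: mf.
  apply/seteqP; split => w /=; rewrite in_itv/= ler_pdivrMr ?exprn_gt0// ltr_pdivlMr ?exprn_gt0//.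
    by move=> <-; rewrite ![_ * 2 ^+ k]mulrC; exact: floor_itv.
  by rewrite ![_ * 2 ^+ k]mulrC; exact: floor_def.
apply: (@measurable_fun_cvg _ _ _ setT (fun k w => e k (Q k w))).
  move=> k _ B mB; rewrite setTI.
  pose F z : set T := [set w | Q k w = z /\ B (e k z)].
  rewrite (_ : _ @^-1` B = \bigcup_z F z).
    apply: countable_bigcupT_measurable => // z.
    have [Bz|nBz] := pselect (B (e k z)); last first.
      by rewrite (_ : F z = set0)//; apply/seteqP; split => // w [].
    rewrite (_ : F z = \bigcap_(j in [set: 'I_n]) ([set w | q k (a j w) = (z j).1] `&` [set w | q k (b j w) = (z j).2])).
      apply: fin_bigcap_measurable => // j _.
      by apply: measurableI; exact: mq.
    apply/seteqP; split => w.
      by move=> [<- _] j _; rewrite /Q /= ffunE.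
    move=> h; split => //; apply/ffunP => j; rewrite ffunE.
    by have [/= -> ->] := h j Logic.I; case: (z j).
  apply/seteqP; split => w /=; first by exists (Q k w).
  by move=> [z _ [/= -> ]].
move=> w _; pose c : R := \sum_(j < n) 2 * rnorm (x j).
have close k : `|e k (Q k w) - rnorm (\sum_(j < n) (a j w +i* b j w) *: x j)| <= c * 2^-1 ^+ k.
  have fl (r : R) : `|(q k r)%:~R / 2 ^+ k - r| <= 2^-1 ^+ k.
    have /andP[h1 h2] := floor_itv (2 ^+ k * r).
    rewrite -/(q k r) in h1 h2; have t0 : 0 < 2 ^+ k :> R by rewrite exprn_gt0.
    rewrite (_ : _ - r = ((q k r)%:~R - 2 ^+ k * r) / 2 ^+ k); last first.
      by field; rewrite gt_eqF.
    rewrite normrM normfV (gtr0_norm t0) ler_pdivrMr// -exprMn mulVf// expr1n.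
    rewrite ler0_norm ?subr_le0// opprB lerBlDl.
    by apply: le_trans (ltW h2) _; rewrite rmorphD rmorph1.
  apply: le_trans (ler_dist_rnorm _ _) _; rewrite -sumrB.
  under eq_bigr => j _.
    rewrite -scalerBl ffunE /=.
    rewrite (_ : _ - _ = ((q k (a j w))%:~R / 2 ^+ k - a j w) +i*
       ((q k (b j w))%:~R / 2 ^+ k - b j w)); last by simpc.
    over.
  apply: le_trans (rnorm_sum _ _ _) _; rewrite mulr_suml; apply: ler_sum => j _.
  rewrite rnormZ mulrAC; apply: ler_wpM2r (rnorm_ge0 _) _ _ _.
  rewrite -[complex.Re _]/(cabs _) mulr_natl mulr2n.
  apply: le_trans (lerD (fl (a j w)) (fl (b j w))).
  exact: cabs_le_ReIm.
have cv0 : (fun k => c * 2^-1 ^+ k) @ \oo --> (0 : R).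
  by apply: cvg_geometric; rewrite ger0_norm; lra.
set l := rnorm _ in close *.
apply: (@squeeze_cvgr _ _ _ _ (fun k => l - c * 2^-1 ^+ k) (fun k => l + c * 2^-1 ^+ k)).
- by apply: nearW => k; have := close k; rewrite ler_distl.
- by rewrite -[X in _ --> X]subr0; apply: cvgB => //; exact: cvg_cst.
- by rewrite -[X in _ --> X]addr0; apply: cvgD => //; exact: cvg_cst.
Qed.
End NormMeasurable.

Section SteinhausSymmetry.
Context {R : realType} {d : measure_display} {Omega : measurableType d}.
Variables (P : probability Omega R) (n : nat) (eps : 'I_n -> Omega -> R[i]).
Hypothesis rad_eps : rademacher P eps.
Local Notation bw := (measurableTypeR R).

Definition rectangle (B : 'I_n -> set (bw * bw)) : set ('I_n -> bw * bw) :=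
  [set v | forall j, B j (v j)].

Definition rectangles : set (set ('I_n -> bw * bw)) :=
  [set A | exists2 B, (forall j, measurable (B j)) & A = rectangle B].

Local Notation V := (g_sigma_algebraType rectangles).

Lemma rectanglesI : setI_closed rectangles.
Proof.
move=> _ _ [B mB ->] [B' mB' ->]; exists (fun j => B j `&` B' j).
  by move=> j; exact: measurableI.
by apply/seteqP; split => [v [h1 h2] j|v h]; [split|split => j; have [] := h j].
Qed.

Lemma rectanglesT : rectangles setT.
Proof. by exists (fun=> setT) => //; apply/seteqP; split. Qed.

Lemma measurable_coord (j : 'I_n) : measurable_fun setT (fun v : V => v j).
Proof.
move=> _ B mB; rewrite setTI; apply: sub_sigma_algebra.
exists (fun i => if i == j then B else setT); first by move=> i; case: ifP.
apply/seteqP; split => [v Bv i|v /(_ j)]; last by rewrite eqxx.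
by case: eqP => [->|].
Qed.

Definition flipped (x : cube n) (w : Omega) : V :=
  fun j => turn (x j) (Re_Im (eps j) w).

Lemma flipped_rectangle x B : flipped x @^-1` rectangle B =
  \bigcap_j (Re_Im (eps j) @^-1` (turn (x j) @^-1` B j)).
Proof. by apply/seteqP; split => [w h j _|w h j]; [exact: h|exact: (h j Logic.I)]. Qed.

Lemma measurable_turn_preimage b (B : set (bw * bw)) : measurable B ->
  measurable (turn b @^-1` B).
Proof. by move=> mB; rewrite -[X in measurable X]setTI; exact: measurable_turn. Qed.

Lemma measurable_flipped x : measurable_fun setT (flipped x).
Proof.
apply: (@measurability _ _ Omega V setT _ rectangles) => // _ [_ [B mB ->] <-].
rewrite setTI flipped_rectangle; apply: fin_bigcap_measurable => // j _.
rewrite -[X in measurable X]setTI; apply: (rad_eps.1 j).1 => //.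
exact: measurable_turn_preimage.
Qed.

HB.instance Definition _ x := isMeasurableFun.Build _ _ _ _ (flipped x) (measurable_flipped x).

(** Rectangles are closed under intersection and generate the sigma-algebra. On them independence
    gives products, each factor of which is invariant under a half turn. *)
Lemma flipped_law x (A : set V) : measurable A ->
  pushforward P (flipped x) A = pushforward P (flipped [ffun=> false]) A.
Proof.
move=> mA; apply: (@measure_unique _ _ V rectangles (fun=> setT)) => //.
- exact: rectanglesI.
- by move=> _; exact: rectanglesT.
- by apply/seteqP; split => // v _; exists 0%N.
- move=> _ [B mB ->]; 
  apply: (etrans (congr1 P (flipped_rectangle x B))).
  apply: etrans _ (esym (congr1 P (flipped_rectangle _ B))).
  rewrite !rad_eps.2; [|by move=> j; exact: measurable_turn_preimage..].
  apply: eq_bigr => j _.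
  have law b : P (Re_Im (eps j) @^-1` (turn b @^-1` B j)) =
      uniform_prob (@ltr01 R) [set u | B j (circle u)].
    rewrite (rad_eps.1 j).2; last exact: measurable_turn_preimage.
    exact: circle_turn.
  by rewrite !law.
- move=> _; apply: (@le_lt_trans _ _ 1%E); last exact: ltry.
  by apply: probability_le1; rewrite preimage_setT.
Qed.

Section Norm.
Context {E : normedModType R[i]}.
Variable u : 'I_n -> E.

Let phi (v : V) : \bar R := (rnorm (\sum_(j < n) ((v j).1 +i* (v j).2) *: u j) `^ 2)%:E.

Let mphi : measurable_fun setT phi.
Proof.
apply/measurable_EFinP; apply: (measurableT_comp (measurable_powR 2)).
by apply: measurable_rnorm_sum => j;
  [apply: (measurableT_comp measurable_fst)|apply: (measurableT_comp measurable_snd)];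
  exact: measurable_coord.
Qed.

Let phi_flipped x w : phi (flipped x w) =
  (rnorm (\sum_(j < n) sgn R x j *: (eps j w *: u j)) `^ 2)%:E.
Proof.
congr (rnorm _ `^ 2)%:E; apply: eq_bigr => j _; rewrite scalerA; congr (_ *: _).
rewrite /flipped /turn /Re_Im /sgn /=; case: (x j); case: (eps j w) => a b.
  by rewrite !expr1 !mulN1r /=; simpc.
by rewrite !expr0 !mul1r.
Qed.

Lemma measurable_steinhaus x : measurable_fun setT
  (fun w => rnorm (\sum_(j < n) sgn R x j *: (eps j w *: u j)) `^ 2).
Proof.
apply/measurable_EFinP; rewrite (_ : _ \o _ = phi \o flipped x).
  by apply: measurableT_comp => //; exact: measurable_flipped.
by apply/funext => w; rewrite /= phi_flipped.
Qed.

Lemma measurable_steinhaus_mean : measurable_fun setT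
  (fun w => mean (fun x => rnorm (\sum_(j < n) sgn R x j *: (eps j w *: u j)) `^ 2)).
Proof.
apply: measurable_funM => //; apply: measurable_sum => x; exact: measurable_steinhaus.
Qed.

Lemma steinhaus_flip x :
  (\int[P]_w (rnorm (\sum_(j < n) sgn R x j *: (eps j w *: u j)) `^ 2)%:E =
   \int[P]_w (rnorm (\sum_(j < n) eps j w *: u j) `^ 2)%:E)%E.
Proof.
have key y : (\int[P]_w (rnorm (\sum_(j < n) sgn R y j *: (eps j w *: u j)) `^ 2)%:E =
    \int[pushforward P (flipped y)]_v phi v)%E.
  have phi0 : {in [set: V], forall v, 0 <= phi v}%E by move=> v _; rewrite lee_fin powR_ge0.
  rewrite (@ge0_integral_pushforward _ _ Omega V R (flipped y) (@measurable_flipped y) P setT phi measurableT mphi phi0).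
  by apply: eq_integral => w _; rewrite /= phi_flipped.
transitivity (\int[P]_w (rnorm (\sum_(j < n) sgn R [ffun=> false] j *: (eps j w *: u j)) `^ 2)%:E)%E.
  by rewrite !key; apply: eq_measure_integral => A mA _; exact: flipped_law.
apply: eq_integral => w _; congr (rnorm _ `^ 2)%:E; apply: eq_bigr => j _.
by rewrite /sgn ffunE expr0 scale1r.
Qed.

Lemma steinhaus_mean :
  (\int[P]_w (rnorm (\sum_(j < n) eps j w *: u j) `^ 2)%:E =
   \int[P]_w (mean (fun x => rnorm (\sum_(j < n) sgn R x j *: (eps j w *: u j)) `^ 2))%:E)%E.
Proof.
under [RHS]eq_integral do rewrite /mean EFinM -sumEFin.
have c0 : 0 <= (2 ^+ n)^-1 :> R by rewrite invr_ge0 exprn_ge0.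
rewrite ge0_integralZl//; first last.
- by move=> w _; apply: sume_ge0 => x _; rewrite lee_fin powR_ge0.
- apply: emeasurable_sum => x; apply/measurable_EFinP; exact: measurable_steinhaus.
rewrite ge0_integral_sum//; first last.
- by move=> x w _; rewrite lee_fin powR_ge0.
- by move=> x; apply/measurable_EFinP; exact: measurable_steinhaus.
under eq_bigr do rewrite steinhaus_flip.
rewrite ge0_sume_distrr; last by move=> x _; apply: integral_ge0 => w _; rewrite lee_fin powR_ge0.
rewrite -ge0_sume_distrl; last by move=> x _; rewrite lee_fin.
have e1 : \sum_(x : cube n) (2 ^+ n)^-1 = 1 :> R.
  by rewrite -[RHS](@mean_cst R n 1) /mean mulr_sumr; apply: eq_bigr => x _; rewrite mulr1.
by rewrite sumEFin e1 mul1e.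
Qed.

End Norm.
End SteinhausSymmetry.

Section Transfer.
Context {R : realType} {E : normedModType R[i]}.

(** For each outcome w the bound for signs is applied to the vectors eps_j(w) u_j, the scalars
    commuting with the linear T_j. Integrating the squares over w and using the symmetry of the
    Steinhaus law on both sides removes the signs. *)
Lemma R_bounded_by_radnorm (F : set (E -> E)) (C : R) : 0 <= C ->
  F `<=` bounded_operator ->
  (forall n (T : 'I_n -> E -> E) (u : 'I_n -> E), (forall j, F (T j)) ->
     radnorm (fun j => T j (u j)) <= C * radnorm u) ->
  R_bounded_by F C.
Proof.
move=> C0 Fb h; split => // n T u d Omega P eps FT hr.
pose I (v : 'I_n -> E) := (\int[P]_w (rnorm (\sum_(j < n) eps j w *: v j) `^ 2)%:E)%E.
have LpE (v : 'I_n -> E) : Lp_norm P 2 (fun w => \sum_(j < n) eps j w *: v j) = (I v `^ 2^-1)%E.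
  rewrite /Lp_norm Lnorm.unlock; congr (_ `^ _)%E; apply: eq_integral => w _ /=.
  by rewrite ger0_norm ?rnorm_ge0.
have I0 (v : 'I_n -> E) : (0 <= I v)%E by apply: integral_ge0 => w _; rewrite lee_fin powR_ge0.
have IT : (I (fun j => T j (u j)) <= (C `^ 2)%:E * I u)%E.
  rewrite /I !steinhaus_mean// -ge0_integralZl//; first last.
  - by rewrite lee_fin powR_ge0.
  - by move=> w _; rewrite lee_fin mean_ge0// => x; exact: powR_ge0.
  - apply/measurable_EFinP; exact: (measurable_steinhaus_mean hr).
  apply: ge0_le_integral => //.
  - by move=> w _; rewrite lee_fin mean_ge0// => x; exact: powR_ge0.
  - apply/measurable_EFinP; exact: (measurable_steinhaus_mean hr).
  - apply/measurable_EFinP; apply: measurable_funM => //.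
    exact: (measurable_steinhaus_mean hr).
  move=> w _; rewrite lee_fin -!rad_powR -powRM ?rad_ge0//.
  rewrite ge0_ler_powR ?nnegrE ?mulr_ge0 ?rad_ge0//.
  rewrite (@eq_rad _ _ _ _ (fun j => T j (eps j w *: u j))); first exact: h.
  by move=> j; rewrite linearZ_fun//; exact: (Fb _ (FT j)).1.
rewrite !LpE -[C in C%:E]powR2K// -poweR_EFin -poweRM ?lee_fin ?powR_ge0//.
apply: gt0_ler_poweR => //; rewrite ?in_itv/= ?leey ?andbT//.
by rewrite mule_ge0// lee_fin powR_ge0.
Qed.

End Transfer.

(** * Analyticity and sectoriality *)

Lemma UMD_rb_csemi (R : realType) (X : completeNormedModType R[i]) (p : R) (p1 : 1 < p) :
  UMD X -> exists rho K : R, [/\ 0 < rho, 0 <= K &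
    forall N n (z : 'I_n -> R[i]), (forall j, 0 < complex.Re (z j)) ->
      (forall j, 2 * `|complex.Im (z j)| <= rho * complex.Re (z j)) ->
      rb X p1 N (fun j => csemi (z j)) K].
Proof.
move=> /(UMD_mart p1)[C [C2 [C0 C20 hX hE]]].
pose M := @stein_cst R p C C2; pose B := C `^ p^-1.
pose K0 := sect_cst M B; pose K2 := power_cst K0 M.
have B0 : 0 <= B by exact: powR_ge0.
have M0 : 0 <= M by rewrite addr_ge0 ?mulr_ge0 ?powR_ge0 ?sqrtr_ge0.
have K00 : 0 <= K0 by rewrite addr_ge0 ?mulr_ge0.
have K20 : 0 <= K2 by exact: power_cst_ge0.
have e0 : 0 < expR 1 :> R by exact: expR_gt0.
(* This gives rho K2 e = K2/(2 (K2 + 1)) <= 1/2, the ratio of the Taylor series. *)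
pose rho := (2 * (K2 + 1) * expR 1)^-1.
have rho0 : 0 < rho by rewrite invr_gt0 !mulr_gt0// ltr_wpDl.
have rho1 : rho * K2 * expR 1 <= 2^-1.
  rewrite -mulrA mulrC ler_pdivrMr; last by rewrite -invr_gt0.
  by have h := e0; lra.
exists rho, (sector_cst M); split => //.
  by rewrite mulr_ge0// addr_ge0// mulr_ge0.
move=> N n z.
have hS m (t : 'I_m -> R) : (forall j, 0 <= t j) -> rb X p1 N (fun j => semi (t j)) M.
  exact: rb_semi C0 C20 hX (hE N) _ _.
have hD m (idx : 'I_m -> nat) (tau : R) a : 0 < tau -> (0 < a)%N ->
    rb X p1 N (fun j k => semi (2 ^+ idx j * tau) k ^+ a * (1 - semi (2 ^+ idx j * tau) k))
      (K2 / a%:R).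
  move=> tau0 a0; have t0 j : 0 <= 2 ^+ idx j * tau by rewrite mulr_ge0 ?exprn_ge0 ?ltW.
  apply: (rb_power_difference K00 M0) => //.
  - by move=> j k; exact: semi_le1.
  - move=> l; apply: rb_ext (hS _ (fun j => l%:R * (2 ^+ idx j * tau)) _) => [j k _|j].
      exact: semiM.
    by rewrite mulr_ge0.
  - move=> w w0 w1; apply: (rb_difference_quotient M0 B0) => // t L theta f t1 tS th.
    exact: (semi_transform L f hX C0 t1 tS th).
exact: (rb_csemi M0 K20 hS hD rho0 rho1).
Qed.

Section MulopBound.
Context {R : realType} {X : normedModType R[i]} {p : R} (p1 : 1 < p) {N : nat}.
Local Notation E := (Lp_cube X p1 N).

(** A crude bound from the number of Walsh functions and a pointwise estimate. It grows with [N] and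
    serves qualitative claims for fixed [N] only. *)
Definition mulop_cst : R := #|{set 'I_N}|%:R * (2 ^+ N) `^ p^-1.

Lemma mulop_cst_ge0 : 0 <= mulop_cst.
Proof. by rewrite mulr_ge0// powR_ge0. Qed.

Lemma rnorm_eval (f : E) x : rnorm (f x) <= (2 ^+ N) `^ p^-1 * rnorm f.
Proof.
have p0 : 0 < p by exact: lt_trans p1.
have N0 : 0 < 2 ^+ N :> R by rewrite exprn_gt0.
rewrite rnorm_Lp /Lp_cube_norm -powRM ?(ltW N0) ?Lp_cube_mean_ge0//.
rewrite -[leLHS](powRK_inv p0) ?rnorm_ge0//.
apply: ler_powRl; [by rewrite invr_ge0 ltW|exact: powR_ge0|].
rewrite /Lp_cube_mean [leRHS]mulrA mulfV ?gt_eqF// mul1r (bigD1 x)//= lerDl.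
by apply: sumr_ge0 => y _; exact: powR_ge0.
Qed.

Lemma rnorm_mulop (m : nat -> R[i]) b (f : E) : 0 <= b ->
  (forall k, (k <= N)%N -> cabs (m k) <= b) -> rnorm (mulop m f) <= b * mulop_cst * rnorm f.
Proof.
move=> b0 mb; have p0 : 0 < p by exact: lt_trans p1.
have N0 : 0 < 2 ^+ N :> R by rewrite exprn_gt0.
pose W := (2 ^+ N) `^ p^-1 * rnorm f.
have W0 : 0 <= W by rewrite mulr_ge0 ?powR_ge0 ?rnorm_ge0.
have walsh1 A x : complex.Re `|walsh A x : R[i]| = 1.
  by rewrite /walsh normr_prod big1 // => i _; rewrite normrX normrN1 expr1n.
have coefW A : rnorm (walsh_coef f A) <= W.
  rewrite /walsh_coef rnormZ -[complex.Re _]/(cabs _) cabsV cabsX cabs_nat.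
  rewrite ler_pdivrMl//; apply: le_trans (rnorm_sum _ _ _) _.
  rewrite (_ : _ * W = \sum_(x : cube N) W).
    by apply: ler_sum => x _; rewrite rnormZ walsh1 mul1r; exact: rnorm_eval.
  by rewrite sumr_const card_cube -[W *+ _]mulr_natl natrX.
pose b' := b * #|{set 'I_N}|%:R * W.
have b'0 : 0 <= b'.
  by rewrite /b'; apply: mulr_ge0 W0; apply: mulr_ge0 => //; exact: ler0n.
have pt x : rnorm (mulop m f x) <= b'.
  rewrite /mulop /mult ffunE; apply: le_trans (rnorm_sum _ _ _) _.
  rewrite (_ : b' = \sum_(A : {set 'I_N}) b * W); last first.
    by rewrite sumr_const -[(b * W) *+ _]mulr_natl mulrA [_ * b]mulrC.
  apply: ler_sum => A _; rewrite rnormZ -[complex.Re _]/(cabs _) cabsM.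
  rewrite [cabs (walsh _ _)]walsh1 mulr1; apply: ler_pM => //; rewrite ?cabs_ge0 ?rnorm_ge0//.
  by apply: mb; rewrite -[leqRHS]card_ord max_card.
rewrite (_ : b * mulop_cst * _ = b'); last by rewrite /b' /W /mulop_cst !mulrA.
rewrite rnorm_Lp /Lp_cube_norm -[leRHS](powRK_inv p0)//.
apply: ler_powRl; [by rewrite invr_ge0 ltW|exact: Lp_cube_mean_ge0|].
rewrite -[leRHS](@mean_cst R N); apply: ler_mean => x.
by apply: ler_powRl => //; [exact: ltW|exact: rnorm_ge0].
Qed.

Lemma mulop_bounded (m : nat -> R[i]) : bounded_operator (mulop m : E -> E).
Proof.
split; first exact: mulop_linear.
exists ((\sum_(k < N.+1) cabs (m k)) * mulop_cst) => f.
apply: rnorm_mulop => [|k kN]; first by apply: sumr_ge0 => k _; exact: cabs_ge0.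
rewrite (bigD1 (Ordinal (kN : (k < N.+1)%N)))//= lerDl.
by apply: sumr_ge0 => i _; exact: cabs_ge0.
Qed.

End MulopBound.

Section SectorGeometry.
Context {R : realType}.

(** The inequality is strict at angle 0 and continuous; the cap pi/4 keeps the angle below pi/2. *)
Lemma small_angle (rho : R) : 0 < rho -> exists2 theta : R, 0 < theta < pi / 2 &
  forall phi, `|phi| < theta -> 0 < cos phi /\ 2 * `|sin phi| <= rho * cos phi.
Proof.
move=> rho0; pose g (x : R) := rho * cos x - 2 * `|sin x|.
have cg : continuous g.
  move=> x; apply: cvgB.
    by apply: cvgMr; exact: continuous_cos.
  apply: cvgMr; apply: cvg_norm; exact: continuous_sin.
have : \forall x \near (0 : R), 0 < g x.
  apply: (cvgr_gt _ (cg 0)).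
  by rewrite /g cos0 sin0 normr0 mulr1 mulr0 subr0.
move=> /nbhs_ballP[e /= e0 he].
have pi0 := @pi_gt0 R.
exists (Num.min e (pi / 4)).
  rewrite lt_min e0 divr_gt0//= gt_min; apply/orP; right.
  by rewrite ltr_pM2l// ltf_pV2 ?posrE// ltr_nat.
move=> phi; rewrite lt_min => /andP[phie _].
have : 0 < g phi by apply: he; rewrite /ball /= sub0r normrN.
rewrite /g subr_gt0 => h; split; last exact: ltW.
rewrite -(pmulr_rgt0 _ rho0); apply: le_lt_trans h.
by rewrite mulr_ge0.
Qed.

Lemma sector_Re (theta : R) (z : R[i]) : (forall phi, `|phi| < theta -> 0 < cos phi) ->
  sector theta z -> 0 < complex.Re z.
Proof. by move=> h [r [phi [r0 /h c0 ->]]] /=; rewrite mulr_gt0. Qed.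

Lemma sector_Im (theta rho : R) (z : R[i]) :
  (forall phi, `|phi| < theta -> 2 * `|sin phi| <= rho * cos phi) ->
  sector theta z -> 2 * `|complex.Im z| <= rho * complex.Re z.
Proof.
move=> h [r [phi [r0 /h c0 ->]]] /=.
by rewrite normrM (gtr0_norm r0) mulrCA [leRHS]mulrCA ler_pM2l.
Qed.

End SectorGeometry.

Section AnalyticExtension.
Context {R : realType} {X : normedModType R[i]} {p : R} (p1 : 1 < p) {N : nat}.
Local Notation E := (Lp_cube X p1 N).
Local Notation S := (fun z => mulop (csemi z) : E -> E).
Local Notation W := (@mulop_cst R p N).

Lemma csemiD (z w : R[i]) k : csemi (z + w) k = csemi z k * csemi w k.
Proof. by rewrite !csemiE mulrDr opprD cexpD. Qed.

Lemma cabs_csemi (z : R[i]) k : 0 <= complex.Re z -> cabs (csemi z k) <= 1.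
Proof. by move=> z0; rewrite /csemi cabsM cabs_cis mulr1 semi_le1. Qed.

Lemma csemi_real (t : R) k : csemi t%:C k = semi t k.
Proof. by rewrite /csemi /= oppr0 mul0r /cis cos0 sin0 mulr1. Qed.

Lemma mulopB m m' (f : E) : mulop m f - mulop m' f = mulop (fun k => m k - m' k) f.
Proof. by rewrite /mulop multBl. Qed.

(** The derivative is - Delta T(z); the remainder is that of finitely many exponentials, one for
    each k <= N. *)
Lemma mulop_csemi_holomorphic (D : set R[i]) : (forall z, D z -> 0 < complex.Re z) ->
  operator_holomorphic D S.
Proof.
move=> DRe z Dz; exists (mulop (fun k => - k%:R * csemi z k)).
split; first exact: mulop_bounded.
move=> e e0.
have W0 : 0 <= W by exact: mulop_cst_ge0.
pose Q := 9 * N%:R ^+ 2 * W + N%:R + 1.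
have Q0 : 0 < Q by rewrite ltr_wpDl// addr_ge0// !mulr_ge0.
pose delta := Num.min Q^-1 (e / Q).
exists delta; split; first by rewrite lt_min invr_gt0 Q0 divr_gt0.
move=> h hd Dzh f.
have {hd} : cabs h < delta by rewrite -ltcR -cabsE.
rewrite lt_min => /andP[h1 h2].
have Nh : N%:R * cabs h <= 1.
  have : Q * cabs h <= 1 by rewrite -ler_pdivlMl// mulr1 ltW.
  apply: le_trans; apply: ler_wpM2r; first exact: cabs_ge0.
  by rewrite /Q addrAC lerDr addr_ge0// !mulr_ge0.
rewrite [X in X - _]mulopB.
rewrite -[X in _ - X](@multZl R X N h).
rewrite [X in `|X| <= _]mulopB.
rewrite !rnormE cabsE -!rmorphM lecR.
apply: (@le_trans _ _ (9 * N%:R ^+ 2 * cabs h ^+ 2 * W * rnorm f)).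
  apply: rnorm_mulop => [|k kN]; first by rewrite !mulr_ge0// cabs_ge0.
  rewrite csemiD (_ : _ - _ = csemi z k * (csemi h k - 1 - (- (k%:R * h)))); last first.
    by ring.
  rewrite cabsM -[leRHS]mul1r; apply: ler_pM; rewrite ?cabs_ge0//.
    by apply: cabs_csemi; rewrite ltW// DRe.
  have kh : cabs (- (k%:R * h)) <= N%:R * cabs h.
    by rewrite cabsN cabsM cabs_nat ler_wpM2r ?cabs_ge0// ler_nat.
  rewrite csemiE; apply: le_trans (cexp_second_order (le_trans kh Nh)) _.
  rewrite -mulrA -exprMn ler_pM2l//; apply: lerXn2r kh; rewrite nnegrE ?cabs_ge0//.
  by rewrite mulr_ge0 ?cabs_ge0.
apply: ler_wpM2r; first exact: rnorm_ge0.
have h0 := cabs_ge0 h.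
have hQ : Q * cabs h <= e by rewrite mulrC -ler_pdivlMr// ltW.
apply: le_trans (ler_wpM2r h0 hQ).
rewrite (_ : 9 * _ * _ * W = 9 * N%:R ^+ 2 * W * cabs h * cabs h); last by ring.
apply: ler_wpM2r => //; apply: ler_wpM2r => //.
by rewrite /Q -addrA lerDl addr_ge0.
Qed.

Lemma mulop_csemi_continuous0 (D : set R[i]) (f : E) : (forall z, D z -> 0 < complex.Re z) ->
  S z f @[z --> within D (nbhs (0 : (R[i])^o))] --> f.
Proof.
move=> DRe; apply/cvgrPdist_le => e e0.
have W0 : 0 <= W by exact: mulop_cst_ge0.
have [eR eE] : e \is Num.real /\ e = (complex.Re e)%:C.
  by split; [exact: gtr0_real|rewrite RRe_real// gtr0_real].
have {}e0 : 0 < complex.Re e by rewrite -ltcR -eE.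
pose Q := 10 * N%:R * W * rnorm f + N%:R + 1.
have Q0 : 0 < Q by rewrite ltr_wpDl// addr_ge0// !mulr_ge0// rnorm_ge0.
pose delta := Num.min Q^-1 (complex.Re e / Q).
have d0 : 0 < delta by rewrite lt_min invr_gt0 Q0 divr_gt0.
apply/nbhs_ballP; exists delta%:C => /=; first by rewrite ltcR.
move=> z; rewrite /ball /= sub0r normrN cabsE ltcR => zd Dz.
move: zd; rewrite lt_min => /andP[h1 h2].
have Nh : N%:R * cabs z <= 1.
  have : Q * cabs z <= 1 by rewrite -ler_pdivlMl// mulr1 ltW.
  apply: le_trans; apply: ler_wpM2r; first exact: cabs_ge0.
  by rewrite /Q addrAC lerDr addr_ge0// !mulr_ge0// rnorm_ge0.
rewrite eE rnormE lecR -[X in rnorm (X - _)](@mult1 R X N).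
rewrite [X in rnorm X]mulopB.
apply: (@le_trans _ _ (10 * (N%:R * cabs z) * W * rnorm f)).
  apply: rnorm_mulop => [|k kN]; first by rewrite !mulr_ge0// cabs_ge0.
  have kh : cabs (- (k%:R * z)) <= N%:R * cabs z.
    by rewrite cabsN cabsM cabs_nat ler_wpM2r ?cabs_ge0// ler_nat.
  have := cexp_second_order (le_trans kh Nh); rewrite -csemiE => h.
  have := cabsD (csemi z k - 1 - (- (k%:R * z))) (- (k%:R * z)).
  rewrite subrK cabsB => /le_trans; apply.
  have := cabs_ge0 (- (k%:R * z)); move: h kh; nra.
have : Q * cabs z <= complex.Re e by rewrite mulrC -ler_pdivlMr// ltW.
apply: le_trans; rewrite /Q.
have := mulr_ge0 (ler0n R N) (cabs_ge0 z); have := cabs_ge0 z; nra.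
Qed.

Lemma analytic_extension (theta : R) :
  (forall z : R[i], sector theta z -> 0 < complex.Re z) ->
  bounded_analytic_extension (E := E) theta walsh_semigroup S.
Proof.
move=> sRe; split.
- by move=> t t0 f; exact: (@eq_mult R X N (csemi t%:C) (semi t) f (fun k _ => csemi_real t k)).
- split; first by move=> z _; exact: mulop_linear.
  exists (1 * W) => z sz f; apply: rnorm_mulop => // k _.
  by apply: cabs_csemi; rewrite ltW// sRe.
- exact: mulop_csemi_holomorphic.
- by move=> z w _ _ _ f; rewrite /= /mulop multM; apply: eq_mult => k _; exact: csemiD.
- by move=> f; exact: mulop_csemi_continuous0.
Qed.

Lemma R_bound_multipliers (F : set (E -> E)) (I : Type) (D : set I) (m : I -> nat -> R[i])
    (K : R) : 0 <= K -> F `<=` (fun i => mulop (m i)) @` D ->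
  (forall n (i : 'I_n -> I), (forall j, D (i j)) -> rb X p1 N (fun j => m (i j)) K) ->
  (R_bound F <= K%:E)%E.
Proof.
move=> K0 FD h; apply: ereal_inf_lbound; exists K => //.
apply: R_bounded_by_radnorm => //.
  by move=> _ /FD[i _ <-]; exact: mulop_bounded.
move=> n T u DT.
have /choice[i hi] j : exists i, D i /\ mulop (m i) = T j.
  by have [i Di e] := FD _ (DT j); exists i.
have := h n i (fun j => (hi j).1) u.
by rewrite (eq_rad (fun j => congr1 (@^~ (u j)) (hi j).2)).
Qed.

End AnalyticExtension.

(** * Polar form and the resolvents of the number operator *)

Section Polar.
Context {R : realType}.

Lemma polar (z : R[i]) : z != 0 ->
  exists phi : R, `|phi| <= pi /\ z = (cabs z)%:C * cis phi.
Proof.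
move=> z0; pose r := cabs z; have r0 : 0 < r by rewrite lt_def cabs_eq0 z0 cabs_ge0.
pose a := complex.Re z / r; pose b := complex.Im z / r.
have ab : a ^+ 2 + b ^+ 2 = 1.
  rewrite /a /b !expr_div_n -mulrDl.
  have -> : complex.Re z ^+ 2 + complex.Im z ^+ 2 = r ^+ 2.
    rewrite /r /cabs normc_def /= sqr_sqrtr// addr_ge0 ?sqr_ge0//.
  by rewrite divff// expf_neq0// gt_eqF.
have a1 : -1 <= a <= 1.
  have : a ^+ 2 <= 1 by rewrite -ab lerDl sqr_ge0.
  by move=> h; apply/andP; split; nra.
have [/andP[phi0 phipi] cphi] := acos_def a1.
have sphi : sin (acos a) = `|b| by rewrite sin_acos// -ab addrC addKr sqrtr_sqr.
have zE : z = r%:C * (a +i* b).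
  have -> : r%:C * (a +i* b) = (r * a) +i* (r * b) by simpc.
  by rewrite /a /b ![r * _]mulrC !divfK ?gt_eqF//; case: (z).
have [b0|b0] := leP 0 b.
  exists (acos a); rewrite ger0_norm//; split => //.
  by rewrite {1}zE /cis cphi sphi ger0_norm.
exists (- acos a); rewrite normrN ger0_norm//; split => //.
by rewrite {1}zE /cis cosN sinN cphi sphi ltr0_norm// opprK.
Qed.

Lemma sector_cis (theta r phi : R) : 0 < r -> `|phi| < theta -> sector theta (r%:C * cis phi).
Proof. by move=> r0 h; exists r, phi; split => //; rewrite /cis; simpc. Qed.

Lemma closed_sector0 (theta : R) : 0 < theta -> closed_sector theta 0.
Proof.
move=> t0 U /nbhs_ballP[e /= e0 eU]; have [eR eE] : 0 < complex.Re e /\ e = (complex.Re e)%:C.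
  have eE : e = (complex.Re e)%:C by rewrite RRe_real// gtr0_real.
  by split => //; rewrite -ltcR -eE.
exists (complex.Re e / 2)%:C; split.
  exists (complex.Re e / 2), 0; rewrite normr0 cos0 sin0 mulr0 mulr1.
  by split => //; rewrite divr_gt0.
apply: eU; rewrite /ball /= sub0r normrN cabsE cabs_real eE ltcR ger0_norm ?divr_ge0 ?ltW//.
by rewrite ltr_pdivrMr// mulr2n; lra.
Qed.

Lemma sector_sub (theta theta' : R) : theta <= theta' -> sector theta `<=` sector theta'.
Proof.
by move=> h z [r [phi [r0 p ->]]]; exists r, phi; split => //; exact: lt_le_trans h.
Qed.

Lemma cos_lower (a x : R) : 0 <= a -> a <= pi / 2 -> `|x| <= pi / 2 - a -> sin a <= cos x.
Proof.
move=> a0 a1 xa; have pi0 := @pi_gt0 R.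
have -> : sin a = cos (pi / 2 - a) by rewrite -cosBpihalf -cosN opprB.
have -> : cos x = cos `|x| by case: (ger0P x) => // _; rewrite cosN.
have x0 := normr_ge0 x.
by rewrite leNgt ltr_cos ?in_itv/= -?leNgt//; apply/andP; split; lra.
Qed.

(* The direction d turns - l into the half-plane by a quarter of the angle
   theta of the sector of analyticity. *)
Lemma rotated_polar (theta : R) (l : R[i]) : 0 < theta < pi / 2 ->
  ~ closed_sector (pi / 2 - theta / 4) l ->
  exists r v d, [/\ 0 < r, cabs v = 1, sin (theta / 4) <= complex.Re v,
    d = cis (theta / 2) \/ d = cis (- (theta / 2)) & - l = r%:C * v / d].
Proof.
move=> /andP[t0 t1] nl; have pi0 := @pi_gt0 R.
have l0 : l != 0.
  by apply/eqP => l0; apply: nl; rewrite l0; apply: closed_sector0; lra.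
have [phi [phipi lE]] := polar l0; set r := cabs l in lE.
have r0 : 0 < r by rewrite lt_def cabs_eq0 l0 cabs_ge0.
have hphi : pi / 2 - theta / 4 <= `|phi|.
  rewrite leNgt; apply/negP => h; apply: nl; apply: subset_closure.
  by rewrite lE; exact: sector_cis.
have cis_neq0 (y : R) : cis y != 0 by rewrite -cabs_eq0 cabs_cis oner_eq0.
have cisDpi (y : R) : cis (y + pi) = - cis y.
  by rewrite /cis cosDpi sinDpi; simpc.
(* The argument of - l is phi - pi or phi + pi, of modulus at most pi/2 + theta/4. A turn by theta/2
   towards the positive axis brings it within pi/2 - theta/4, where the cosine is at least
   sin(theta/4). *)
have [p0|p0] := leP 0 phi.
  exists r, (cis (phi - pi + theta / 2)), (cis (theta / 2)); split => //.
  - exact: cabs_cis.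
  - rewrite /cis /=; apply: cos_lower; try lra.
    by move: phipi hphi; rewrite ger0_norm// ler_norml => h1 h2; apply/andP; split; lra.
  - by left.
  - have cE : cis phi = - cis (phi - pi) by rewrite -cisDpi subrK.
    by rewrite cisD mulrA mulfK// {1}lE cE mulrN opprK.
exists r, (cis (phi + pi - theta / 2)), (cis (- (theta / 2))); split => //.
- exact: cabs_cis.
- rewrite /cis /=; apply: cos_lower; try lra.
  by move: phipi hphi; rewrite ltr0_norm// ler_norml => h1 h2; apply/andP; split; lra.
- by right.
- by rewrite cisD mulrA mulfK// {1}lE cisDpi mulrN.
Qed.

End Polar.

Section Sectorial.
Context {R : realType} {X : normedModType R[i]} {p : R} (p1 : 1 < p) {N : nat}.
Local Notation E := (Lp_cube X p1 N).
Local Notation A := (walsh_number : E -> E).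

Lemma walsh_numberE (f : E) : A f = mulop (fun k => k%:R) f.
Proof. by []. Qed.

Section Resolvent.
Variable l : R[i].
Hypothesis lk : forall k : nat, l - k%:R != 0.
Let G : E -> E := mulop (fun k => (l - k%:R)^-1).

Let multiplier_sub (m : nat -> R[i]) (f : E) :
  l *: (mulop m f : E) - A (mulop m f) = mulop (fun k => (l - k%:R) * m k) f.
Proof.
rewrite -[l *: _](@multZl R X N l) walsh_numberE {2}/mulop [X in _ - X]multM.
by rewrite mulopB; apply: eq_mult => k _; rewrite mulrBl.
Qed.

Lemma resolvent_sub (f : E) : l *: G f - A (G f) = f.
Proof.
rewrite multiplier_sub -[RHS](@mult1 R X N); apply: eq_mult => k _.
by rewrite mulfV.
Qed.

Lemma sub_resolvent (f : E) : G (l *: f - A f) = f.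
Proof.
rewrite -[in X in G X](@mult1 R X N f) multiplier_sub.
rewrite /G /mulop multM -[RHS](@mult1 R X N); apply: eq_mult => k _.
by rewrite mulr1 mulVf.
Qed.

Lemma is_resolvent_mulop : is_resolvent A l G.
Proof.
by split; [exact: mulop_bounded|exact: resolvent_sub|exact: sub_resolvent].
Qed.

Lemma is_resolvent_unique (B : E -> E) : is_resolvent A l B -> B =1 G.
Proof. by move=> [_ _ h] f; rewrite -{1}(resolvent_sub f) h. Qed.

End Resolvent.

(** With - l = r v / d, the symbol l/(l - k) becomes v/(v + k d/r), to which the Laplace bound
    applies. The denominator has real part at least sin(theta/4), so [l] avoids all eigenvalues. *)
Lemma rb_resolvent_sector (rho K theta : R) n (l : 'I_n -> R[i]) :
  0 < rho -> 0 <= K -> 0 < theta < pi / 2 ->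
  (forall phi, `|phi| < theta -> 0 < cos phi /\ 2 * `|sin phi| <= rho * cos phi) ->
  (forall m (z : 'I_m -> R[i]), (forall j, 0 < complex.Re (z j)) ->
     (forall j, 2 * `|complex.Im (z j)| <= rho * complex.Re (z j)) ->
     rb X p1 N (fun j => csemi (z j)) K) ->
  (forall j, ~ closed_sector (pi / 2 - theta / 4) (l j)) ->
  (forall j (k : nat), l j - k%:R != 0) /\
  rb X p1 N (fun j k => l j / (l j - k%:R)) (2 * K / sin (theta / 4)).
Proof.
move=> rho0 K0 th hth hZ nl; have pi0 := @pi_gt0 R.
have [t0 t1] := andP th.
have c0 : 0 < sin (theta / 4) by apply: sin_gt0_pi; lra.
have /choice[w hw] j : exists w : R * (R[i] * R[i]),
    [/\ 0 < w.1, cabs w.2.1 = 1, sin (theta / 4) <= complex.Re w.2.1,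
    w.2.2 = cis (theta / 2) \/ w.2.2 = cis (- (theta / 2)) &
    - l j = w.1%:C * w.2.1 / w.2.2].
  by have [r [v [d h]]] := rotated_polar th (nl j); exists (r, (v, d)).
pose r j := (w j).1; pose v j := (w j).2.1; pose d j := (w j).2.2.
have half : `|theta / 2| < theta by rewrite ger0_norm; lra.
have dP j : [/\ cabs (d j) = 1, 0 < complex.Re (d j) &
    2 * `|complex.Im (d j)| <= rho * complex.Re (d j)].
  have [h1 h2] := hth _ half.
  have [_ _ _ + _] := hw j; rewrite -/(d j) => -[] -> /=; split; rewrite ?cabs_cis//.
  - by rewrite cosN.
  - by rewrite cosN sinN normrN.
have d_neq0 j : d j != 0 by have [d1 _ _] := dP j; rewrite -cabs_eq0 d1 oner_eq0.
have rC j : (r j)%:C != 0 :> R[i].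
  by have [r0 _ _ _ _] := hw j; rewrite -cabs_eq0 cabs_real gtr0_norm// gt_eqF.
have lE j : l j = - ((r j)%:C * v j / d j) by have [_ _ _ _ <-] := hw j; rewrite opprK.
have vk j (k : nat) : v j + k%:R * d j / (r j)%:C != 0.
  apply/eqP => e; have [r0 _ cv _ _] := hw j.
  have [_ d0 _] := dP j.
  have : 0 < complex.Re (v j + k%:R * d j / (r j)%:C).
    rewrite (lt_le_trans c0)//; apply: le_trans cv _.
    rewrite -fmorphV -(rmorph_nat (real_complex R)).
    have : 0 <= k%:R * complex.Re (d j) / r j by rewrite divr_ge0 ?mulr_ge0// ltW.
    by rewrite /v; case: (w j).2.1 => a b; case: (d j) => a' b' /=; simpc => /=; rewrite lerDl.
  by rewrite e ltxx.
have lkE j (k : nat) : l j - k%:R = - ((r j)%:C / d j) * (v j + k%:R * d j / (r j)%:C).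
  by rewrite lE; field; rewrite d_neq0 rC.
split=> [j k|].
  by rewrite lkE mulf_neq0// oppr_eq0 mulf_neq0// invr_eq0.
apply: rb_ext (@rb_resolvent R X p p1 N rho K K0 hZ n (sin (theta / 4)) v d r c0 _ _ _ _ _ _).
- move=> j k _; rewrite lkE {1}lE; have := vk j k.
  set y := v j + _ => y0; field.
  by rewrite y0 d_neq0 rC.
- by move=> j; have [] := hw j.
- by move=> j; have [] := hw j.
- by move=> j; have [] := hw j.
- by move=> j; have [] := dP j.
- by move=> j; have [] := dP j.
- by move=> j; have [] := dP j.
Qed.

End Sectorial.

Theorem theorem6p1 (R : realType) (X : completeNormedModType R[i])
    (p : R) (p1 : 1 < p) (umdX : UMD X) :
  (exists theta C : R, [/\ 0 < theta < pi / 2, 0 <= C &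
     forall N : nat, (1 <= N)%N ->
       exists S : R[i] -> Lp_cube X p1 N -> Lp_cube X p1 N,
         bounded_analytic_extension (E := Lp_cube X p1 N)
           theta walsh_semigroup S /\
         (R_bound (S @` sector theta) <= C%:E)%E]) /\
  (exists omega : R, 0 < omega < pi / 2 /\
     uniformly_R_sectorial (E := fun N : nat => Lp_cube X p1 N.+1)
       (fun N : nat => walsh_number) omega).
Proof.
have [rho [K [rho0 K0 hZ]]] := UMD_rb_csemi p1 umdX.
have [theta th hth] := small_angle rho0.
have [t0 t1] := andP th; have pi0 := @pi_gt0 R.
have sRe (z : R[i]) : sector theta z -> 0 < complex.Re z.
  by apply: sector_Re => phi /hth[].
split.
  exists theta, K; split => // N _.
  exists (fun z => mulop (csemi z)); split; first exact: analytic_extension.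
  apply: (R_bound_multipliers K0 (@subset_refl _ _)) => n z sz.
  apply: hZ => j; first exact: sRe.
  by apply: sector_Im (sz j) => phi /hth[].
have hsec N n (l : 'I_n -> R[i]) := @rb_resolvent_sector R X p p1 N rho K theta n l
  rho0 K0 th hth (hZ N).
(* The ray is turned by theta/2 and only theta/4 of this is spent on the angle; the remaining
   theta/4 is the margin behind sin(theta/4). *)
exists (pi / 2 - theta / 4); split; first by apply/andP; split; lra.
have c0 : 0 < sin (theta / 4) by apply: sin_gt0_pi; lra.
split=> [N l specl|theta' /andP[ht' _]].
  apply: contrapT => nl; apply: specl.
  (* A tuple of length one, used for the fact that l - k never vanishes. *)
  have [lk _] := hsec N.+1 1%N (fun=> l) (fun=> nl).
  by exists (mulop (fun k => (l - k%:R)^-1)); apply: is_resolvent_mulop => k; exact: (lk ord0).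
have out (l : R[i]) : ~ closed_sector theta' l -> ~ closed_sector (pi / 2 - theta / 4) l.
  by apply: contra_not; apply: closure_subset; apply: sector_sub; exact: ltW.
(* The same constant serves every theta', since the complement of the larger sector lies in that of
   the smaller one. *)
exists (2 * K / sin (theta / 4)) => N.
apply: (@R_bound_multipliers R X p p1 N.+1 _ R[i] (~` closed_sector theta')
  (fun l k => l / (l - k%:R))).
- by rewrite divr_ge0 ?mulr_ge0// ltW.
- move=> T [l [B [nl resB ->]]]; exists l => //.
  have [lk _] := hsec N.+1 1%N (fun=> l) (fun=> out _ nl).
  apply/funext => f; rewrite (is_resolvent_unique (lk ord0) resB).
  by rewrite -[l *: _](@multZl R X N.+1 l).
- by move=> n l nl; have [] := hsec N.+1 n l (fun j => out _ (nl j)).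
Qed.
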